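(* Consider a whole plane Spectre tiling. To every yellow hex $h$ associate: its dot $b_h\in c\Lambda$, a vertex of $HB$; the centre $y_h\in\Lambda$ of the associated hexagon of $HY$; and the vertex $g_h\in c\Lambda$ of $HG$ associated to the yellow cluster that contains $h$. Choose any yellow hex $h_0$ as a reference. Then for every yellow hex $h$, $$b_h-b_{h_0}=3\,(y_h-y_{h_0})+\rho^2\,(g_h-g_{h_0}).$$
   Context: Notation: $\rho=e^{2\pi i/6}$, $c=1/(1+\rho)$, $\Lambda=\mathbb Z+\rho\mathbb Z\subset\mathbb C$. A honeycomb is a tessellation of the plane by regular hexagons. $HB,HY,HG$ denote three copies (blue, yellow, green) of the honeycomb whose hexagons have their centres at the points of $\Lambda$; their edges are of the form $\rho^kc$ and their vertices lie in $c\Lambda$. The Spectre is the closed polygon with successive vertices $P_0=(0,0),P_1,\dots,P_{13}$ obtained by 14 unit steps starting at $P_0$ in the directions (in degrees) $0,60,330,270,0,300,210,150,240,180,180,120,30,90$ (so the angle at $P_{10}$ is flat). A whole plane Spectre tiling is a covering of the plane by images of the Spectre under orientation-preserving isometries (no reflections), with pairwise disjoint interiors. Any two tiles differ in orientation by a multiple of $30^\circ$; they have the same parity if they differ by a multiple of $60^\circ$. Exactly one parity class has the property that no two of its tiles share an edge; its tiles are called odd, the others even. Let $p=\left(\tfrac{3-\sqrt3}{2},-\tfrac{1+\sqrt3}{2}\right)$. The hex of the tile is the regular hexagon with vertices $P_1,P_3,P_5,P_7,P_9,p$ and its rhomb is the rhombus with vertices $P_1,p,P_{11},P_{13}$. Transporting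 these to every tile, the sides of all hexes and rhombs form the decoration graph, whose faces are the hexes, the rhombs and squares; all its edges have the same length. An edge is blue if it is parallel to a side of the hex of an even tile, yellow otherwise. Hexes of even tiles are blue, hexes of odd tiles are yellow. Apply an orientation-preserving similarity to the tiling so that decoration edges have length $1/\sqrt3=|c|$ and blue edges are parallel to vectors $\rho^kc$, $k\in\mathbb Z$. Let $b$ be the map from decoration vertices to $\mathbb C$ with $b(v')-b(v)=v'-v$ if $vv'$ is a blue edge and $0$ if it is yellow; let $y$ be the map with $y(v')-y(v)=e^{-i\pi/6}(v'-v)$ if $vv'$ is a yellow edge and $0$ if it is blue. Both are well defined up to additive constants, which are chosen so that $b$ sends blue hexes to hexagons of $HB$ and $y$ sends yellow hexes to hexagons of $HY$ (this gives bijective correspondences). For a yellow hex $h$, $b$ takes a single value $b_h$ on the vertices of $h$ (a vertex of $HB$, called the dot of $h$), and $y_h\in\Lambda$ is the centre of the hexagon $y(h)$ of $HY$. For two yellow hexes $h,h'$ with $|y_{h'}-y_h|=1$, there is an interface between them, of $\mathrm V$-type if $|b_{h'}-b_h|^2=9$ and of $\mathrm I$-type if $|b_{h'}-b_h|^2=19/3$. Yellow clusters are the equivalence classes of yellow hexes for the relation generated by $\mathrm V$-type interfaces. Two yellow clusters are adjacent if they contain yellow hexes linked by an $\mathrm I$-type interface. The association of a vertex of $HG$ to each yellow cluster is a bijection $C\mapsto G(C)$ from the set of yellow clusters to the set of vertices of $HG$ such that adjacent clusters correspond to adjacent vertices, and such that whenever $h\in C$ and $h'\in C'$ are linked by an $\mathrm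 I$-type interface, $G(C')-G(C)$ has the direction of $e^{i\pi/6}(y_{h'}-y_h)$ (such a bijection exists). For $h\in C$, $g_h=G(C)$. *)

(* Defs.v *)
(* The plane is C = R * R. *)
From Stdlib Require Import Reals ZArith List Relation_Operators.
From Coquelicot Require Import Coquelicot.
Import ListNotations.
Open Scope R_scope.

Definition cis (theta : R) : C := (cos theta, sin theta).

Definition rho : C := cis (2 * PI / 6).
Definition c : C := (/ (RtoC 1 + rho))%C.

Definition Lambda (z : C) : Prop :=
  exists m n : Z, z = (RtoC (IZR m) + rho * RtoC (IZR n))%C.

Definition parallel (u v : C) : Prop :=
  exists r : R, r <> 0 /\ u = (RtoC r * v)%C.

Definition same_direction (u v : C) : Prop :=
  exists r : R, 0 < r /\ u = (RtoC r * v)%C.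

(* [v] and [w] are the ends, in either order, of a side of the closed polygon
   whose successive vertices are listed in [l]. *)
Definition side (l : list C) (v w : C) : Prop :=
  exists k : nat, (k < length l)%nat /\
    let x := nth k l (RtoC 0) in
    let x' := nth (S k mod length l) l (RtoC 0) in
    (v = x /\ w = x') \/ (v = x' /\ w = x).

Definition polygon_boundary (l : list C) (z : C) : Prop :=
  exists v w : C, side l v w /\
    exists s : R, 0 <= s <= 1 /\ z = (v + RtoC s * (w - v))%C.

(* The closed region bounded by a simple closed polygon: the points from which
   no path goes to infinity without meeting the boundary.  Boundary points
   qualify, since the time [0] is included. *)
Definition polygon_region (l : list C) (z : C) : Prop :=
  forall gamma : R -> C,
    (forall t : R, continuous gamma t) ->
    gamma 0 = z ->
    filterlim (fun t => Cmod (gamma t))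
      (Rbar_locally p_infty) (Rbar_locally p_infty) ->
    exists t : R, 0 <= t /\ polygon_boundary l (gamma t).

(* The honeycomb with hexagons centred at [Lambda]; the three copies HB, HY
   and HG are the same subset of the plane. *)

Definition honeycomb_hexagon (l : C) : list C :=
  map (fun k => (l + rho ^ k * c)%C) (seq 0 6).

Definition honeycomb_vertex (z : C) : Prop :=
  exists l : C, Lambda l /\ In z (honeycomb_hexagon l).

Definition honeycomb_edge (z z' : C) : Prop :=
  exists l : C, Lambda l /\ side (honeycomb_hexagon l) z z'.


Definition spectre_directions : list R :=
  [0; 60; 330; 270; 0; 300; 210; 150; 240; 180; 180; 120; 30; 90].

Fixpoint P (k : nat) : C :=
  match k with
  | O => RtoC 0
  | S j => (P j + cis (nth j spectre_directions 0 * PI / 180))%C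
  end.

Definition spectre : list C := map P (seq 0 14).

Definition p : C := ((3 - sqrt 3) / 2, - ((1 + sqrt 3) / 2)).

Definition spectre_hex : list C := [P 1; P 3; P 5; P 7; P 9; p].
Definition spectre_rhomb : list C := [P 1; p; P 11; P 13].

(* The orientation-preserving similarity z |-> lin * z + off.  The Spectre has
   no symmetry, so a tile is identified with the map placing it. *)
Record placement : Type := Placement { lin : C; off : C }.

Definition act (t : placement) (z : C) : C := (lin t * z + off t)%C.

Definition compose (s t : placement) : placement :=
  Placement (lin s * lin t)%C (act s (off t)).

Definition tile_region (t : placement) (z : C) : Prop :=
  exists w : C, polygon_region spectre w /\ z = act t w.

Definition tile (t : placement) : list C := map (act t) spectre.
Definition hex (t : placement) : list C := map (act t) spectre_hex.
Definition rhomb (t : placement) : list C := map (act t) spectre_rhomb.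

Definition spectre_tiling (T : placement -> Prop) : Prop :=
  (forall t, T t -> Cmod (lin t) = 1) /\
  (forall z : C, exists t, T t /\ tile_region t z) /\
  (forall t t', T t -> T t' -> t <> t' ->
     ~ exists z : C, locally z (tile_region t) /\ locally z (tile_region t')).

Definition image_tiling (s : placement) (T : placement -> Prop)
    (t' : placement) : Prop :=
  exists t, T t /\ t' = compose s t.

Definition same_parity (t t' : placement) : Prop :=
  exists k : nat, lin t' = (lin t * rho ^ k)%C.

Definition share_edge (t t' : placement) : Prop :=
  exists v w : C, side (tile t) v w /\ side (tile t') v w.

(* The parity class of [t] is the one in which no two tiles share an edge. *)
Definition odd (D : placement -> Prop) (t : placement) : Prop :=
  D t /\
  forall t1 t2, D t1 -> D t2 -> same_parity t t1 -> same_parity t t2 ->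
    t1 <> t2 -> ~ share_edge t1 t2.

Definition even (D : placement -> Prop) (t : placement) : Prop :=
  D t /\ ~ odd D t.


Definition decoration_edge (D : placement -> Prop) (v w : C) : Prop :=
  exists t, D t /\ (side (hex t) v w \/ side (rhomb t) v w).

Definition blue_edge (D : placement -> Prop) (v w : C) : Prop :=
  decoration_edge D v w /\
  exists t x x', even D t /\ side (hex t) x x' /\
    parallel (w - v)%C (x' - x)%C.

Definition yellow_edge (D : placement -> Prop) (v w : C) : Prop :=
  decoration_edge D v w /\ ~ blue_edge D v w.

Definition normalised (D : placement -> Prop) : Prop :=
  (forall v w, decoration_edge D v w -> Cmod (w - v)%C = 1 / sqrt 3) /\
  (forall v w, blue_edge D v w ->
     exists k : nat, parallel (w - v)%C (rho ^ k * c)%C).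

(* A hex is represented by the tile that carries it. *)
Definition blue_hex : (placement -> Prop) -> placement -> Prop := even.
Definition yellow_hex : (placement -> Prop) -> placement -> Prop := odd.

Definition maps_hex_to (f : C -> C) (h : placement) (l : C) : Prop :=
  Lambda l /\
  forall z : C, In z (map f (hex h)) <-> In z (honeycomb_hexagon l).

(* The maps [b] and [y] are total functions on the plane, but only their values
   at decoration vertices are constrained. *)

Definition is_b (D : placement -> Prop) (b : C -> C) : Prop :=
  (forall v w, blue_edge D v w -> (b w - b v = w - v)%C) /\
  (forall v w, yellow_edge D v w -> (b w - b v = RtoC 0)%C) /\
  (forall h, blue_hex D h -> exists l : C, maps_hex_to b h l).

Definition is_y (D : placement -> Prop) (y : C -> C) : Prop :=
  (forall v w, yellow_edge D v w -> (y w - y v = cis (- (PI / 6)) * (w - v))%C) /\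
  (forall v w, blue_edge D v w -> (y w - y v = RtoC 0)%C) /\
  (forall h, yellow_hex D h -> exists l : C, maps_hex_to y h l).

Definition is_dot (b : C -> C) (h : placement) (z : C) : Prop :=
  forall v, In v (hex h) -> b v = z.

(* Below, [bh] gives the dots and [yh] the centres of the yellow hexes. *)

Definition neighbours (D : placement -> Prop) (yh : placement -> C)
    (h h' : placement) : Prop :=
  yellow_hex D h /\ yellow_hex D h' /\ Cmod (yh h' - yh h)%C = 1.

Definition V_interface (D : placement -> Prop) (bh yh : placement -> C)
    (h h' : placement) : Prop :=
  neighbours D yh h h' /\ Cmod (bh h' - bh h)%C ^ 2 = 9.

Definition I_interface (D : placement -> Prop) (bh yh : placement -> C)
    (h h' : placement) : Prop :=
  neighbours D yh h h' /\ Cmod (bh h' - bh h)%C ^ 2 = 19 / 3.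

Definition cluster_of (D : placement -> Prop) (bh yh : placement -> C)
    (h : placement) : placement -> Prop :=
  fun h' => yellow_hex D h' /\
    clos_refl_sym_trans placement (V_interface D bh yh) h h'.

Definition yellow_cluster (D : placement -> Prop) (bh yh : placement -> C)
    (K : placement -> Prop) : Prop :=
  exists h, yellow_hex D h /\ K = cluster_of D bh yh h.

Definition adjacent_clusters (D : placement -> Prop) (bh yh : placement -> C)
    (K K' : placement -> Prop) : Prop :=
  exists h h', K h /\ K' h' /\ I_interface D bh yh h h'.

Definition is_G (D : placement -> Prop) (bh yh : placement -> C)
    (G : (placement -> Prop) -> C) : Prop :=
  let cluster := yellow_cluster D bh yh in
  (forall K, cluster K -> honeycomb_vertex (G K)) /\
  (forall K K', cluster K -> cluster K' -> G K = G K' -> K = K') /\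
  (forall z, honeycomb_vertex z -> exists K, cluster K /\ G K = z) /\
  (forall K K', cluster K -> cluster K' -> adjacent_clusters D bh yh K K' ->
     honeycomb_edge (G K) (G K')) /\
  (forall K K' h h', cluster K -> cluster K' -> K h -> K' h' ->
     I_interface D bh yh h h' ->
     same_direction (G K' - G K)%C (cis (PI / 6) * (yh h' - yh h))%C).

(* Main.v *)
(* Write positions in Z[zeta] with zeta = exp (i pi / 6). Blue and yellow edges span two
   complementary lattices of rank 2, so the displacement between two decoration vertices
   determines the increments of b and y. The identity says that
   b_h - 3 y_h - rho^2 g_h is constant, and it is preserved between two odd tiles
   whose hex centres differ by one of twelve vectors: those with y-increment a unit u and
   b-increment 3 u (a V-type interface, where g does not change) or
   3 u + exp (5 i pi / 6) u / sqrt 3 (an I-type interface, where g moves by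
   exp (i pi / 6) u / sqrt 3). It remains to see that these steps connect all the odd tiles.

   Every tiling is side to side: a fractional offset between two sides would produce
   right-angled corners at both ends of a side, and no side has two. Hence all tiles have
   positions in Z[zeta] and are connected through shared sides. A backtracking search then
   shows that two tiles sharing a side are in one of 27 relative positions, that every tile
   lies in a nine-tile cluster around some odd tile, and that odd tiles with neighbouring
   clusters are joined by a chain of steps. *)

(* The formal hypotheses do not say that tiles meet along whole sides, nor that they are rotated by
   multiples of 30 degrees, so the first obstacle is topological. The region of the Spectre, defined
   by paths, is never computed: it is caught between the open set [sS] and the closed set [inS], and
   star-shapedness makes up for the difference. Contact along a side is detected with parabolic arcs
   tangent to it, because a straight ray along a side cannot tell its two sides apart.

   The search trees are certificates found beforehand. Only the soundness of the checker matters, so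
   every numerical test may be one-sided: a missed overlap can make a check fail, but cannot make a
   false conclusion pass.

   The search knows oddness only through one fact: tiles turned by an even multiple of 30 degrees
   from the reference odd tile do not share sides. That the remaining tiles are not odd is a result,
   drawn from two tiles of a forced cluster that share a side. *)
Require Import Defs.
From Stdlib Require Import Reals ZArith List Relation_Operators Lra Lia Psatz Bool Classical
  Permutation.
From Coquelicot Require Import Coquelicot.
Import ListNotations.
Open Scope R_scope.

(** * Arithmetic in Z[zeta_12] *)

(** Coordinates in the basis 1, zeta, zeta^2, zeta^3, where zeta = exp (i pi / 6) satisfies zeta^4 =
    zeta^2 - 1. *)
Definition zz : Type := (Z * Z * Z * Z)%type.

Definition zadd (a b : zz) : zz :=
  let '(a0, a1, a2, a3) := a in let '(b0, b1, b2, b3) := b in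
  (a0 + b0, a1 + b1, a2 + b2, a3 + b3)%Z.
Definition zscale (n : Z) (a : zz) : zz :=
  let '(a0, a1, a2, a3) := a in (n * a0, n * a1, n * a2, n * a3)%Z.
Definition zsub (a b : zz) : zz := zadd a (zscale (-1) b).
(** [c4], [c5], [c6] are the coefficients of zeta^4 = zeta^2 - 1, zeta^5 = zeta^3 - zeta and zeta^6
    = -1. *)
Definition zmul (a b : zz) : zz :=
  let '(a0, a1, a2, a3) := a in let '(b0, b1, b2, b3) := b in
  let c4 := (a1 * b3 + a2 * b2 + a3 * b1)%Z in
  let c5 := (a2 * b3 + a3 * b2)%Z in
  let c6 := (a3 * b3)%Z in
  (a0 * b0 - c4 - c6, a0 * b1 + a1 * b0 - c5,
   a0 * b2 + a1 * b1 + a2 * b0 + c4, a0 * b3 + a1 * b2 + a2 * b1 + a3 * b0 + c5)%Z.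
Definition zconj (a : zz) : zz :=
  let '(a0, a1, a2, a3) := a in (a0 + a2, a1, - a2, - a1 - a3)%Z.
Definition zzero : zz := (0, 0, 0, 0)%Z.
Definition zone : zz := (1, 0, 0, 0)%Z.
Definition zzeta : zz := (0, 1, 0, 0)%Z.
Fixpoint zeta (k : nat) : zz :=
  match k with O => zone | S j => zmul zzeta (zeta j) end.

Definition zz_eqb (a b : zz) : bool :=
  let '(a0, a1, a2, a3) := a in let '(b0, b1, b2, b3) := b in
  (a0 =? b0)%Z && (a1 =? b1)%Z && (a2 =? b2)%Z && (a3 =? b3)%Z.

Lemma zz_eqb_eq (a b : zz) : zz_eqb a b = true <-> a = b.
Proof.
  destruct a as [[[a0 a1] a2] a3], b as [[[b0 b1] b2] b3]; simpl.
  rewrite !andb_true_iff, !Z.eqb_eq. split; [intros [[[-> ->] ->] ->]; easy|].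
  intros E; injection E; auto.
Qed.

Definition q3 : R := sqrt 3.
Lemma q3_sq : q3 * q3 = 3.
Proof. apply sqrt_sqrt; lra. Qed.
Lemma q3_pos : 0 < q3.
Proof. apply sqrt_lt_R0; lra. Qed.

Definition ev (a : zz) : C :=
  let '(a0, a1, a2, a3) := a in
  (IZR a0 + IZR a1 * q3 / 2 + IZR a2 / 2, IZR a1 / 2 + IZR a2 * q3 / 2 + IZR a3).

Ltac destr_zz a :=
  let a0 := fresh a in let a1 := fresh a in let a2 := fresh a in let a3 := fresh a in
  destruct a as [[[a0 a1] a2] a3].

Lemma ev_add (a b : zz) : ev (zadd a b) = (ev a + ev b)%C.
Proof.
  destr_zz a; destr_zz b; apply injective_projections; simpl;
    rewrite !plus_IZR; field.
Qed.

Lemma ev_scale (n : Z) (a : zz) : ev (zscale n a) = (RtoC (IZR n) * ev a)%C.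
Proof.
  destr_zz a; apply injective_projections; simpl; rewrite !mult_IZR; field.
Qed.

Lemma ev_sub (a b : zz) : ev (zsub a b) = (ev a - ev b)%C.
Proof. unfold zsub. rewrite ev_add, ev_scale. simpl. ring. Qed.

Lemma ev_mul (a b : zz) : ev (zmul a b) = (ev a * ev b)%C.
Proof.
  pose proof q3_sq as Hq.
  destr_zz a; destr_zz b; apply injective_projections; simpl;
    rewrite ?plus_IZR, ?minus_IZR, ?plus_IZR, ?mult_IZR;
    rewrite ?plus_IZR, ?minus_IZR, ?plus_IZR, ?mult_IZR; field [Hq].
Qed.

Lemma ev_conj (a : zz) : ev (zconj a) = Cconj (ev a).
Proof.
  destr_zz a; apply injective_projections; simpl;
    rewrite ?minus_IZR, ?plus_IZR, ?opp_IZR; field.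
Qed.

Lemma ev_zero : ev zzero = RtoC 0.
Proof. apply injective_projections; simpl; field. Qed.
Lemma ev_one : ev zone = RtoC 1.
Proof. apply injective_projections; simpl; field. Qed.

Lemma zmul_1 (a : zz) : zmul zone a = a.
Proof. destr_zz a; unfold zmul, zone; cbv zeta; repeat apply (f_equal2 pair); ring. Qed.
Lemma zmul_assoc (a b c : zz) : zmul a (zmul b c) = zmul (zmul a b) c.
Proof.
  destr_zz a; destr_zz b; destr_zz c; unfold zmul; cbv zeta; repeat apply (f_equal2 pair); ring.
Qed.
Lemma zmul_add (a b c : zz) : zmul a (zadd b c) = zadd (zmul a b) (zmul a c).
Proof.
  destr_zz a; destr_zz b; destr_zz c; unfold zmul, zadd; cbv zeta; repeat apply (f_equal2 pair);
    ring.
Qed.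
Lemma zeta_add (m n : nat) : zeta (m + n) = zmul (zeta m) (zeta n).
Proof.
  induction m.
  - symmetry; apply zmul_1.
  - cbn [Nat.add zeta]. now rewrite IHm, zmul_assoc.
Qed.
Lemma zeta_12 (k : nat) : zeta (12 + k) = zeta k.
Proof.
  rewrite zeta_add. replace (zeta 12) with zone by reflexivity. apply zmul_1.
Qed.
Lemma zeta_mod (k : nat) : zeta (k mod 12) = zeta k.
Proof.
  rewrite (Nat.div_mod_eq k 12) at 2. generalize (k mod 12)%nat as r, (k / 12)%nat as d.
  intros r d; induction d.
  - now rewrite Nat.mul_0_r.
  - replace (12 * S d + r)%nat with (12 + (12 * d + r))%nat by lia. now rewrite zeta_12.
Qed.

(** * Exact signs in Z[sqrt 3] *)

Definition eval3 (p : Z * Z) : R := IZR (fst p) + IZR (snd p) * q3.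
(** Doubling clears the denominators of the real and imaginary parts. *)
Definition im2 (a : zz) : Z * Z := let '(a0, a1, a2, a3) := a in (a1 + 2 * a3, a2)%Z.
Definition re2 (a : zz) : Z * Z := let '(a0, a1, a2, a3) := a in (2 * a0 + a2, a1)%Z.

Lemma im2_spec (a : zz) : eval3 (im2 a) = 2 * Im (ev a).
Proof. destr_zz a; unfold eval3, Im, im2, ev; cbn [fst snd]. rewrite plus_IZR, mult_IZR. field.
Qed.
Lemma re2_spec (a : zz) : eval3 (re2 a) = 2 * Re (ev a).
Proof. destr_zz a; unfold eval3, Re, re2, ev; cbn [fst snd]. rewrite plus_IZR, mult_IZR. field.
Qed.

(** When a and b have opposite signs, the sign of a + b sqrt 3 comes from comparing a^2 with 3 b^2.
    Soundness is all that the checks below require. *)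
Definition lt0 (p : Z * Z) : bool :=
  let '(a, b) := p in
  ((a <=? 0) && (b <=? 0) && ((a <? 0) || (b <? 0)))%Z
  || ((a <? 0) && (0 <? b) && (3 * (b * b) <? a * a))%Z
  || ((0 <? a) && (b <? 0) && (a * a <? 3 * (b * b)))%Z.
Definition eq0 (p : Z * Z) : bool := ((fst p =? 0) && (snd p =? 0))%Z.
Definition le0 (p : Z * Z) : bool := lt0 p || eq0 p.
Definition opp3 (p : Z * Z) : Z * Z := (- fst p, - snd p)%Z.

Lemma lt0_spec (p : Z * Z) : lt0 p = true -> eval3 p < 0.
Proof.
  destruct p as [a b]; unfold lt0, eval3; cbn [fst snd].
  pose proof q3_sq as Hq. pose proof q3_pos as Hp.
  rewrite !orb_true_iff, !andb_true_iff, !orb_true_iff, !Z.leb_le, !Z.ltb_lt.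
  intros [[[[H1 H2] [H3|H3]]|[[H1 H2] H3]]|[[H1 H2] H3]];
    try apply IZR_le in H1; try apply IZR_lt in H1;
    try apply IZR_le in H2; try apply IZR_lt in H2; apply IZR_lt in H3;
    rewrite ?mult_IZR in H3.
  - nra.
  - nra.
  - assert (0 < (- IZR a - IZR b * q3) * (- IZR a + IZR b * q3)) by nra.
    assert (0 < - IZR a + IZR b * q3) by nra.
    nra.
  - assert (0 < (- IZR b * q3 - IZR a) * (- IZR b * q3 + IZR a)) by nra.
    assert (0 < - IZR b * q3 + IZR a) by nra.
    nra.
Qed.
Lemma eq0_spec (p : Z * Z) : eq0 p = true -> eval3 p = 0.
Proof.
  unfold eq0, eval3. rewrite andb_true_iff, !Z.eqb_eq. intros [-> ->]. ring.
Qed.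
Lemma le0_spec (p : Z * Z) : le0 p = true -> eval3 p <= 0.
Proof.
  unfold le0. rewrite orb_true_iff. intros [H|H];
    [apply lt0_spec in H|apply eq0_spec in H]; lra.
Qed.
Lemma opp3_spec (p : Z * Z) : eval3 (opp3 p) = - eval3 p.
Proof. unfold eval3, opp3; simpl. rewrite !opp_IZR. ring. Qed.

Lemma cis_zeta (k : nat) : cis (INR k * (PI / 6)) = ev (zeta k).
Proof.
  induction k.
  - simpl zeta. rewrite ev_one. unfold cis. simpl INR. rewrite Rmult_0_l, cos_0, sin_0. easy.
  - cbn [zeta]. rewrite ev_mul, <- IHk.
    replace (ev zzeta) with (cis (PI / 6)).
    + rewrite S_INR. replace ((INR k + 1) * (PI / 6)) with (PI / 6 + INR k * (PI / 6)) by ring.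
      unfold cis. rewrite cos_plus, sin_plus. apply injective_projections; simpl; ring.
    + unfold cis. rewrite cos_PI6, sin_PI6. apply injective_projections; simpl; unfold q3; field.
Qed.

Lemma zeta_norm (k : nat) : (Cconj (ev (zeta k)) * ev (zeta k))%C = RtoC 1.
Proof.
  rewrite <- ev_conj, <- ev_mul, <- ev_one. f_equal. induction k; [reflexivity|].
  cbn [zeta]. destruct (zeta k) as [[[a b] c'] d]. revert IHk.
  unfold zmul, zconj, zone, zzeta. intros H. injection H as H0 H1 H2 H3.
  repeat apply (f_equal2 pair); lia.
Qed.

(* Variants of [existsb] and [forallb] that stop early under call by value. *)
Fixpoint anyb {A} (f : A -> bool) (l : list A) : bool :=
  match l with [] => false | a :: l => if f a then true else anyb f l end.
Fixpoint allb {A} (f : A -> bool) (l : list A) : bool :=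
  match l with [] => true | a :: l => if f a then allb f l else false end.
Lemma anyb_exists {A} (f : A -> bool) l : anyb f l = true <-> exists a, In a l /\ f a = true.
Proof.
  rewrite <- existsb_exists. replace (anyb f l) with (existsb f l); [easy|].
  induction l as [|a l IH]; simpl; [easy|]. rewrite IH. now destruct (f a).
Qed.
Lemma allb_forall {A} (f : A -> bool) l : allb f l = true <-> forall a, In a l -> f a = true.
Proof.
  rewrite <- forallb_forall. replace (allb f l) with (forallb f l); [easy|].
  induction l as [|a l IH]; simpl; [easy|]. rewrite IH. now destruct (f a).
Qed.

(** * The Spectre as a region *)

Definition dirs : list nat := [0; 2; 11; 9; 0; 10; 7; 5; 8; 6; 6; 4; 1; 3]%nat.
Definition dir (i : nat) : nat := nth i dirs 0%nat.
Fixpoint walk (k : nat) : zz :=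
  match k with O => zzero | S j => zadd (walk j) (zeta (dir j)) end.
(** The fifteenth point is the return to the origin, so side i runs from [pt i] to [pt (S i)]
    without reduction modulo 14. *)
Definition pts : list zz := Eval vm_compute in map walk (seq 0 15).
Definition pt (k : nat) : zz := nth k pts zzero.
Definition dv (i : nat) : C := ev (zeta (dir i)).

Lemma pt_S (i : nat) : (i < 14)%nat -> pt (S i) = zadd (pt i) (zeta (dir i)).
Proof. intros H. do 14 (destruct i as [|i]; [reflexivity|]). lia. Qed.

Lemma ev_pt_S (i : nat) : (i < 14)%nat -> ev (pt (S i)) = (ev (pt i) + dv i)%C.
Proof. intros H. now rewrite pt_S, ev_add. Qed.

Lemma direction_angle (i : nat) : (i < 14)%nat ->
  nth i spectre_directions 0 * PI / 180 = INR (dir i) * (PI / 6).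
Proof.
  intros H. do 14 (destruct i as [|i]; [simpl; field|]). lia.
Qed.

Lemma P_pt (k : nat) : (k <= 14)%nat -> P k = ev (pt k).
Proof.
  induction k; intros H.
  - symmetry; apply ev_zero.
  - cbn [P]. rewrite IHk, direction_angle, cis_zeta, ev_pt_S by lia. easy.
Qed.

Lemma pt_mod (i : nat) : (i < 14)%nat -> pt (S i mod 14) = pt (S i).
Proof. intros H. do 14 (destruct i as [|i]; [reflexivity|]). lia. Qed.

(* [form (a, b)] is positive to the left of the line from [P a] to [P b];
   the Spectre runs clockwise, so its interior is on the right of its sides. *)
Definition fdir (f : nat * nat) : C := (ev (pt (snd f)) - ev (pt (fst f)))%C.
Definition lform (f : nat * nat) (e : C) : R := Im (Cconj (fdir f) * e)%C.
Definition form (f : nat * nat) (z : C) : R := lform f (z - ev (pt (fst f)))%C.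

Lemma lform_add f u v : lform f (u + v)%C = lform f u + lform f v.
Proof. unfold lform, Im. simpl. ring. Qed.
Lemma lform_scal f r u : lform f (RtoC r * u)%C = r * lform f u.
Proof. unfold lform, Im. simpl. ring. Qed.
Lemma form_add f z e : form f (z + e)%C = form f z + lform f e.
Proof. unfold form. rewrite <- lform_add. f_equal. ring. Qed.
Lemma form_mix f s u v :
  form f (RtoC (1 - s) * u + RtoC s * v)%C = (1 - s) * form f u + s * form f v.
Proof. unfold form, lform, Im. simpl. ring. Qed.

(** Exact version of [form] at the point w / N, multiplied by 2 N to lie in Z[sqrt 3]. *)
Definition zform (f : nat * nat) (N : Z) (w : zz) : Z * Z :=
  im2 (zmul (zconj (zsub (pt (snd f)) (pt (fst f)))) (zsub w (zscale N (pt (fst f))))).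
Definition evq (N : Z) (w : zz) : C := (RtoC (/ IZR N) * ev w)%C.

Lemma evq_1 w : evq 1 w = ev w.
Proof. unfold evq. rewrite Rinv_1. apply injective_projections; simpl; ring. Qed.

Lemma zform_spec f N w : (0 < N)%Z -> eval3 (zform f N w) = 2 * IZR N * form f (evq N w).
Proof.
  intros HN. assert (IZR N <> 0) by (apply not_0_IZR; lia).
  unfold zform. rewrite im2_spec, ev_mul, ev_conj, !ev_sub, ev_scale.
  unfold form, lform, fdir, evq, Im. simpl. field. easy.
Qed.

Definition flt (f : nat * nat) N w := lt0 (zform f N w).
Lemma flt_spec f N w : (0 < N)%Z -> flt f N w = true -> form f (evq N w) < 0.
Proof.
  intros HN H. apply lt0_spec in H. rewrite zform_spec in H by easy.
  apply (IZR_lt 0) in HN. nra.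
Qed.
Lemma zform_vertex f k : eval3 (zform f 1 (pt k)) = 2 * form f (ev (pt k)).
Proof. rewrite zform_spec, evq_1 by lia. ring. Qed.

Definition vlt f k := lt0 (zform f 1 (pt k)).
Definition vle f k := le0 (zform f 1 (pt k)).
Definition vgt f k := lt0 (opp3 (zform f 1 (pt k))).
Definition vge f k := le0 (opp3 (zform f 1 (pt k))).
Definition veq f k := eq0 (zform f 1 (pt k)).
Lemma vlt_spec f k : vlt f k = true -> form f (ev (pt k)) < 0.
Proof. intros H. apply lt0_spec in H. rewrite zform_vertex in H. lra. Qed.
Lemma vle_spec f k : vle f k = true -> form f (ev (pt k)) <= 0.
Proof. intros H. apply le0_spec in H. rewrite zform_vertex in H. lra. Qed.
Lemma vgt_spec f k : vgt f k = true -> 0 < form f (ev (pt k)).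
Proof. intros H. apply lt0_spec in H. rewrite opp3_spec, zform_vertex in H. lra. Qed.
Lemma vge_spec f k : vge f k = true -> 0 <= form f (ev (pt k)).
Proof. intros H. apply le0_spec in H. rewrite opp3_spec, zform_vertex in H. lra. Qed.
Lemma veq_spec f k : veq f k = true -> form f (ev (pt k)) = 0.
Proof. intros H. apply eq0_spec in H. rewrite zform_vertex in H. lra. Qed.

(* A point is in the Spectre when in each clause some form is nonpositive: the
   singletons cut out the convex hull, the pairs remove the four notches. *)
Definition clauses : list (list (nat * nat)) :=
  [[(0, 2)]; [(2, 3)]; [(3, 5)]; [(5, 6)]; [(6, 7)]; [(7, 9)]; [(9, 11)];
   [(11, 12)]; [(12, 0)]; [(0, 1); (1, 2)]; [(3, 4); (4, 5)]; [(7, 8); (8, 9)];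
   [(12, 13); (13, 14)]]%nat.

(** [polygon_region spectre] contains [sS] and is contained in [inS], see [sS_region] and
    [region_inS]. *)
Definition inS (z : C) : Prop :=
  forall cl, In cl clauses -> exists f, In f cl /\ form f z <= 0.
Definition sS (z : C) : Prop :=
  forall cl, In cl clauses -> exists f, In f cl /\ form f z < 0.

Lemma sS_inS z : sS z -> inS z.
Proof. intros H cl Hc. destruct (H cl Hc) as (f & Hf & L). exists f; split; [easy|lra]. Qed.

Definition sSb (N : Z) (w : zz) : bool :=
  allb (anyb (fun f => flt f N w)) clauses.
Lemma sSb_spec N w : (0 < N)%Z -> sSb N w = true -> sS (evq N w).
Proof.
  intros HN H cl Hc. unfold sSb in H. rewrite allb_forall in H.
  apply H in Hc. apply anyb_exists in Hc. destruct Hc as (f & Hf & L).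
  exists f; split; [easy|]. now apply flt_spec.
Qed.

(* The Spectre is star-shaped around this point. *)
Definition kappa : C := evq 4 (3, 6, -1, -6)%Z.

Lemma kappa_neg cl f : In cl clauses -> In f cl -> form f kappa < 0.
Proof.
  intros Hc Hf. apply flt_spec; [lia|].
  assert (H : forallb (forallb (fun f => flt f 4 (3, 6, -1, -6)%Z)) clauses = true)
    by (vm_compute; reflexivity).
  rewrite forallb_forall in H. specialize (H cl Hc). rewrite forallb_forall in H. now apply H.
Qed.

Lemma star z s : inS z -> 0 < s <= 1 -> sS (RtoC (1 - s) * z + RtoC s * kappa)%C.
Proof.
  intros H Hs cl Hc. destruct (H cl Hc) as (f & Hf & L). exists f; split; [easy|].
  rewrite form_mix. pose proof (kappa_neg cl f Hc Hf). nra.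
Qed.

Lemma kappa_sS : sS kappa.
Proof.
  intros cl Hc. destruct cl as [|f cl]; [exfalso; revert Hc; simpl; intuition discriminate|].
  exists f; split; [now left|]. apply (kappa_neg _ _ Hc). now left.
Qed.

Definition feqb (f g : nat * nat) : bool := ((fst f =? fst g) && (snd f =? snd g))%nat.
Lemma feqb_eq f g : feqb f g = true <-> f = g.
Proof.
  unfold feqb. rewrite andb_true_iff, !Nat.eqb_eq. destruct f, g; simpl.
  split; [intros [-> ->]|intros E; injection E]; easy.
Qed.

Definition single_clause (g : nat * nat) : bool :=
  existsb (fun cl => match cl with [g'] => feqb g g' | _ => false end) clauses.

(* On a line carrying a form [f], a single clause or the clause of [f] itself
   keeps the points of the boundary between the two ends. *)
Definition between_check : bool :=
  forallb (fun cl => forallb (fun f =>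
     let lower := existsb (fun g => single_clause g && veq g (fst f) && vlt g (snd f)) (concat
       clauses)
                  || existsb (fun g => veq g (fst f) && vgt g (snd f)) cl in
     let upper := existsb (fun g => single_clause g && veq g (snd f) && vlt g (fst f)) (concat
       clauses)
                  || existsb (fun g => veq g (snd f) && vgt g (fst f)) cl in
     lower && upper) cl) clauses.

Lemma between_check_true : between_check = true.
Proof. vm_compute. reflexivity. Qed.

Lemma single_clause_le z g : inS z ->
  single_clause g = true ->
  form g z <= 0.
Proof.
  intros H E. apply existsb_exists in E. destruct E as (cl & Hc & E).
  destruct cl as [|g' [|]]; try discriminate.
  apply feqb_eq in E. subst g'.
  destruct (H _ Hc) as (f & [<-|[]] & L). easy.
Qed.

Definition fpoint (f : nat * nat) (s : R) : C :=
  (RtoC (1 - s) * ev (pt (fst f)) + RtoC s * ev (pt (snd f)))%C.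

Lemma fpoint_form f s g :
  form g (fpoint f s) = (1 - s) * form g (ev (pt (fst f))) + s * form g (ev (pt (snd f))).
Proof. apply form_mix. Qed.

Definition nondegenerate : bool :=
  forallb (forallb (fun f => lt0 (opp3 (re2 (zmul (zconj (zsub (pt (snd f)) (pt (fst f))))
     (zsub (pt (snd f)) (pt (fst f)))))))) clauses.

Lemma fdir_pos cl f : In cl clauses -> In f cl -> 0 < Re (Cconj (fdir f) * fdir f)%C.
Proof.
  intros Hc Hf. assert (H : nondegenerate = true) by (vm_compute; reflexivity).
  unfold nondegenerate in H. rewrite forallb_forall in H. specialize (H cl Hc).
  rewrite forallb_forall in H. specialize (H f Hf). apply lt0_spec in H.
  rewrite opp3_spec, re2_spec, ev_mul, ev_conj, ev_sub in H. unfold fdir. lra.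
Qed.

Lemma line_param cl f e : In cl clauses -> In f cl -> lform f e = 0 ->
  exists r, e = (RtoC r * fdir f)%C.
Proof.
  intros Hc Hf H. pose proof (fdir_pos cl f Hc Hf) as Hp.
  unfold lform in H. destruct (fdir f) as [dx dy], e as [ex ey].
  unfold Re, Im in *. simpl in *.
  exists ((dx * ex + dy * ey) / (dx * dx + dy * dy)).
  assert (Hn : dx * dx + dy * dy <> 0) by lra.
  assert (E : dx * ey = dy * ex) by lra.
  apply injective_projections; simpl; field_simplify_eq; [|lra| |lra]; ring [E].
Qed.

Lemma form0_param cl f z : In cl clauses -> In f cl -> form f z = 0 ->
  exists s, z = fpoint f s.
Proof.
  intros Hc Hf H. destruct (line_param cl f _ Hc Hf H) as (r & E).
  exists r. unfold fpoint. rewrite RtoC_minus.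
  replace z with (ev (pt (fst f)) + (z - ev (pt (fst f))))%C by ring.
  rewrite E. unfold fdir. ring.
Qed.

(** A form that vanishes at one end of the line, and whose sign is known both at the other end and
    at the point, bounds the parameter on that side. *)
Lemma param_between cl f s : In cl clauses -> In f cl -> inS (fpoint f s) ->
  (forall g, In g cl -> 0 <= form g (fpoint f s)) -> 0 <= s <= 1.
Proof.
  intros Hc Hf HS Hge. pose proof between_check_true as H.
  unfold between_check in H. rewrite forallb_forall in H. specialize (H cl Hc).
  rewrite forallb_forall in H. specialize (H f Hf). apply andb_true_iff in H.
  destruct H as [Hlo Hup]. rewrite orb_true_iff in Hlo, Hup. split.
  - destruct Hlo as [Hl|Hl]; apply existsb_exists in Hl; destruct Hl as (g & Hg & Hl).
    + rewrite !andb_true_iff in Hl. destruct Hl as [[H1 H2] H3].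
      pose proof (single_clause_le _ _ HS H1) as H4. rewrite fpoint_form in H4.
      apply veq_spec in H2. apply vlt_spec in H3. nra.
    + rewrite !andb_true_iff in Hl. destruct Hl as [H2 H3].
      pose proof (Hge g Hg) as H4. rewrite fpoint_form in H4.
      apply veq_spec in H2. apply vgt_spec in H3. nra.
  - destruct Hup as [Hl|Hl]; apply existsb_exists in Hl; destruct Hl as (g & Hg & Hl).
    + rewrite !andb_true_iff in Hl. destruct Hl as [[H1 H2] H3].
      pose proof (single_clause_le _ _ HS H1) as H4. rewrite fpoint_form in H4.
      apply veq_spec in H2. apply vlt_spec in H3. nra.
    + rewrite !andb_true_iff in Hl. destruct Hl as [H2 H3].
      pose proof (Hge g Hg) as H4. rewrite fpoint_form in H4.
      apply veq_spec in H2. apply vgt_spec in H3. nra.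
Qed.

Definition on_side (i : nat) (l : R) : C := (ev (pt i) + RtoC l * dv i)%C.
Definition boundary (z : C) : Prop :=
  exists i l, (i < 14)%nat /\ 0 <= l <= 1 /\ z = on_side i l.

(** The hull sides that span a notch, each with the two sides of the notch. They carry forms of
    clauses, but meet [inS] only at their ends. *)
Definition bases : list (nat * nat * (nat * nat) * (nat * nat)) :=
  [(0, 2, (0, 1), (1, 2)); (3, 5, (3, 4), (4, 5)); (7, 9, (7, 8), (8, 9));
   (12, 0, (12, 13), (13, 14))]%nat.

Lemma base_ends b g h s : In (b, g, h) bases -> inS (fpoint b s) -> 0 <= s <= 1 ->
  s = 0 \/ s = 1.
Proof.
  intros Hb HS Hs.
  assert (H : forallb (fun x => let '(b, g, h) := x in
     veq g (fst b) && vgt g (snd b) && vgt h (fst b) && veq h (snd b)) bases = true)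
    by (vm_compute; reflexivity).
  rewrite forallb_forall in H. specialize (H _ Hb). cbv beta iota in H.
  rewrite !andb_true_iff in H. destruct H as [[[H1 H2] H3] H4].
  apply veq_spec in H1, H4. apply vgt_spec in H2, H3.
  assert (Hc : In [g; h] clauses).
  { repeat (destruct Hb as [E|Hb]; [injection E as <- <- <-|]); [..|destruct Hb];
      repeat ((left; reflexivity) || right). }
  destruct (HS _ Hc) as (f & [<-|[<-|[]]] & L); rewrite fpoint_form in L.
  - left. nra.
  - right. nra.
Qed.

Lemma on_side_fpoint i s : (i < 14)%nat -> fpoint (i, S i) s = on_side i s.
Proof.
  intros Hi. unfold fpoint, on_side. cbn [fst snd]. rewrite ev_pt_S, RtoC_minus by easy. ring.
Qed.

Lemma dv_9_10 : fdir (9, 11)%nat = (RtoC 2 * dv 9)%C /\ dv 10 = dv 9.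
Proof.
  split; [|reflexivity]. unfold fdir. cbn [fst snd].
  rewrite (ev_pt_S 10), (ev_pt_S 9) by lia. change (dv 10) with (dv 9). ring.
Qed.

(** Because of the flat angle at vertex 10, the hull side (9, 11) has length 2 and carries the sides
    9 and 10. *)
Lemma fpoint_9_11 s : fpoint (9, 11)%nat s = on_side 9 (2 * s) /\
  fpoint (9, 11)%nat s = on_side 10 (2 * s - 1).
Proof.
  unfold fpoint, on_side. cbn [fst snd]. rewrite (ev_pt_S 10), (ev_pt_S 9) by lia.
  change (dv 10) with (dv 9). generalize (ev (pt 9)) (dv 9). intros u v.
  split; apply injective_projections; simpl; ring.
Qed.

Lemma form_kinds cl f : In cl clauses -> In f cl ->
  (exists i, (i < 14)%nat /\ f = (i, S i)) \/ f = (9, 11)%nat \/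
  (exists g h, In (f, g, h) bases).
Proof.
  intros Hc Hf.
  assert (H : forallb (forallb (fun f => ((snd f =? S (fst f)) && (fst f <? 14))%nat
      || ((fst f =? 9) && (snd f =? 11))%nat
      || existsb (fun x => let '(b, _, _) := x in feqb f b) bases)) clauses = true)
    by (vm_compute; reflexivity).
  rewrite forallb_forall in H. specialize (H cl Hc).
  rewrite forallb_forall in H. specialize (H f Hf).
  rewrite !orb_true_iff, !andb_true_iff, existsb_exists, !Nat.eqb_eq, Nat.ltb_lt in H.
  destruct f as [a b]; cbn [fst snd] in H. destruct H as [[[-> H]|[-> ->]]|([[b' g] h] & Hb & H)].
  - left. now exists a.
  - now right; left.
  - right; right. exists g, h. apply feqb_eq in H. now subst b'.
Qed.

(** One of the forms of the clause vanishes at z, which lies between the ends of the corresponding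
    line. That line is a side, the double side through the flat vertex, or a hull side over a notch,
    met only at its ends. *)
Lemma boundary_of z cl : inS z -> In cl clauses ->
  (forall f, In f cl -> 0 <= form f z) -> boundary z.
Proof.
  intros HS Hc Hge. destruct (HS cl Hc) as (f & Hf & L).
  destruct (form0_param cl f z Hc Hf) as (s & ->); [specialize (Hge f Hf); lra|].
  pose proof (param_between cl f s Hc Hf HS Hge) as Hs.
  destruct (form_kinds cl f Hc Hf) as [(i & Hi & ->)|[->|(g & h & Hb)]].
  - exists i, s. rewrite on_side_fpoint; auto.
  - destruct (Rle_dec s (1 / 2)).
    + exists 9%nat, (2 * s). repeat split; [lia|lra|lra|apply fpoint_9_11].
    + exists 10%nat, (2 * s - 1). repeat split; [lia|lra|lra|apply fpoint_9_11].
  - assert (E : exists i, (i < 14)%nat /\ fpoint f s = on_side i 0).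
    { assert (Hfs : (fst f < 14 /\ snd f < 14)%nat)
        by (repeat (destruct Hb as [E|Hb]; [injection E as <- <- <-; simpl; lia|]); destruct Hb).
      destruct (base_ends f g h s Hb HS Hs) as [->| ->];
        [exists (fst f)|exists (snd f)]; (split; [apply Hfs|]); unfold fpoint, on_side.
      - replace (1 - 0) with 1 by ring. ring.
      - replace (1 - 1) with 0 by ring. ring. }
    destruct E as (i & Hi & E). exists i, 0. repeat split; auto; lra.
Qed.

Lemma inS_cases z : inS z -> sS z \/ boundary z.
Proof.
  intros H. destruct (classic (sS z)) as [|Hn]; [now left|right].
  apply not_all_ex_not in Hn. destruct Hn as (cl & Hn).
  apply imply_to_and in Hn. destruct Hn as [Hc Hn].
  apply (boundary_of z cl H Hc). intros f Hf.
  apply Rnot_lt_le. intros L. apply Hn. now exists f.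
Qed.

Lemma spectre_nth k : (k < 14)%nat -> nth k spectre (RtoC 0) = ev (pt k).
Proof.
  intros H. unfold spectre. rewrite (nth_indep _ _ (P 0)) by (rewrite length_map, length_seq;
    lia).
  rewrite map_nth, seq_nth by lia. apply P_pt. simpl; lia.
Qed.

Lemma side_spectre i : (i < 14)%nat -> side spectre (ev (pt i)) (ev (pt (S i))).
Proof.
  intros H. exists i. split; [easy|]. cbv zeta. left.
  change (length spectre) with 14%nat.
  rewrite !spectre_nth, pt_mod by (try apply Nat.mod_upper_bound; lia). easy.
Qed.

Lemma boundary_iff z : polygon_boundary spectre z <-> boundary z.
Proof.
  split.
  - intros (v & w & (k & Hk & HS) & s & Hs & ->). change (length spectre) with 14%nat in *.
    cbv zeta in HS. rewrite !spectre_nth, pt_mod, ev_pt_S in HS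
      by (try apply Nat.mod_upper_bound; lia).
    destruct HS as [[-> ->]|[-> ->]].
    + exists k, s. repeat split; try easy. unfold on_side. ring.
    + exists k, (1 - s). repeat split; try lra; try easy. unfold on_side. rewrite RtoC_minus.
      ring.
  - intros (i & l & Hi & Hl & ->). exists (ev (pt i)), (ev (pt (S i))).
    split; [now apply side_spectre|]. exists l. split; [easy|].
    rewrite ev_pt_S by easy. unfold on_side. ring.
Qed.

(* From an exterior point, the ray along the outer normal of a hull side never meets
   the boundary. *)
Definition escape_dir (cl : list (nat * nat)) : C :=
  let a := fst (hd (0, 0)%nat cl) in let b := snd (last cl (0, 0)%nat) in
  (Ci * (ev (pt b) - ev (pt a)))%C.

Definition escape_check : bool :=
  forallb (fun cl =>
    let a := fst (hd (0, 0)%nat cl) in let b := snd (last cl (0, 0)%nat) in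
    forallb (fun f => le0 (opp3 (re2 (zmul (zconj (zsub (pt (snd f)) (pt (fst f))))
                                         (zsub (pt b) (pt a)))))) cl
    && lt0 (opp3 (re2 (zmul (zconj (zsub (pt b) (pt a))) (zsub (pt b) (pt a)))))
    && forallb (fun i => existsb (fun f => vle f i && vle f (S i)) cl) (seq 0 14)) clauses.

Lemma escape_check_true : escape_check = true.
Proof. vm_compute. reflexivity. Qed.

Lemma on_side_form f i l :
  (i < 14)%nat -> form f (on_side i l) =
  (1 - l) * form f (ev (pt i)) + l * form f (ev (pt (S i))).
Proof. intros Hi. rewrite <- on_side_fpoint by easy. apply fpoint_form. Qed.

(** All forms of a violated clause stay positive along the ray, whereas each side of the polygon
    lies in the closed half-plane where one of them is nonpositive. *)
Lemma escape_ray z : ~ inS z ->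
  exists n : C, Cmod n <> 0 /\ forall t, 0 <= t -> ~ boundary (z + RtoC t * n)%C.
Proof.
  intros Hn. apply not_all_ex_not in Hn. destruct Hn as (cl & Hn).
  apply imply_to_and in Hn. destruct Hn as [Hc Hn].
  pose proof escape_check_true as H. unfold escape_check in H.
  rewrite forallb_forall in H. specialize (H cl Hc).
  rewrite !andb_true_iff, !forallb_forall in H. destruct H as [[H1 H2] H3].
  exists (escape_dir cl). unfold escape_dir.
  set (a := fst (hd (0, 0)%nat cl)) in *. set (b := snd (last cl (0, 0)%nat)) in *.
  split.
  - apply lt0_spec in H2. rewrite opp3_spec, re2_spec, ev_mul, ev_conj, ev_sub in H2.
    intros E. apply Cmod_eq_0 in E.
    destruct (ev (pt b) - ev (pt a))%C as [x y]. unfold Re in H2. simpl in *.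
    injection E as E1 E2. nra.
  - intros t Ht (i & l & Hi & Hl & E).
    specialize (H3 i). rewrite in_seq, existsb_exists in H3.
    destruct H3 as (f & Hf & H3); [lia|]. apply andb_true_iff in H3. destruct H3 as [H3 H4].
    apply vle_spec in H3, H4.
    assert (L : 0 < form f z).
    { apply Rnot_le_lt. intros L. apply Hn. now exists f. }
    specialize (H1 f Hf). apply le0_spec in H1.
    rewrite opp3_spec, re2_spec, ev_mul, ev_conj, !ev_sub in H1.
    assert (L2 : form f (z + RtoC t * (Ci * (ev (pt b) - ev (pt a)))) <= 0).
    { rewrite E, on_side_form by easy. nra. }
    rewrite form_add, lform_scal in L2.
    assert (E2 : lform f (Ci * (ev (pt b) - ev (pt a))) =
      Re (Cconj (ev (pt (snd f)) - ev (pt (fst f))) * (ev (pt b) - ev (pt a)))%C).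
    { unfold lform, fdir, Re, Im. simpl. ring. }
    rewrite E2 in L2. nra.
Qed.

Lemma region_inS z : polygon_region spectre z -> inS z.
Proof.
  intros H. apply NNPP. intros Hn. destruct (escape_ray z Hn) as (n & Hnz & Hesc).
  destruct (H (fun t => z + RtoC t * n)%C) as (t & Ht & Hb).
  - intros t. apply (continuous_plus (V := C_R_NormedModule) (fun _ => z) (fun t => (RtoC t *
      n)%C)).
    + apply continuous_const.
    + apply (continuous_ext (fun t : R => scal (V := C_R_NormedModule) t n)).
      * intros x. rewrite scal_R_Cmult. easy.
      * apply (continuous_scal_l (V := C_R_NormedModule) (fun t : R => t)). apply continuous_id.
  - apply injective_projections; simpl; ring.
  - assert (Hp : 0 < Cmod n) by (pose proof (Cmod_ge_0 n); lra).
    intros Q [M HM]. exists (Rmax 0 ((M + Cmod z) / Cmod n)). intros t Ht.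
    apply HM. pose proof (Rmax_l 0 ((M + Cmod z) / Cmod n)).
    pose proof (Rmax_r 0 ((M + Cmod z) / Cmod n)).
    assert (E : (M + Cmod z) < t * Cmod n).
    { apply Rle_lt_trans with ((M + Cmod z) / Cmod n * Cmod n); [right; field; lra|].
      apply Rmult_lt_compat_r; lra. }
    pose proof (Cmod_triangle (z + RtoC t * n) (- z)) as T.
    replace (z + RtoC t * n + - z)%C with (RtoC t * n)%C in T by ring.
    rewrite Cmod_mult, Cmod_opp, Cmod_R, Rabs_pos_eq in T by lra. lra.
  - apply boundary_iff in Hb. now apply (Hesc t Ht).
Qed.

(** Continuous induction, by the supremum of the initial segments where Q holds. It serves for paths
    leaving the Spectre and for the segment joining two tiles. *)
Lemma real_induction (Q : R -> Prop) (a b : R) :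
  a <= b -> Q a ->
  (forall t, a < t <= b -> (forall u, a <= u < t -> Q u) -> Q t) ->
  (forall t, a <= t < b -> Q t -> exists d, 0 < d /\ forall u, t < u < t + d -> Q u) ->
  Q b.
Proof.
  intros Hab Ha Hl Hr.
  set (E := fun t => a <= t <= b /\ forall u, a <= u <= t -> Q u).
  destruct (completeness E) as [m [Hm1 Hm2]].
  - exists b. intros t Ht. apply Ht.
  - exists a. split; [lra|]. intros u Hu. now replace u with a by lra.
  - assert (Ea : E a) by (split; [lra|]; intros u Hu; now replace u with a by lra).
    assert (Ham : a <= m) by (now apply Hm1).
    assert (Hmb : m <= b) by (apply Hm2; intros t Ht; apply Ht).
    assert (Hlt : forall u, a <= u < m -> Q u).
    { intros u Hu. apply NNPP. intros Hn.
      assert (m <= u); [|lra]. apply Hm2. intros t Ht.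
      apply Rnot_lt_le. intros L. apply Hn. apply Ht. lra. }
    assert (Qm : Q m).
    { destruct (Req_dec a m) as [<-|Hne]; [easy|]. apply Hl; [lra|easy]. }
    destruct (Req_dec m b) as [<-|Hne]; [easy|].
    destruct (Hr m) as (d & Hd & H); [lra|easy|].
    exfalso. set (t := Rmin (m + d / 2) b).
    assert (Ht : m < t /\ t <= b /\ t <= m + d / 2).
    { unfold t. split; [apply Rmin_glb_lt; lra|]. split; [apply Rmin_r|apply Rmin_l]. }
    assert (E t); [|assert (t <= m) by (now apply Hm1); lra].
    split; [lra|]. intros u Hu. destruct (Rlt_dec u m); [apply Hlt; lra|].
    destruct (Req_dec u m) as [->|]; [easy|]. apply H; lra.
Qed.

Lemma form_continuous f : forall z : C, continuous (form f) z.
Proof.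
  intros z.
  apply (continuous_ext (fun z : C => plus (fst (fdir f) * (snd z + - snd (ev (pt (fst f)))))
    (- snd (fdir f) * (fst z + - fst (ev (pt (fst f))))))).
  { intros w. unfold form, lform, Im, plus. generalize (fdir f) (ev (pt (fst f))). intros u v.
    simpl. ring. }
  generalize (fdir f) (ev (pt (fst f))). intros [dx dy] [ax ay]. cbn [fst snd].
  apply (continuous_plus (fun z : C => dx * (snd z + - ay)) (fun z : C => - dy * (fst z + - ax))).
  - apply (continuous_scal_r dx (fun z : C => snd z + - ay)).
    apply (continuous_plus (fun z : C => snd z) (fun _ => - ay)).
    + apply continuous_snd.
    + apply continuous_const.
  - apply (continuous_scal_r (- dy) (fun z : C => fst z + - ax)).
    apply (continuous_plus (fun z : C => fst z) (fun _ => - ax)).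
    + apply continuous_fst.
    + apply continuous_const.
Qed.

Lemma filter_list {A B} (F : (A -> Prop) -> Prop) {FF : Filter F}
  (Q : B -> A -> Prop) (l : list B) :
  (forall f, In f l -> F (Q f)) -> F (fun x => forall f, In f l -> Q f x).
Proof.
  induction l as [|f l IH]; intros H.
  - apply (filter_imp (fun _ => True)); [|apply filter_true]. intros x _ f [].
  - apply (filter_imp (fun x => Q f x /\ forall f, In f l -> Q f x)).
    + intros x [H1 H2] f' [<-|Hin]; auto.
    + apply filter_and; [apply H; now left|]. apply IH. intros f' Hin. apply H. now right.
Qed.

Lemma form_lt_locally f (z : C) r : form f z < r -> locally z (fun w => form f w < r).
Proof. intros H. exact (form_continuous f z (fun x => x < r) (open_lt r _ H)). Qed.
Lemma form_gt_locally f (z : C) r : r < form f z -> locally z (fun w => r < form f w).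
Proof. intros H. exact (form_continuous f z (fun x => r < x) (open_gt r _ H)). Qed.

Lemma sS_open z : sS z -> locally z sS.
Proof.
  intros H. apply (filter_list (locally z) (fun cl w => exists f, In f cl /\ form f w < 0)).
  intros cl Hc. destruct (H cl Hc) as (f & Hf & L).
  apply (filter_imp (fun w => form f w < 0)); [|now apply form_lt_locally].
  intros w Hw. now exists f.
Qed.

Lemma not_inS_open z : ~ inS z -> locally z (fun w => ~ inS w).
Proof.
  intros Hn. apply not_all_ex_not in Hn. destruct Hn as (cl & Hn).
  apply imply_to_and in Hn. destruct Hn as [Hc Hn].
  apply (filter_imp (fun w => forall f, In f cl -> 0 < form f w)).
  - intros w Hw HS. destruct (HS cl Hc) as (f & Hf & L). specialize (Hw f Hf). lra.
  - apply (filter_list (locally z) (fun f w => 0 < form f w)). intros f Hf. apply form_gt_locally.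
    apply Rnot_le_lt. intros L. apply Hn. now exists f.
Qed.

Lemma q3_bounds : 17 / 10 < q3 < 18 / 10.
Proof. pose proof q3_sq. pose proof q3_pos. split; nra. Qed.

Lemma inS_bounded z : inS z -> Cmod z <= 20.
Proof.
  intros H.
  assert (G : forall g, In [g] clauses -> form g z <= 0).
  { intros g Hg. destruct (H _ Hg) as (f & [<-|[]] & L). easy. }
  pose proof (G (5, 6)%nat ltac:(simpl; tauto)) as H1.
  pose proof (G (11, 12)%nat ltac:(simpl; tauto)) as H2.
  pose proof (G (0, 2)%nat ltac:(simpl; tauto)) as H3.
  pose proof (G (6, 7)%nat ltac:(simpl; tauto)) as H4.
  destruct z as [x y]. unfold form, lform, fdir, Im, pt, pts, ev in *. simpl in *.
  pose proof q3_bounds as Hq. pose proof q3_sq as Hq2.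
  (* Coordinates in the frame turned by 30 degrees, where the four hull sides chosen above bound a
     rectangle. *)
  set (u := y / 2 + q3 * x / 2). set (v := q3 * y / 2 - x / 2).
  assert (Hu : -10 <= u <= 10) by (unfold u; split; nra).
  assert (Hv : -10 <= v <= 10) by (unfold v; split; nra).
  assert (E : x * x + y * y = u * u + v * v) by (unfold u, v; nra).
  unfold Cmod. simpl. rewrite <- (sqrt_square 20) by lra. apply sqrt_le_1_alt.
  rewrite !Rmult_1_r. nra.
Qed.

(** A path starting in [sS] and avoiding the boundary cannot leave [sS], because the complement of
    [inS] is open and [inS] consists of [sS] and boundary points. It stays bounded, so it does not
    go to infinity. *)
Lemma sS_region z : sS z -> polygon_region spectre z.
Proof.
  intros H gamma Hc H0 Hinf. apply NNPP. intros Hn.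
  assert (Hb : forall t, 0 <= t -> ~ boundary (gamma t)).
  { intros t Ht B. apply Hn. exists t. split; [easy|]. now apply boundary_iff. }
  assert (A : forall t, 0 <= t -> sS (gamma t)).
  { intros t Ht. apply (real_induction (fun t => sS (gamma t)) 0 t Ht).
    - now rewrite H0.
    - intros t' Ht' Hu. destruct (inS_cases (gamma t')) as [|B]; [|easy|].
      + apply NNPP. intros Hni. apply not_inS_open in Hni.
        apply (Hc t') in Hni. destruct Hni as [d Hd].
        set (u := Rmax 0 (t' - d / 2)). pose proof (cond_pos d).
        assert (Hu' : 0 <= u /\ t' - d / 2 <= u /\ u < t').
        { unfold u. split; [apply Rmax_l|]. split; [apply Rmax_r|]. apply Rmax_lub_lt; lra. }
        apply (Hd u).
        * unfold ball; simpl; unfold AbsRing_ball, abs, minus, plus, opp; simpl.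
          apply Rabs_def1; lra.
        * apply sS_inS, Hu. lra.
      + exfalso. apply (Hb t'); [lra|easy].
    - intros t' Ht' HS. apply sS_open in HS. apply (Hc t') in HS. destruct HS as [d Hd].
      pose proof (cond_pos d). exists d. split; [easy|]. intros u Hu. apply Hd.
      unfold ball; simpl; unfold AbsRing_ball, abs, minus, plus, opp; simpl.
      apply Rabs_def1; lra. }
  destruct (Hinf (fun r => 20 < r)) as [M HM].
  - now exists 20.
  - specialize (HM (Rmax 0 M + 1)). pose proof (Rmax_l 0 M). pose proof (Rmax_r 0 M).
    assert (20 < Cmod (gamma (Rmax 0 M + 1))) by (apply HM; lra).
    assert (Cmod (gamma (Rmax 0 M + 1)) <= 20) by (apply inS_bounded, sS_inS, A; lra). lra.
Qed.

(** * Tilings near a point *)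

(** The inverse of [act t] when the linear part has modulus 1. *)
Definition loc (t : placement) (z : C) : C := (Cconj (lin t) * (z - off t))%C.
Definition inT (t : placement) (z : C) : Prop := inS (loc t z).
Definition sT (t : placement) (z : C) : Prop := sS (loc t z).
Definition unitary (t : placement) : Prop := (Cconj (lin t) * lin t)%C = RtoC 1.

Lemma unitary_Cmod t : Cmod (lin t) = 1 -> unitary t.
Proof.
  intros H. unfold unitary. destruct (lin t) as [x y]. unfold Cmod in H. simpl in H.
  assert (E : x * x + y * y = 1).
  { assert (0 <= x * (x * 1) + y * (y * 1)) by nra.
    rewrite <- (sqrt_sqrt (x * (x * 1) + y * (y * 1))) in H0 by easy.
    pose proof (sqrt_sqrt (x * (x * 1) + y * (y * 1)) ltac:(nra)) as E. rewrite H in E. lra. }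
  apply injective_projections; simpl; lra.
Qed.

Lemma loc_act t w : unitary t -> loc t (act t w) = w.
Proof.
  intros H. unfold loc, act. replace (lin t * w + off t - off t)%C with (lin t * w)%C by ring.
  rewrite Cmult_assoc, H. ring.
Qed.
Lemma act_loc t z : unitary t -> act t (loc t z) = z.
Proof.
  intros H. unfold loc, act. rewrite Cmult_assoc, (Cmult_comm (lin t)), H. ring.
Qed.
Lemma loc_add t z e : loc t (z + e)%C = (loc t z + Cconj (lin t) * e)%C.
Proof. unfold loc. ring. Qed.
Lemma loc_mix t s u v : loc t (RtoC (1 - s) * u + RtoC s * v)%C =
  (RtoC (1 - s) * loc t u + RtoC s * loc t v)%C.
Proof. unfold loc. rewrite RtoC_minus. ring. Qed.
Lemma unitary_mod_conj t e : unitary t -> Cmod (Cconj (lin t) * e) = Cmod e.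
Proof.
  intros H. rewrite Cmod_mult. replace (Cmod (Cconj (lin t))) with 1; [ring|].
  assert (E : Cmod (Cconj (lin t)) * Cmod (lin t) = 1) by (rewrite <- Cmod_mult, H, Cmod_1; easy).
  rewrite Cmod_conj in *. pose proof (Cmod_ge_0 (lin t)). nra.
Qed.

Lemma at0 (Q : R -> Prop) d : 0 < d -> (forall e, 0 < e < d -> Q e) -> at_right 0 Q.
Proof.
  intros Hd H. exists (mkposreal d Hd). intros e He Hpos. apply H. split; [easy|].
  unfold ball in He; simpl in He; unfold AbsRing_ball, abs, minus, plus, opp in He; simpl in He.
  apply Rabs_def2 in He. lra.
Qed.
Lemma at0_inv (Q : R -> Prop) : at_right 0 Q -> exists d, 0 < d /\ forall e, 0 < e < d -> Q e.
Proof.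
  intros [d Hd]. exists d. split; [apply cond_pos|]. intros e He. apply Hd; [|lra].
  unfold ball; simpl; unfold AbsRing_ball, abs, minus, plus, opp; simpl. apply Rabs_def1; lra.
Qed.
Lemma at0_ex (Q : R -> Prop) : at_right 0 Q -> exists e, 0 < e /\ Q e.
Proof.
  intros H. apply at0_inv in H. destruct H as (d & Hd & H). exists (d / 2).
  split; [lra|]. apply H. lra.
Qed.
Lemma at0_lt d : 0 < d -> at_right 0 (fun e => 0 < e < d).
Proof. intros Hd. now apply (at0 _ d). Qed.

(** The condition for a + e b + e^2 c to be negative for all small positive e. *)
Definition lex_neg (a b c : R) : Prop := a < 0 \/ (a = 0 /\ (b < 0 \/ (b = 0 /\ c < 0))).

Lemma lex_neg_at0 a b c : lex_neg a b c -> at_right 0 (fun e => a + e * b + e * e * c < 0).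
Proof.
  set (m := Rabs b + Rabs c + 1).
  assert (Hm : 1 <= m) by (unfold m; pose proof (Rabs_pos b); pose proof (Rabs_pos c); lra).
  assert (Hb : - m <= b <= m /\ - m <= c <= m).
  { unfold m. pose proof (Rabs_pos b); pose proof (Rabs_pos c).
    pose proof (Rle_abs b). pose proof (Rle_abs c). pose proof (Rle_abs (- b)).
    pose proof (Rle_abs (- c)). rewrite Rabs_Ropp in *. lra. }
  assert (Q : forall x, 0 < x -> exists d, 0 < d /\ d <= 1 /\ d * (2 * m) <= x).
  { intros x Hx. exists (Rmin 1 (x / (2 * m))).
    assert (0 < x / (2 * m)) by (apply Rdiv_lt_0_compat; lra).
    split; [apply Rmin_glb_lt; lra|]. split; [apply Rmin_l|].
    apply Rle_trans with (x / (2 * m) * (2 * m)); [|right; field; lra].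
    apply Rmult_le_compat_r; [lra|apply Rmin_r]. }
  intros [Ha|[-> [Hb'|[-> Hc]]]].
  - destruct (Q (- a)) as (d & Hd & Hd1 & Hd2); [lra|]. apply (at0 _ d Hd). intros e He.
    assert (e * b <= e * m) by nra. assert (e * c <= m) by nra.
    assert (e * (e * c) <= e * m) by nra.
    assert (e * (2 * m) < d * (2 * m)) by nra. lra.
  - destruct (Q (- b)) as (d & Hd & Hd1 & Hd2); [lra|]. apply (at0 _ d Hd). intros e He.
    assert (e * c <= e * m) by nra. assert (e * (2 * m) < d * (2 * m)) by nra.
    assert (b + e * c < 0) by lra.
    assert (e * (b + e * c) < 0) by nra. lra.
  - apply (at0 _ 1); [lra|]. intros e He. assert (0 < e * e) by nra. nra.
Qed.

(** [tiling_disjoint] is stronger than disjointness of interiors: an interior point of a tile is not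
    on the boundary of another tile either. Moving such a point towards the centre of the second
    tile would give a common interior point. *)
Record tiling (T : placement -> Prop) : Prop := {
  tiling_unitary : forall t, T t -> unitary t;
  tiling_cover : forall z, exists t, T t /\ inT t z;
  tiling_disjoint : forall t t' z, T t -> T t' -> sT t z -> inT t' z -> t = t' }.

Lemma loc_locally t z : sT t z -> locally z (sT t).
Proof.
  intros H. destruct (sS_open _ H) as [eps He].
  unfold sT. destruct (lin t) as [a b] eqn:El.
  assert (Hm : 0 < Rabs a + Rabs b + 1) by (pose proof (Rabs_pos a); pose proof (Rabs_pos b);
    lra).
  assert (Hd : 0 < eps / (Rabs a + Rabs b + 1)) by (apply Rdiv_lt_0_compat;
    [apply cond_pos|easy]).
  exists (mkposreal _ Hd). intros w [H1 H2]. apply He.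
  unfold ball in H1, H2; simpl in H1, H2; unfold AbsRing_ball, abs, minus, plus, opp in H1, H2;
    simpl in H1, H2.
  set (d := eps / (Rabs a + Rabs b + 1)) in *.
  assert (E : d * (Rabs a + Rabs b + 1) = eps) by (unfold d; field; lra).
  assert (Hx : forall u v x y, Rabs x < d -> Rabs y < d -> Rabs u + Rabs v = Rabs a + Rabs b ->
     Rabs (u * x + v * y) < eps).
  { intros u v x y Hx Hy Huv. eapply Rle_lt_trans; [apply Rabs_triang|]. rewrite !Rabs_mult, <- E.
    pose proof (Rabs_pos u). pose proof (Rabs_pos v). pose proof (Rabs_pos x).
    pose proof (Rabs_pos y). nra. }
  unfold loc. rewrite El. split; unfold ball; simpl; unfold AbsRing_ball, abs, minus, plus, opp;
    simpl.
  - match goal with |- Rabs ?x < _ => replace x with (a * (fst w + - fst z) + b * (snd w + - snd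
      z)) by ring end.
    now apply Hx.
  - match goal with |- Rabs ?x < _ => replace x with ((- b) * (fst w + - fst z) + a * (snd w + -
      snd z)) by ring end.
    apply Hx; [easy..|rewrite Rabs_Ropp; ring].
Qed.

Lemma tile_region_inT t z : unitary t -> tile_region t z -> inT t z.
Proof. intros Hu (w & Hw & ->). unfold inT. rewrite loc_act by easy. now apply region_inS. Qed.

Lemma sT_tile_region t z : unitary t -> sT t z -> locally z (tile_region t).
Proof.
  intros Hu H. apply (filter_imp (sT t)); [|now apply loc_locally].
  intros w Hw. exists (loc t w). split; [now apply sS_region|]. now rewrite act_loc.
Qed.

(* Forms are affine along segments and strictly negative at [kappa], so points of
   a tile are limits of interior points. *)
Lemma sT_segment t t' z : sT t z ->
  at_right 0 (fun e => sT t (RtoC (1 - e) * z + RtoC e * act t' kappa)%C).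
Proof.
  intros H. unfold sT.
  apply (filter_list (at_right 0) (fun cl e => exists f, In f cl /\
     form f (loc t (RtoC (1 - e) * z + RtoC e * act t' kappa)) < 0)).
  intros cl Hc. destruct (H cl Hc) as (f & Hf & L).
  apply (filter_imp (fun e => form f (loc t z) + e * (form f (loc t (act t' kappa)) - form f (loc
    t z)) + e * e * 0 < 0)).
  - intros e He. exists f. split; [easy|]. rewrite loc_mix, form_mix. lra.
  - apply lex_neg_at0. now left.
Qed.

Lemma spectre_tiling_tiling T : spectre_tiling T -> tiling T.
Proof.
  intros (Hu & Hc & Hd).
  assert (HU : forall t, T t -> unitary t) by (intros t Ht; now apply unitary_Cmod, Hu).
  assert (HD : forall t t' z, T t -> T t' -> sT t z -> sT t' z -> t = t').
  { intros t t' z Ht Ht' H H'. apply NNPP. intros Hne. apply (Hd t t' Ht Ht' Hne).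
    exists z. split; apply sT_tile_region; auto. }
  split; [easy| |].
  - intros z. destruct (Hc z) as (t & Ht & H). exists t. split; [easy|].
    apply tile_region_inT; auto.
  - intros t t' z Ht Ht' H H'.
    destruct (at0_ex _ (filter_and _ _ (sT_segment t t' z H) (at0_lt 1 Rlt_0_1))) as (e & _ & H1
      & H2).
    apply (HD t t' _ Ht Ht' H1). unfold sT. rewrite loc_mix, loc_act by auto.
    apply star; [easy|lra].
Qed.

(** * Local finiteness *)

Lemma infinite_pigeonhole (Q : nat -> nat -> Prop) (N : nat) :
  (forall n, exists i, (i < N)%nat /\ Q n i) ->
  exists i, (i < N)%nat /\ forall m, exists n, (m <= n)%nat /\ Q n i.
Proof.
  intros H. apply NNPP. intros Hn.
  assert (A : forall k, (k <= N)%nat -> exists m, forall n i,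
    (m <= n)%nat -> (i < k)%nat -> ~ Q n i).
  { induction k; intros Hk.
    - exists 0%nat. intros; lia.
    - destruct IHk as [m Hm]; [lia|].
      assert (B : exists m', forall n, (m' <= n)%nat -> ~ Q n k).
      { apply NNPP. intros B. apply Hn. exists k. split; [lia|]. intros m'.
        apply NNPP. intros D. apply B. exists m'. intros n Hle HQ. apply D. now exists n. }
      destruct B as [m' Hm']. exists (max m m'). intros n i Hle Hi.
      destruct (Nat.eq_dec i k) as [->|]; [apply Hm'; lia|apply Hm; lia]. }
  destruct (A N (le_n _)) as [m Hm]. destruct (H m) as (i & Hi & HQ). now apply (Hm m i).
Qed.

Lemma grid_cell (d M : R) : 0 < d -> 0 <= M ->
  exists N, forall r, 0 <= r <= M -> exists i, (i < N)%nat /\ INR i * d <= r < (INR i + 1) * d.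
Proof.
  intros Hd HM.
  assert (HMd : 0 <= M / d) by (apply Rdiv_le_0_compat; lra).
  destruct (nfloor_ex (M / d) HMd) as [N HN].
  exists (S N). intros r Hr.
  assert (Hrd : 0 <= r / d) by (apply Rdiv_le_0_compat; lra).
  destruct (nfloor_ex (r / d) Hrd) as [i Hi]. exists i.
  assert (r = r / d * d) by (field; lra).
  split; [|nra].
  apply INR_lt. rewrite S_INR.
  assert (r / d <= M / d) by (apply Rmult_le_compat_r; [left; now apply Rinv_0_lt_compat|lra]).
  lra.
Qed.

Lemma kappa_margin cl f e : In cl clauses -> In f cl ->
  Rabs (fst e) < 1 / 50 -> Rabs (snd e) < 1 / 50 -> form f (kappa + e)%C < 0.
Proof.
  intros Hc Hf H1 H2.
  (* Every form is at most -1/4 at [kappa] and the coordinates of [fdir f] are at most 3 in absolute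
     value, so a displacement below 1/50 in each coordinate changes the form by at most 6/50. *)
  assert (K : forallb (forallb (fun f =>
     let z := zform f 4 (3, 6, -1, -6)%Z in le0 (fst z + 2, snd z)%Z &&
     let d := zsub (pt (snd f)) (pt (fst f)) in
     le0 (fst (re2 d) - 6, snd (re2 d))%Z && le0 (- fst (re2 d) - 6, - snd (re2 d))%Z &&
     le0 (fst (im2 d) - 6, snd (im2 d))%Z && le0 (- fst (im2 d) - 6,
       - snd (im2 d))%Z)) clauses = true)
    by (vm_compute; reflexivity).
  rewrite forallb_forall in K. specialize (K cl Hc).
  rewrite forallb_forall in K. specialize (K f Hf). cbv zeta in K.
  rewrite !andb_true_iff in K. destruct K as [K1 [[[K2 K3] K4] K5]].
  apply le0_spec in K1, K2, K3, K4, K5.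
  pose proof (zform_spec f 4 (3, 6, -1, -6)%Z ltac:(lia)) as Z1. fold kappa in Z1.
  pose proof (re2_spec (zsub (pt (snd f)) (pt (fst f)))) as R1.
  pose proof (im2_spec (zsub (pt (snd f)) (pt (fst f)))) as I1.
  rewrite ev_sub in R1, I1. fold (fdir f) in R1, I1.
  unfold eval3 in *. cbn [fst snd] in *. rewrite ?plus_IZR, ?minus_IZR, ?opp_IZR in *.
  rewrite form_add. unfold lform. apply Rabs_def2 in H1, H2.
  destruct (fdir f) as [dx dy], e as [ex ey]. unfold Re, Im in *. cbn [fst snd] in *.
  simpl. 
  assert (-3 <= dx <= 3 /\ -3 <= dy <= 3) by lra.
  assert (dx * ey <= 3 / 50) by nra. assert (- dy * ex <= 3 / 50) by nra. lra.
Qed.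

Lemma kappa_close t t' : unitary t -> unitary t' ->
  Rabs (fst (act t' kappa) - fst (act t kappa)) < 1 / 100 ->
  Rabs (snd (act t' kappa) - snd (act t kappa)) < 1 / 100 -> sT t (act t' kappa).
Proof.
  intros Hu Hu' H1 H2. unfold sT.
  replace (act t' kappa) with (act t kappa + (act t' kappa - act t kappa))%C by ring.
  rewrite loc_add, loc_act by easy.
  set (e := (act t' kappa - act t kappa)%C) in *.
  change (Rabs (fst e) < 1 / 100) in H1. change (Rabs (snd e) < 1 / 100) in H2.
  assert (Hm : Cmod (Cconj (lin t) * e) < 1 / 50).
  { rewrite unitary_mod_conj by easy. apply Rle_lt_trans with (Rabs (fst e) + Rabs (snd e));
      [|lra].
    unfold Cmod. rewrite <- (sqrt_square (Rabs (fst e) + Rabs (snd e)))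
      by (pose proof (Rabs_pos (fst e)); pose proof (Rabs_pos (snd e)); lra).
    apply sqrt_le_1_alt. rewrite <- (pow2_abs (fst e)), <- (pow2_abs (snd e)).
    pose proof (Rabs_pos (fst e)); pose proof (Rabs_pos (snd e)). nra. }
  intros cl Hc. destruct cl as [|f cl]; [exfalso; revert Hc; simpl; intuition discriminate|].
  exists f. split; [now left|]. apply (kappa_margin _ f _ Hc); [now left| |].
  - eapply Rle_lt_trans; [|exact Hm]. eapply Rle_trans; [|apply Rmax_Cmod]. apply Rmax_l.
  - eapply Rle_lt_trans; [|exact Hm]. eapply Rle_trans; [|apply Rmax_Cmod]. apply Rmax_r.
Qed.

(** The tiles that meet the unit disc around v have their centres in a bounded square. In a cell of
    side 1/100 there is at most one centre, by [kappa_close], so finitely many tiles share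
    infinitely many points. *)
Lemma tile_covers_infinitely_often T (K : placement -> Prop) (v : C) (z : nat -> C) :
  tiling T -> (forall t, K t -> T t) ->
  (forall n, Cmod (z n - v) <= 1) -> (forall n, exists t, K t /\ inT t (z n)) ->
  exists t, K t /\ forall m, exists n, (m <= n)%nat /\ inT t (z n).
Proof.
  intros HT HK Hz Hcov.
  (* The centre of a tile meeting the disc is within 1 + 20 + 20 = 41 of v, by [inS_bounded]; hence
     the offset 41 and the width 82. *)
  destruct (grid_cell (1 / 100) 82) as [N HN]; [lra|lra|].
  set (cell := fun t i j =>
    INR i * (1 / 100) <= fst (act t kappa) - fst v + 41 < (INR i + 1) * (1 / 100) /\
    INR j * (1 / 100) <= snd (act t kappa) - snd v + 41 < (INR j + 1) * (1 / 100)).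
  assert (Hcell : forall n, exists i, (i < N)%nat /\ exists j, (j < N)%nat /\
     exists t, K t /\ inT t (z n) /\ cell t i j).
  { intros n. destruct (Hcov n) as (t & Ht & HS).
    assert (Hu : unitary t) by (apply (tiling_unitary T); auto).
    assert (D : Cmod (act t kappa - v) <= 41).
    { replace (act t kappa - v)%C with ((z n - v) + (act t kappa - z n))%C by ring.
      eapply Rle_trans; [apply Cmod_triangle|]. specialize (Hz n).
      assert (Cmod (act t kappa - z n) <= 40); [|lra].
      rewrite <- (unitary_mod_conj t) by easy.
      replace (Cconj (lin t) * (act t kappa - z n))%C with (kappa + - loc t (z n))%C.
      - eapply Rle_trans; [apply Cmod_triangle|]. rewrite Cmod_opp.
        pose proof (inS_bounded _ HS). pose proof (inS_bounded _ (sS_inS _ kappa_sS)). lra.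
      - rewrite <- (loc_act t kappa) at 1 by easy. unfold loc. ring. }
    pose proof (Rmax_Cmod (act t kappa - v)%C) as M.
    assert (B : forall x, Rabs x <= 41 -> 0 <= x + 41 <= 82).
    { intros x Hx. pose proof (Rle_abs x). pose proof (Rle_abs (- x)). rewrite Rabs_Ropp in *.
      lra. }
    destruct (HN (fst (act t kappa) - fst v + 41)) as (i & Hi & Ci').
    { apply B. pose proof (Rmax_l (Rabs (fst (act t kappa - v)%C)) (Rabs (snd (act t kappa -
        v)%C))).
      change (fst (act t kappa) - fst v) with (fst (act t kappa - v)%C). lra. }
    destruct (HN (snd (act t kappa) - snd v + 41)) as (j & Hj & Cj').
    { apply B. pose proof (Rmax_r (Rabs (fst (act t kappa - v)%C)) (Rabs (snd (act t kappa -
        v)%C))).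
      change (snd (act t kappa) - snd v) with (snd (act t kappa - v)%C). lra. }
    exists i. split; [easy|]. exists j. split; [easy|]. exists t. repeat split; easy. }
  destruct (infinite_pigeonhole _ N Hcell) as (i & _ & Hi).
  destruct (infinite_pigeonhole (fun m j => exists n, (m <= n)%nat /\
     exists t, K t /\ inT t (z n) /\ cell t i j) N) as (j & _ & Hj).
  { intros m. destruct (Hi m) as (n & Hn & j & Hj & H). exists j. split; [easy|]. now exists n. }
  destruct (Hj 0%nat) as (_ & _ & n0 & _ & t & Ht & _ & Hc1 & Hc2).
  exists t. split; [easy|]. intros m. destruct (Hj m) as (m' & Hm & n & Hn & t' & Ht' & HS & Hc1'
    & Hc2').
  exists n. split; [lia|]. replace t with t'; [easy|].
  assert (Hu : unitary t) by (apply (tiling_unitary T); auto).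
  assert (Hu' : unitary t') by (apply (tiling_unitary T); auto).
  symmetry. apply (tiling_disjoint T HT t t' (act t' kappa)); auto.
  - apply kappa_close; auto; apply Rabs_def1; lra.
  - unfold inT. rewrite loc_act by easy. apply sS_inS, kappa_sS.
Qed.

(** * Germs of parabolic arcs *)

Definition curve (v d n : C) (e : R) : C := (v + (RtoC e * d + RtoC (e * e) * n))%C.

Lemma form_curve f v d n e :
  form f (curve v d n e) = form f v + e * lform f d + e * e * lform f n.
Proof. unfold curve. rewrite form_add, lform_add, !lform_scal. ring. Qed.
Lemma lform_opp f n : lform f (- n)%C = - lform f n.
Proof. unfold lform, Im. simpl. ring. Qed.

Definition lex_pos (a b c : R) : Prop := lex_neg (- a) (- b) (- c).
Lemma lex_pos_at0 a b c : lex_pos a b c -> at_right 0 (fun e => 0 < a + e * b + e * e * c).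
Proof.
  intros H. apply lex_neg_at0 in H. revert H. apply filter_imp. intros e He. lra.
Qed.
Lemma lex_nonpos_at0 a b c : ~ lex_pos a b c -> at_right 0 (fun e => a + e * b + e * e * c <= 0).
Proof.
  intros H. destruct (classic (lex_neg a b c)) as [Hn|Hn].
  - apply lex_neg_at0 in Hn. revert Hn. apply filter_imp. intros e He. lra.
  - assert (a = 0 /\ b = 0 /\ c = 0) as (-> & -> & ->).
    { unfold lex_pos, lex_neg in *. lra. }
    apply (at0 _ 1); [lra|]. intros e He. lra.
Qed.

(** Decides whether v + e d + e^2 n is in the Spectre for small positive e. When d runs along a
    side, the second-order term tells on which side of it the arc lies. *)
Definition germ_in (v d n : C) : Prop := forall cl, In cl clauses ->
  exists f, In f cl /\ ~ lex_pos (form f v) (lform f d) (lform f n).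

Lemma germ_in_at0 v d n : germ_in v d n -> at_right 0 (fun e => inS (curve v d n e)).
Proof.
  intros H. apply (filter_list (at_right 0) (fun cl e => exists f,
    In f cl /\ form f (curve v d n e) <= 0)).
  intros cl Hc. destruct (H cl Hc) as (f & Hf & L). apply lex_nonpos_at0 in L.
  revert L. apply filter_imp. intros e He. exists f. split; [easy|]. now rewrite form_curve.
Qed.
Lemma not_germ_in v d n : ~ germ_in v d n ->
  exists cl, In cl clauses /\ forall f, In f cl -> lex_pos (form f v) (lform f d) (lform f n).
Proof.
  intros H. apply not_all_ex_not in H. destruct H as (cl & H). apply imply_to_and in H.
  destruct H as [Hc H]. exists cl. split; [easy|]. intros f Hf. apply NNPP. intros L.
  apply H. now exists f.
Qed.
Lemma not_germ_in_at0 v d n : ~ germ_in v d n -> at_right 0 (fun e => ~ inS (curve v d n e)).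
Proof.
  intros H. apply not_germ_in in H. destruct H as (cl & Hc & H).
  apply (filter_imp (fun e => forall f, In f cl -> 0 < form f (curve v d n e))).
  - intros e He HS. destruct (HS cl Hc) as (f & Hf & L). specialize (He f Hf). lra.
  - apply (filter_list (at_right 0) (fun f e => 0 < form f (curve v d n e))).
    intros f Hf. specialize (H f Hf). apply lex_pos_at0 in H. revert H. apply filter_imp.
    intros e He. now rewrite form_curve.
Qed.

Lemma at0_seq (Q : R -> Prop) : at_right 0 Q -> exists m, forall n,
  (m <= n)%nat -> Q (/ (INR n + 2)).
Proof.
  intros H. apply at0_inv in H. destruct H as (d & Hd & H).
  destruct (nfloor_ex (/ d)) as [m Hm]; [left; now apply Rinv_0_lt_compat|].
  exists m. intros n Hn. apply H. apply le_INR in Hn. pose proof (pos_INR m).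
  split; [apply Rinv_0_lt_compat; lra|].
  rewrite <- (Rinv_inv d). apply Rinv_lt_contravar; [|lra].
  apply Rmult_lt_0_compat; [now apply Rinv_0_lt_compat|lra].
Qed.

(** An arc is eventually inside or eventually outside, so being inside infinitely often is being
    inside for all small parameters. *)
Lemma germ_in_of_seq v d n :
  (forall m, exists k, (m <= k)%nat /\ inS (curve v d n (/ (INR k + 2)))) -> germ_in v d n.
Proof.
  intros H. apply NNPP. intros Hn. apply not_germ_in_at0, at0_seq in Hn.
  destruct Hn as [m Hm]. destruct (H m) as (k & Hk & HS). now apply (Hm k).
Qed.

Lemma fpoint_add f s r e : (fpoint f s + RtoC e * (RtoC r * fdir f))%C = fpoint f (s + e * r).
Proof. unfold fpoint, fdir. rewrite !RtoC_minus, RtoC_plus, RtoC_mult. ring. Qed.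

Lemma at0_param s r : at_right 0 (fun e => 0 <= s + e * r <= 1) ->
  0 <= s <= 1 /\ (0 < r -> s < 1) /\ (r < 0 -> 0 < s).
Proof.
  intros H. apply at0_inv in H. destruct H as (d & Hd & H).
  assert (0 <= s).
  { apply Rnot_lt_le. intros L.
    assert (D : at_right 0 (fun e => s + e * r + e * e * 0 < 0)) by (apply lex_neg_at0; now left).
    destruct (at0_ex _ (filter_and _ _ D (at0_lt d Hd))) as (e & _ & H1 & H2).
    specialize (H e H2). lra. }
  assert (s <= 1).
  { apply Rnot_lt_le. intros L.
    assert (D : at_right 0 (fun e => (1 - s) + e * (- r) + e * e * 0 < 0)) by (apply lex_neg_at0;
      left; lra).
    destruct (at0_ex _ (filter_and _ _ D (at0_lt d Hd))) as (e & _ & H1 & H2).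
    specialize (H e H2). lra. }
  assert (Hh := H (d / 2) ltac:(lra)).
  split; [lra|]. split; intros Hr; nra.
Qed.

(* Two tangent arcs leaving [v] on both sides of the direction [d], one inside and
   the other outside the Spectre, surround a side of the Spectre. *)
Lemma side_of_germ v d n : d <> RtoC 0 -> germ_in v d n -> ~ germ_in v d (- n)%C ->
  exists cl f s r, In cl clauses /\ In f cl /\ ~ (exists g h, In (f, g, h) bases) /\
    lform f n < 0 /\ v = fpoint f s /\ d = (RtoC r * fdir f)%C /\
    0 <= s <= 1 /\ (0 < r -> s < 1) /\ (r < 0 -> 0 < s).
Proof.
  intros Hd Hin Hout. apply not_germ_in in Hout. destruct Hout as (cl & Hc & Hp).
  destruct (Hin cl Hc) as (f & Hf & Hnp). pose proof (Hp f Hf) as Hpf.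
  rewrite lform_opp in Hpf.
  assert (form f v = 0 /\ lform f d = 0 /\ lform f n < 0) as (Ev & Ed & En).
  { unfold lex_pos, lex_neg in *. lra. }
  destruct (form0_param cl f v Hc Hf Ev) as [s Es].
  destruct (line_param cl f d Hc Hf Ed) as [r Er].
  (* The straight ray, where n is replaced by 0, is still inside and still makes every form of the
     clause nonnegative. Hence it runs on the line of f between its two ends. *)
  assert (HB : at_right 0 (fun e => inS (fpoint f (s + e * r)) /\ 0 <= s + e * r <= 1)).
  { assert (H1 : at_right 0 (fun e => inS (curve v d (RtoC 0) e))).
    { apply germ_in_at0. intros cl' Hc'. destruct (Hin cl' Hc') as (f' & Hf' & L).
      exists f'. split; [easy|].
      replace (lform f' (RtoC 0)) with 0 by (unfold lform, Im; simpl; ring).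
      unfold lex_pos, lex_neg in *. lra. }
    assert (H2 : at_right 0 (fun e => forall g, In g cl -> 0 <= form g (curve v d (RtoC 0) e))).
    { apply (filter_list (at_right 0) (fun g e => 0 <= form g (curve v d (RtoC 0) e))).
      intros g Hg. specialize (Hp g Hg).
      assert (L : ~ lex_pos (- form g v) (- lform g d) 0) by (unfold lex_pos, lex_neg in *; lra).
      apply lex_nonpos_at0 in L. revert L. apply filter_imp. intros e He.
      rewrite form_curve. replace (lform g (RtoC 0)) with 0 by (unfold lform, Im; simpl; ring).
      lra. }
    generalize (filter_and _ _ H1 H2). apply filter_imp. intros e [A B].
    assert (E : curve v d (RtoC 0) e = fpoint f (s + e * r)).
    { unfold curve. rewrite Es, Er, <- fpoint_add. ring. }
    rewrite E in A, B. split; [easy|]. now apply (param_between cl f). }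
  exists cl, f, s, r. repeat split; try easy.
  (* A hull side over a notch meets [inS] in two points only, and the ray would have three points
     there. *)
  1: { intros (g & h & Hb). apply at0_inv in HB. destruct HB as (e & He & HB).
    destruct (HB (e / 2)) as [A1 B1]; [lra|]. destruct (HB (e / 3)) as [A2 B2]; [lra|].
    destruct (HB (e / 4)) as [A3 B3]; [lra|].
    assert (r <> 0) by (intros ->; apply Hd; rewrite Er; ring).
    destruct (base_ends f g h _ Hb A1 B1), (base_ends f g h _ Hb A2 B2),
      (base_ends f g h _ Hb A3 B3); nra. }
  all: assert (HB2 : at_right 0 (fun e => 0 <= s + e * r <= 1)) by (revert HB; apply filter_imp;
    tauto);
    apply at0_param in HB2; tauto.
Qed.

(** Sides 9 and 10 both take the form of the hull side (9, 11). *)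
Definition side_form (i : nat) : nat * nat :=
  nth i [(0, 1); (1, 2); (2, 3); (3, 4); (4, 5); (5, 6); (6, 7); (7, 8); (8, 9);
         (9, 11); (9, 11); (11, 12); (12, 13); (13, 14)]%nat (0, 0)%nat.
(** A clause without [side_form i] is satisfied along the whole side by one form, strictly except
    perhaps at one end. In a clause with it, the other forms are nonnegative along the side, so
    crossing the side leaves the Spectre. *)
Definition side_check : bool :=
  forallb (fun i =>
    veq (side_form i) i && veq (side_form i) (S i) &&
    lt0 (opp3 (re2 (zmul (zconj (zsub (pt (snd (side_form i))) (pt (fst (side_form i))))) (zeta
      (dir i))))) &&
    existsb (existsb (feqb (side_form i))) clauses &&
    forallb (fun cl =>
      if existsb (feqb (side_form i)) cl then
        forallb (fun g => feqb (side_form i) g ||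
          (vge g i && vge g (S i) && (vgt g i || vgt g (S i)))) cl
      else existsb (fun f => vle f i && vle f (S i) && (vlt f i || vlt f (S i))) cl)
      clauses) (seq 0 14).
Lemma side_check_true : side_check = true.
Proof. vm_compute. reflexivity. Qed.

(** The point at parameter l has room to move along its side, forwards for sg = 1 and backwards for
    sg = -1. *)
Definition leaving (sg l : R) : Prop :=
  (sg = 1 /\ 0 <= l < 1) \/ (sg = -1 /\ 0 < l <= 1).

Lemma lform_dv f i : (i < 14)%nat ->
  lform f (dv i) = form f (ev (pt (S i))) - form f (ev (pt i)).
Proof.
  intros Hi. replace (ev (pt (S i))) with (ev (pt i) + dv i)%C by (now rewrite ev_pt_S).
  rewrite form_add. ring.
Qed.

Lemma side_lex f i l sg n : (i < 14)%nat -> leaving sg l ->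
  form f (ev (pt i)) <= 0 -> form f (ev (pt (S i))) <= 0 ->
  form f (ev (pt i)) < 0 \/ form f (ev (pt (S i))) < 0 ->
  lex_neg (form f (on_side i l)) (lform f (RtoC sg * dv i)%C) n.
Proof.
  intros Hi Hl H1 H2 H3. rewrite on_side_form, lform_scal, lform_dv by easy.
  generalize dependent (form f (ev (pt i))). generalize dependent (form f (ev (pt (S i)))).
  intros b Hb a Ha H. unfold lex_neg. destruct Hl as [[-> Hl]|[-> Hl]].
  - destruct (Req_dec ((1 - l) * a + l * b) 0) as [E|E]; [|left; nra].
    right. split; [easy|left]. assert (a = 0) by nra. subst a. nra.
  - destruct (Req_dec ((1 - l) * a + l * b) 0) as [E|E]; [|left; nra].
    right. split; [easy|left]. assert (b = 0) by nra. subst b. nra.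
Qed.

Lemma side_form_normal i : (i < 14)%nat -> 0 < lform (side_form i) (Ci * dv i)%C.
Proof.
  intros Hi. pose proof side_check_true as H. unfold side_check in H.
  rewrite forallb_forall in H. specialize (H i). rewrite in_seq, !andb_true_iff in H.
  destruct H as [[[_ H] _] _]; [lia|]. apply lt0_spec in H.
  rewrite opp3_spec, re2_spec, ev_mul, ev_conj, ev_sub in H.
  fold (fdir (side_form i)) in H. fold (dv i) in H.
  unfold lform. destruct (fdir (side_form i)), (dv i). unfold Re, Im in *. simpl in *. lra.
Qed.

(** The Spectre runs clockwise, so turning the direction of a side by [- Ci] points inwards. The arc
    bent that way satisfies all clauses strictly, and the arc bent by [Ci] violates the clause of
    the side. *)
Lemma side_germs i l sg : (i < 14)%nat -> leaving sg l ->
  at_right 0 (fun e => sS (curve (on_side i l) (RtoC sg * dv i) (- (Ci * dv i)) e)%C) /\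
  ~ germ_in (on_side i l) (RtoC sg * dv i)%C (Ci * dv i)%C.
Proof.
  intros Hi Hl. pose proof side_check_true as H. unfold side_check in H.
  rewrite forallb_forall in H. specialize (H i). rewrite in_seq, !andb_true_iff in H.
  destruct H as [[[[H1 H2] _] H4] H5]; [lia|].
  apply veq_spec in H1, H2. pose proof (side_form_normal i Hi) as Hn.
  rewrite forallb_forall in H5.
  assert (Z : form (side_form i) (on_side i l) = 0 /\ lform (side_form i) (RtoC sg * dv i) = 0).
  { rewrite on_side_form, lform_scal, lform_dv, H1, H2 by easy. lra. }
  destruct Z as [Z1 Z2]. split.
  - apply (filter_list (at_right 0) (fun cl e => exists f, In f cl /\
      form f (curve (on_side i l) (RtoC sg * dv i) (- (Ci * dv i)) e)%C < 0)).
    intros cl Hc. specialize (H5 cl Hc).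
    assert (Q : exists f, In f cl /\ lex_neg (form f (on_side i l)) (lform f (RtoC sg * dv i)%C)
      (lform f (- (Ci * dv i))%C)).
    { destruct (existsb (feqb (side_form i)) cl) eqn:E.
      - apply existsb_exists in E. destruct E as (f & Hf & E). apply feqb_eq in E. subst f.
        exists (side_form i). split; [easy|]. rewrite Z1, Z2, lform_opp. unfold lex_neg. lra.
      - apply existsb_exists in H5. destruct H5 as (f & Hf & H5).
        rewrite !andb_true_iff, orb_true_iff in H5. destruct H5 as [[H6 H7] H8].
        exists f. split; [easy|]. apply side_lex; try easy; try now apply vle_spec.
        destruct H8 as [H8|H8]; apply vlt_spec in H8; tauto. }
    destruct Q as (f & Hf & Q). apply lex_neg_at0 in Q. revert Q. apply filter_imp.
    intros e He. exists f. split; [easy|]. now rewrite form_curve.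
  - intros Hg. apply existsb_exists in H4. destruct H4 as (cl & Hc & E).
    specialize (H5 cl Hc). rewrite E in H5. rewrite forallb_forall in H5.
    destruct (Hg cl Hc) as (f & Hf & L). apply L. specialize (H5 f Hf).
    apply orb_true_iff in H5. destruct H5 as [H5|H5].
    + apply feqb_eq in H5. subst f. rewrite Z1, Z2. unfold lex_pos, lex_neg. lra.
    + rewrite !andb_true_iff, orb_true_iff in H5. destruct H5 as [[H6 H7] H8].
      apply vge_spec in H6, H7.
      assert (H9 : 0 < form f (ev (pt i)) \/ 0 < form f (ev (pt (S i))))
        by (destruct H8 as [H8|H8]; apply vgt_spec in H8; tauto).
      rewrite on_side_form, lform_scal, lform_dv by easy. revert H6 H7 H9.
      generalize (form f (ev (pt i))) (form f (ev (pt (S i)))). intros a b Ha Hb H.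
      unfold lex_pos, lex_neg. destruct Hl as [[-> Hl]|[-> Hl]].
      * destruct (Req_dec ((1 - l) * a + l * b) 0) as [E'|E']; [|left; nra].
        right. split; [lra|left]. assert (a = 0) by nra. subst a. nra.
      * destruct (Req_dec ((1 - l) * a + l * b) 0) as [E'|E']; [|left; nra].
        right. split; [lra|left]. assert (b = 0) by nra. subst b. nra.
Qed.

(** * Tilings are side to side *)

(** The code (k, a) stands for the map sending z to zeta^k z + a. Uniqueness of codes requires k <
    12, which is carried as a hypothesis. *)
Definition zpl : Type := (nat * zz)%type.
Definition pl (x : zpl) : placement := Placement (ev (zeta (fst x))) (ev (snd x)).
Definition zid : zpl := (0%nat, zzero).
Definition ztab : list zz := Eval vm_compute in map zeta (seq 0 12).
Definition zt (k : nat) : zz := nth k ztab zone.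
Definition zcomp (x y : zpl) : zpl :=
  ((fst x + fst y) mod 12, zadd (zmul (zt (fst x)) (snd y)) (snd x))%nat.
Definition zinv (x : zpl) : zpl :=
  ((12 - fst x) mod 12, zmul (zt ((12 - fst x) mod 12)) (zscale (-1) (snd x)))%nat.
Definition zrel (x y : zpl) : zpl := zcomp (zinv x) y.
Definition zpl_eqb (x y : zpl) : bool :=
  let '(k, (a0, a1, a2, a3)) := x in let '(l, (b0, b1, b2, b3)) := y in
  if (k =? l)%nat then if (a0 =? b0)%Z then if (a1 =? b1)%Z then
  if (a2 =? b2)%Z then (a3 =? b3)%Z else false else false else false else false.
Lemma zpl_eqb_eq x y : zpl_eqb x y = true <-> x = y.
Proof.
  destruct x as [k [[[a0 a1] a2] a3]], y as [l [[[b0 b1] b2] b3]]. unfold zpl_eqb.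
  destruct (Nat.eqb_spec k l), (Z.eqb_spec a0 b0), (Z.eqb_spec a1 b1), (Z.eqb_spec a2 b2),
    (Z.eqb_spec a3 b3); split; congruence.
Qed.

Lemma zt_spec k : (k < 12)%nat -> zt k = zeta k.
Proof. intros H. do 12 (destruct k as [|k]; [reflexivity|]). lia. Qed.

Lemma placement_eq (t t' : placement) : lin t = lin t' -> off t = off t' -> t = t'.
Proof. destruct t, t'; simpl. now intros -> ->. Qed.

Lemma compose_assoc t u v : compose t (compose u v) = compose (compose t u) v.
Proof. apply placement_eq; unfold compose, act; cbn [lin off]; ring. Qed.
Lemma compose_act t u z : act (compose t u) z = act t (act u z).
Proof. unfold compose, act; cbn [lin off]. ring. Qed.
Lemma compose_zid t : compose t (pl zid) = t.
Proof.
  apply placement_eq; unfold pl, zid, compose, act; cbn [lin off fst snd zeta];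
    rewrite ?ev_one, ?ev_zero; ring.
Qed.
Lemma pl_zcomp x y : (fst x < 12)%nat -> pl (zcomp x y) = compose (pl x) (pl y).
Proof.
  intros H. apply placement_eq; unfold pl, zcomp, compose, act; cbn [lin off fst snd].
  - now rewrite zeta_mod, zeta_add, ev_mul.
  - now rewrite ev_add, ev_mul, zt_spec.
Qed.
Lemma zcomp_lt x y : (fst (zcomp x y) < 12)%nat.
Proof. unfold zcomp. cbn [fst]. now apply Nat.mod_upper_bound. Qed.
Lemma zinv_lt x : (fst (zinv x) < 12)%nat.
Proof. unfold zinv. cbn [fst]. now apply Nat.mod_upper_bound. Qed.

Lemma zcomp_assoc x y z : (fst x < 12)%nat -> (fst y < 12)%nat ->
  zcomp x (zcomp y z) = zcomp (zcomp x y) z.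
Proof.
  intros Hx Hy. unfold zcomp. cbn [fst snd]. apply f_equal2.
  - rewrite Nat.Div0.add_mod_idemp_l, Nat.Div0.add_mod_idemp_r. f_equal. lia.
  - rewrite !zt_spec, zeta_mod, zeta_add by (try apply Nat.mod_upper_bound; lia).

    rewrite zmul_add, zmul_assoc.
    destruct (zmul (zmul (zeta (fst x)) (zeta (fst y))) (snd z)) as [[[? ?] ?] ?],
      (zmul (zeta (fst x)) (snd y)) as [[[? ?] ?] ?], (snd x) as [[[? ?] ?] ?].
    unfold zadd. repeat apply (f_equal2 pair); ring.
Qed.
Lemma zcomp_id_l x : (fst x < 12)%nat -> zcomp zid x = x.
Proof.
  intros H. destruct x as [k a]. unfold zcomp, zid. cbn [fst snd] in *.
  apply f_equal2; [now apply Nat.mod_small|]. change (zt 0) with zone. rewrite zmul_1.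
  destr_zz a. unfold zadd, zzero. repeat apply (f_equal2 pair); ring.
Qed.
Lemma zcomp_id_r x : (fst x < 12)%nat -> zcomp x zid = x.
Proof.
  intros H. destruct x as [k a]. unfold zcomp, zid. cbn [fst snd] in *.
  apply f_equal2; [rewrite Nat.add_0_r; now apply Nat.mod_small|].
  destruct (zt k) as [[[? ?] ?] ?]; destr_zz a. unfold zadd, zmul, zzero.
  cbv zeta. repeat apply (f_equal2 pair); ring.
Qed.
Lemma zcomp_inv_r x : (fst x < 12)%nat -> zcomp x (zinv x) = zid.
Proof.
  intros H. destruct x as [k a]. unfold zcomp, zinv, zid. cbn [fst snd] in *.
  apply f_equal2.
  - rewrite Nat.Div0.add_mod_idemp_r. replace (k + (12 - k))%nat with 12%nat by lia. reflexivity.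
  - rewrite !zt_spec by (try apply Nat.mod_upper_bound; lia).
    rewrite zmul_assoc, zeta_mod, <- zeta_add. replace (k + (12 - k))%nat with 12%nat by lia.
    change (zeta 12) with zone. rewrite zmul_1. destr_zz a.
    unfold zadd, zscale, zzero. repeat apply (f_equal2 pair); ring.
Qed.
Lemma zcomp_inv_l x : (fst x < 12)%nat -> zcomp (zinv x) x = zid.
Proof.
  intros H. destruct x as [k a]. unfold zcomp, zinv, zid. cbn [fst snd] in *.
  apply f_equal2.
  - rewrite Nat.Div0.add_mod_idemp_l. replace (12 - k + k)%nat with 12%nat by lia. reflexivity.
  - rewrite !zt_spec by (try apply Nat.mod_upper_bound; lia).
    destruct (zeta ((12 - k) mod 12)) as [[[? ?] ?] ?]; destr_zz a.
    unfold zadd, zmul, zscale, zzero. cbv zeta. repeat apply (f_equal2 pair); ring.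
Qed.
Lemma zcomp_zrel x y : (fst x < 12)%nat -> (fst y < 12)%nat -> zcomp x (zrel x y) = y.
Proof.
  intros Hx Hy. unfold zrel. rewrite zcomp_assoc, zcomp_inv_r, zcomp_id_l; auto using zinv_lt.
Qed.
Lemma zrel_zcomp x y : (fst x < 12)%nat -> (fst y < 12)%nat -> zrel x (zcomp x y) = y.
Proof.
  intros Hx Hy. unfold zrel. rewrite zcomp_assoc, zcomp_inv_l, zcomp_id_l; auto using zinv_lt.
Qed.

(* Interior points whose positions detect all the overlaps that occur below. *)
Definition test_points : list zz :=
  [(74, -25, 1, -24); (1, -24, -1, -26); (51, 25, 24, -51); (26, 1, 24, -1);
   (74, -26, -25, -24); (1, 1, 0, -1); (25, 1, 1, 0); (74, 24, 0, -49)]%Z.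

(** The test points of each tile are tried in the other one, with coordinates multiplied by 25. The
    answer [true] exhibits a common interior point; [false] proves nothing. *)
Definition overlapb (r : zpl) : bool :=
  let '(k, a) := r in
  if (k <? 12)%nat then
    if anyb (fun w => sSb 25 (zadd (zmul (zt k) w) (zscale 25 a))) test_points then true
    else anyb (fun w => sSb 25 (zmul (zt ((12 - k) mod 12)) (zsub w (zscale 25 a)))) test_points
  else false.

Lemma test_points_inside w : In w test_points -> sS (evq 25 w).
Proof.
  intros Hw. apply sSb_spec; [lia|].
  assert (H : forallb (sSb 25) test_points = true) by (vm_compute; reflexivity).
  rewrite forallb_forall in H. now apply H.
Qed.

Lemma act_pl_evq k a w N : (0 < N)%Z ->
  act (pl (k, a)) (evq N w) = evq N (zadd (zmul (zeta k) w) (zscale N a)).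
Proof.
  intros HN. unfold act, pl, evq. cbn [lin off fst snd].
  rewrite ev_add, ev_mul, ev_scale.
  assert (IZR N <> 0) by (apply not_0_IZR; lia).
  assert (E : (RtoC (/ IZR N) * RtoC (IZR N))%C = RtoC 1) by (rewrite <- RtoC_mult; f_equal;
    field; easy).
  replace (RtoC (/ IZR N) * (ev (zeta k) * ev w + RtoC (IZR N) * ev a))%C with
    (ev (zeta k) * (RtoC (/ IZR N) * ev w) + (RtoC (/ IZR N) * RtoC (IZR N)) * ev a)%C by ring.
  rewrite E. ring.
Qed.

Lemma overlapb_point r : overlapb r = true ->
  exists z, sS z /\ sS (act (pl r) z).
Proof.
  destruct r as [k a]. unfold overlapb. intros H.
  destruct (k <? 12)%nat eqn:Hk; [|easy]. apply Nat.ltb_lt in Hk.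
  destruct (anyb _ _) eqn:E in H;
    [clear H; apply anyb_exists in E; destruct E as (w & Hw & H)
    |clear E; apply anyb_exists in H; destruct H as (w & Hw & H)].
  - rewrite zt_spec in H by easy. exists (evq 25 w). split; [now apply test_points_inside|].
    rewrite act_pl_evq by lia. apply sSb_spec; [lia|easy].
  - rewrite zt_spec in H by (apply Nat.mod_upper_bound; lia).
    eexists. split; [apply sSb_spec; [|exact H]; lia|].
    rewrite act_pl_evq by lia. rewrite zmul_assoc, zeta_mod, <- zeta_add.
    replace (k + (12 - k))%nat with 12%nat by lia. change (zeta 12) with zone. rewrite zmul_1.
    replace (zadd (zsub w (zscale 25 a)) (zscale 25 a)) with w; [now apply test_points_inside|].
    destr_zz w; destr_zz a. unfold zsub, zadd, zscale. repeat apply (f_equal2 pair); ring.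
Qed.

Lemma overlap_eq T t r : tiling T -> T t -> T (compose t (pl r)) -> overlapb r = true ->
  t = compose t (pl r).
Proof.
  intros HT Ht Ht' H. apply overlapb_point in H. destruct H as (z & H1 & H2).
  assert (Hu := tiling_unitary T HT t Ht).
  assert (Hu' := tiling_unitary T HT _ Ht').
  apply (tiling_disjoint T HT _ _ (act (compose t (pl r)) z) Ht Ht').
  - unfold sT. rewrite compose_act, loc_act by easy. easy.
  - unfold inT. rewrite loc_act by easy. now apply sS_inS.
Qed.

Lemma dv_unit i : (Cconj (dv i) * dv i)%C = RtoC 1.
Proof. apply zeta_norm. Qed.

(* Points approaching [v] along a parabola tangent to side [i] on the outside belong,
   infinitely often, to the same tile [t], which does not contain the mirror arc. *)
Lemma aligned T s i l sg : tiling T -> T s -> (i < 14)%nat -> leaving sg l ->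
  exists t j m, T t /\ (j < 14)%nat /\ leaving (- sg) m /\
    (lin t * dv j)%C = (- (lin s * dv i))%C /\
    act t (on_side j m) = act s (on_side i l).
Proof.
  intros HT Hs Hi Hl.
  assert (Hus := tiling_unitary T HT s Hs).
  set (v := act s (on_side i l)). set (u := (lin s * dv i)%C).
  assert (Hu1 : (Cconj u * u)%C = RtoC 1).
  { unfold u. rewrite Cmult_conj.
    replace (Cconj (lin s) * Cconj (dv i) * (lin s * dv i))%C with
      ((Cconj (lin s) * lin s) * (Cconj (dv i) * dv i))%C by ring.
    rewrite Hus, dv_unit. ring. }
  assert (Mu : Cmod u = 1).
  { assert (E : Cmod (Cconj u * u) = 1) by (rewrite Hu1; apply Cmod_1).
    rewrite Cmod_mult, Cmod_conj in E. pose proof (Cmod_ge_0 u). nra. }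
  assert (Hsg : Rabs sg = 1 /\ sg * sg = 1).
  { destruct Hl as [[-> _]|[-> _]]; [rewrite Rabs_R1|rewrite Rabs_left by lra]; split; ring. }
  destruct (side_germs i l sg Hi Hl) as [Gin Gout].
  assert (Lc : forall t e n, loc t (curve v (RtoC sg * u) n e) =
      curve (loc t v) (Cconj (lin t) * (RtoC sg * u)) (Cconj (lin t) * n) e).
  { intros t e n. unfold curve. rewrite loc_add. ring. }
  assert (Ls : (loc s v = on_side i l) /\ (Cconj (lin s) * (RtoC sg * u) = RtoC sg * dv i)%C /\
      (Cconj (lin s) * (Ci * u) = Ci * dv i)%C).
  { unfold v, u. rewrite loc_act by easy. repeat split.
    - replace (Cconj (lin s) * (RtoC sg * (lin s * dv i)))%C with ((Cconj (lin s) * lin s) *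
        (RtoC sg * dv i))%C by ring.
      rewrite Hus. ring.
    - replace (Cconj (lin s) * (Ci * (lin s * dv i)))%C with ((Cconj (lin s) * lin s) * (Ci * dv
        i))%C by ring.
      rewrite Hus. ring. }
  destruct Ls as (Ls1 & Ls2 & Ls3).
  destruct (tile_covers_infinitely_often T T v (fun k => curve v (RtoC sg * u) (Ci * u) (/ (INR k
    + 2))) HT)
    as (t & Ht & Hacc); [easy| | |].
  - intros k. pose proof (pos_INR k).
    assert (He : 0 < / (INR k + 2) <= 1 / 2).
    { split; [apply Rinv_0_lt_compat; lra|]. replace (1 / 2) with (/ 2) by lra.
      apply Rinv_le_contravar; lra. }
    revert He. generalize (/ (INR k + 2)). intros e He. unfold curve.
    replace (v + (RtoC e * (RtoC sg * u) + RtoC (e * e) * (Ci * u)) - v)%C with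
      ((RtoC e * RtoC sg + RtoC (e * e) * Ci) * u)%C by ring.
    rewrite Cmod_mult, Mu, Rmult_1_r. eapply Rle_trans; [apply Cmod_triangle|].
    assert (MI : Cmod Ci = 1).
    { unfold Cmod, Ci; simpl. replace (0 * (0 * 1) + 1 * (1 * 1)) with 1 by ring. apply sqrt_1. }
    rewrite !Cmod_mult, !Cmod_R, MI, (proj1 Hsg), !Rabs_pos_eq by nra. nra.
  - intros k. apply (tiling_cover T HT).
  - assert (Hut := tiling_unitary T HT t Ht).
    assert (Din : germ_in (loc t v) (Cconj (lin t) * (RtoC sg * u)) (Cconj (lin t) * (Ci * u))).
    { apply germ_in_of_seq. intros m. destruct (Hacc m) as (k & Hk & HS). exists k.
      split; [easy|]. unfold inT in HS. now rewrite Lc in HS. }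
    (* Otherwise the mirror arc would be in t and in the interior of s, so that t = s; but s does
       not contain the outer arc. *)
    assert (Dout : ~ germ_in (loc t v) (Cconj (lin t) * (RtoC sg * u)) (- (Cconj (lin t) * (Ci *
      u)))).
    { intros D. apply germ_in_at0 in D.
      destruct (at0_ex _ (filter_and _ _ D Gin)) as (e & He & H1 & H2).
      assert (E : s = t).
      { apply (tiling_disjoint T HT s t (curve v (RtoC sg * u) (- (Ci * u)) e)); auto.
        - unfold sT. rewrite Lc, Ls1, Ls2.
          replace (Cconj (lin s) * - (Ci * u))%C with (- (Cconj (lin s) * (Ci * u)))%C by ring.
          now rewrite Ls3.
        - unfold inT. rewrite Lc.
          now replace (Cconj (lin t) * - (Ci * u))%C with (- (Cconj (lin t) * (Ci * u)))%C
            by ring. }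
      subst t. apply Gout. now rewrite Ls1, Ls2, Ls3 in Din. }
    assert (Hd0 : (Cconj (lin t) * (RtoC sg * u))%C <> RtoC 0).
    { intros E. apply (f_equal Cmod) in E. rewrite unitary_mod_conj, Cmod_mult, Cmod_R, Mu,
        Cmod_0 in E by easy. lra. }
    destruct (side_of_germ _ _ _ Hd0 Din Dout) as (cl & f & x & r & Hc & Hf & Hnb & Hneg & Ev &
      Ed & Hx & Hr1 & Hr2).
    assert (Hneg2 : sg * r < 0).
    { replace (Cconj (lin t) * (Ci * u))%C with (RtoC sg * (Ci * (Cconj (lin t) * (RtoC sg *
        u))))%C in Hneg.
      - rewrite Ed in Hneg. pose proof (fdir_pos cl f Hc Hf) as Hp. unfold lform in Hneg.
        destruct (fdir f). unfold Re, Im in *. simpl in *. nra.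
      - replace (RtoC sg * (Ci * (Cconj (lin t) * (RtoC sg * u))))%C with
          ((RtoC sg * RtoC sg) * (Cconj (lin t) * (Ci * u)))%C by ring.
        rewrite <- RtoC_mult, (proj2 Hsg). ring. }
    assert (Hdir : (Cconj (lin t) * u)%C = (RtoC (sg * r) * fdir f)%C).
    { rewrite RtoC_mult. replace (RtoC sg * RtoC r * fdir f)%C with (RtoC sg * (RtoC r * fdir
        f))%C by ring.
      rewrite <- Ed. replace (RtoC sg * (Cconj (lin t) * (RtoC sg * u)))%C with
        ((RtoC sg * RtoC sg) * (Cconj (lin t) * u))%C by ring.
      rewrite <- RtoC_mult, (proj2 Hsg). ring. }
    assert (Hmod : - (sg * r) * Cmod (fdir f) = 1).
    { apply (f_equal Cmod) in Hdir. rewrite unitary_mod_conj, Mu, Cmod_mult, Cmod_R,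
        Rabs_left in Hdir by easy. lra. }
    assert (Hdv : forall j, Cmod (dv j) = 1).
    { intros j. assert (E : Cmod (Cconj (dv j) * dv j) = 1) by (rewrite dv_unit; apply Cmod_1).
      rewrite Cmod_mult, Cmod_conj in E. pose proof (Cmod_ge_0 (dv j)). nra. }
    assert (Hut' : (lin t * Cconj (lin t))%C = RtoC 1) by (rewrite Cmult_comm; exact Hut).
    assert (Fin : forall j, (Cconj (lin t) * u)%C = (- dv j)%C -> (lin t * dv j)%C = (- u)%C).
    { intros j E. replace (dv j) with (- - dv j)%C by ring. rewrite <- E.
      replace (lin t * - (Cconj (lin t) * u))%C with (- ((lin t * Cconj (lin t)) * u))%C by ring.
      rewrite Hut'. ring. }
    destruct (form_kinds cl f Hc Hf) as [(j & Hj & ->)|[->|Hb]]; [| |contradiction].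
    + assert (Ef : fdir (j, S j) = dv j).
      { unfold fdir. cbn [fst snd]. rewrite ev_pt_S by easy. ring. }
      rewrite Ef, Hdv in Hmod. exists t, j, x. split; [easy|]. split; [easy|].
      assert (Er : sg * r = -1) by lra.
      split; [|split].
      * destruct Hl as [[-> _]|[-> _]]; [right|left]; (split; [ring|]);
          [specialize (Hr2 ltac:(lra))|specialize (Hr1 ltac:(lra))]; lra.
      * apply Fin. rewrite Hdir, Ef, Er. ring.
      * rewrite <- on_side_fpoint, <- Ev by easy. now apply act_loc.
    (* On the hull side (9, 11), parameter x falls on side 9 or on side 10 according to 2 x. The
       midpoint is given to the side that has room in the required direction. *)
    + destruct dv_9_10 as [Ef E10]. rewrite Ef, Cmod_mult, Cmod_R, Hdv, Rabs_pos_eq in Hmod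
        by lra.
      assert (Er : sg * r = -1 / 2) by lra.
      assert (F9 : (lin t * dv 9)%C = (- u)%C).
      { apply Fin. rewrite Hdir, Ef, Er. apply injective_projections; simpl; field. }
      destruct Hl as [[-> _]|[-> _]].
      * specialize (Hr2 ltac:(lra)). destruct (Rle_dec x (1 / 2)).
        -- exists t, 9%nat, (2 * x). split; [easy|]. split; [lia|].
        split; [right; split; [ring|lra]|].
           split; [easy|]. rewrite <- (proj1 (fpoint_9_11 x)), <- Ev. now apply act_loc.
        -- exists t, 10%nat, (2 * x - 1). split; [easy|]. split; [lia|].
        split; [right; split; [ring|lra]|].
           split; [now rewrite E10|]. rewrite <- (proj2 (fpoint_9_11 x)), <- Ev.
           now apply act_loc.
      * specialize (Hr1 ltac:(lra)). destruct (Rlt_dec x (1 / 2)).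
        -- exists t, 9%nat, (2 * x). split; [easy|]. split; [lia|].
        split; [left; split; [ring|lra]|].
           split; [easy|]. rewrite <- (proj1 (fpoint_9_11 x)), <- Ev. now apply act_loc.
        -- exists t, 10%nat, (2 * x - 1). split; [easy|]. split; [lia|].
        split; [left; split; [ring|lra]|].
           split; [now rewrite E10|]. rewrite <- (proj2 (fpoint_9_11 x)), <- Ev.
           now apply act_loc.
Qed.

Lemma ev_zeta_6 : ev (zeta 6) = (- RtoC 1)%C.
Proof.
  replace (zeta 6) with (zscale (-1) zone) by reflexivity. rewrite ev_scale, ev_one.
  apply injective_projections; simpl; ring.
Qed.

(** The code, relative to a first tile, of a tile whose side k has the direction of side i turned by
    30 h degrees and whose point w' falls on w. Adding 12 prevents truncated subtraction. *)
Definition align (h i k : nat) (w w' : zz) : zpl :=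
  let r := ((dir i + 12 + h - dir k) mod 12)%nat in (r, zsub w (zmul (zt r) w')).

Lemma dir_le i : (dir i <= 11)%nat.
Proof.
  destruct (Nat.lt_ge_cases i 14) as [H|H].
  - do 14 (destruct i as [|i]; [unfold dir; simpl; lia|]). lia.
  - unfold dir. rewrite nth_overflow by (simpl; lia). lia.
Qed.

Lemma align_spec s s' h i k w w' :
  (lin s' * dv k)%C = (ev (zeta h) * (lin s * dv i))%C ->
  act s' (ev w') = act s (ev w) -> s' = compose s (pl (align h i k w w')).
Proof.
  intros Hd Hp. set (r := ((dir i + 12 + h - dir k) mod 12)%nat).
  assert (Hr : (ev (zeta r) * dv k)%C = (ev (zeta h) * dv i)%C).
  { unfold r, dv. rewrite zeta_mod, <- !ev_mul, <- !zeta_add. f_equal.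
    pose proof (dir_le k). replace (dir i + 12 + h - dir k + dir k)%nat with (12 + (h + dir
      i))%nat by lia.
    apply zeta_12. }
  assert (Hl : lin s' = (lin s * ev (zeta r))%C).
  { transitivity ((lin s' * dv k) * Cconj (dv k))%C.
    - rewrite <- Cmult_assoc, (Cmult_comm (dv k)), dv_unit. ring.
    - rewrite Hd. replace (ev (zeta h) * (lin s * dv i))%C with (lin s * (ev (zeta h) * dv i))%C
        by ring.
      rewrite <- Hr. rewrite <- !Cmult_assoc, (Cmult_comm (dv k)), dv_unit. ring. }
  apply placement_eq; unfold align, pl, compose; fold r; cbn [lin off fst snd]; [easy|].
  unfold act in *. rewrite ev_sub, ev_mul, zt_spec by (now apply Nat.mod_upper_bound).
  rewrite Hl in Hp.
  replace (off s') with (lin s * ev (zeta r) * ev w' + off s' - lin s * ev (zeta r) * ev w')%C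
    by ring.
  rewrite Hp. ring.
Qed.

(** Side j is glued backwards onto side i: h = 6 reverses the direction, and the start of side j
    falls on the end of side i. *)
Definition nbr0 (i j : nat) : zpl := align 6 i j (pt (S i)) (pt j).

Lemma vertex_not_inside i k x : (i < 15)%nat -> (k < 14)%nat -> 0 < x < 1 ->
  on_side k x <> ev (pt i).
Proof.
  intros Hi Hk Hx E.
  assert (H : forallb (fun i => forallb (fun k =>
      let z := zmul (zconj (zeta (dir k))) (zsub (pt i) (pt k)) in
      lt0 (im2 z) || lt0 (opp3 (im2 z)) || le0 (re2 z) || le0 (2 - fst (re2 z), - snd (re2 z))%Z)
      (seq 0 14)) (seq 0 15) = true) by (vm_compute; reflexivity).
  rewrite forallb_forall in H. specialize (H i). rewrite in_seq, forallb_forall in H.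
  specialize (H ltac:(lia) k). rewrite in_seq in H. specialize (H ltac:(lia)). cbv zeta in H.
  assert (Q : (Cconj (dv k) * (ev (pt i) - ev (pt k)))%C = RtoC x).
  { rewrite <- E. unfold on_side.
    replace (Cconj (dv k) * (ev (pt k) + RtoC x * dv k - ev (pt k)))%C with (RtoC x * (Cconj (dv
      k) * dv k))%C by ring.
    rewrite dv_unit. ring. }
  set (z := zmul (zconj (zeta (dir k))) (zsub (pt i) (pt k))) in *.
  assert (Z : ev z = RtoC x) by (unfold z; rewrite ev_mul, ev_conj, ev_sub; exact Q).
  pose proof (im2_spec z) as I. pose proof (re2_spec z) as J. rewrite Z in I, J.
  unfold Im, Re in I, J. simpl in I, J.
  rewrite !orb_true_iff in H. destruct H as [[[H|H]|H]|H];
    (apply lt0_spec in H || apply le0_spec in H); rewrite ?opp3_spec in H; try lra.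
  unfold eval3 in *. cbn [fst snd] in H. rewrite minus_IZR, opp_IZR in H. lra.
Qed.

(** Both tiles lie to the right of the same ray, so each contains in its interior the arc that
    [side_germs] attaches to it. *)
Lemma same_direction_eq T s s' i k l m sg : tiling T -> T s -> T s' ->
  (i < 14)%nat -> (k < 14)%nat -> leaving sg l -> leaving sg m ->
  (lin s' * dv k)%C = (lin s * dv i)%C ->
  act s' (on_side k m) = act s (on_side i l) -> s = s'.
Proof.
  intros HT Hs Hs' Hi Hk Hl Hm Hd Hp.
  assert (Hu := tiling_unitary T HT s Hs). assert (Hu' := tiling_unitary T HT s' Hs').
  destruct (side_germs i l sg Hi Hl) as [G _]. destruct (side_germs k m sg Hk Hm) as [G' _].
  destruct (at0_ex _ (filter_and _ _ G G')) as (e & He & H1 & H2).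
  set (w := curve (on_side i l) (RtoC sg * dv i) (- (Ci * dv i))%C e) in *.
  set (w' := curve (on_side k m) (RtoC sg * dv k) (- (Ci * dv k))%C e) in *.
  assert (E : act s' w' = act s w).
  { assert (A : forall t a d n, act t (curve a d n e) = (act t a + RtoC e * (lin t * d) + RtoC (e
      * e) * (lin t * n))%C)
      by (intros; unfold act, curve; ring).
    unfold w, w'. rewrite !A, Hp.
    replace (lin s' * (RtoC sg * dv k))%C with (RtoC sg * (lin s' * dv k))%C by ring.
    replace (lin s' * - (Ci * dv k))%C with (- Ci * (lin s' * dv k))%C by ring.
    rewrite Hd. ring. }
  apply (tiling_disjoint T HT s s' (act s w)); auto.
  - unfold sT. now rewrite loc_act.
  - unfold inT. rewrite <- E, loc_act by easy. now apply sS_inS.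
Qed.

(* The vertices with an angle of 90 or 180 degrees. *)
Definition even_vertices : list nat := [0; 2; 6; 10; 12; 14]%nat.
Definition nonzero (a : zz) : bool :=
  lt0 (re2 a) || lt0 (opp3 (re2 a)) || lt0 (im2 a) || lt0 (opp3 (im2 a)).
Lemma nonzero_spec a : nonzero a = true -> ev a <> RtoC 0.
Proof.
  unfold nonzero. rewrite !orb_true_iff. intros H E.
  pose proof (im2_spec a) as I. pose proof (re2_spec a) as J. rewrite E in I, J.
  unfold Im, Re in I, J. simpl in I, J.
  destruct H as [[[H|H]|H]|H]; apply lt0_spec in H; rewrite ?opp3_spec in H; lra.
Qed.

Definition properb (r : zpl) : bool := nonzero (zsub (zeta (fst r)) zone) || nonzero (snd r).
Lemma properb_spec t r : unitary t -> properb r = true -> t <> compose t (pl r).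
Proof.
  intros Hu H E. unfold properb in H. apply orb_true_iff in H.
  assert (Hc : act t (act (pl r) (RtoC 0)) = act t (RtoC 0) /\ act t (act (pl r) (RtoC 1)) = act
    t (RtoC 1))
    by (rewrite <- !compose_act, <- E; easy).
  destruct Hc as [H0 H1]. apply (f_equal (loc t)) in H0, H1. rewrite !loc_act in H0, H1 by easy.
  unfold act, pl in H0, H1. cbn [lin off] in H0, H1.
  assert (E0 : ev (snd r) = RtoC 0) by (rewrite <- H0; ring).
  destruct H as [H|H]; apply nonzero_spec in H; apply H; [|easy].
  rewrite ev_sub, ev_one. rewrite E0 in H1.
  replace (ev (zeta (fst r))) with (ev (zeta (fst r)) * RtoC 1 + RtoC 0)%C by ring.
  rewrite H1. ring.
Qed.

Lemma overlap_false T t r : tiling T -> T t -> T (compose t (pl r)) ->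
  overlapb r = true -> properb r = true -> False.
Proof.
  intros HT Ht Ht' Ho Hp. apply (properb_spec t r); [now apply (tiling_unitary T)|easy|].
  now apply (overlap_eq T).
Qed.

(* When an end [a] of side [i] of [s] is interior to a side of [t], the angles on both
   sides of [a] are right angles. The end is the first one for [sg = 1]. *)
Lemma straddle T s t i j m sg e : tiling T -> T s -> T t -> (i < 14)%nat -> (j < 14)%nat ->
  0 < m < 1 -> (sg = 1 /\ e = 0%nat) \/ (sg = -1 /\ e = 1%nat) ->
  (lin t * dv j)%C = (- (lin s * dv i))%C ->
  act t (on_side j m) = act s (ev (pt (e + i))) ->
  In (e + i)%nat even_vertices /\ exists s' k, T s' /\ (k < 14)%nat /\
    (lin s' * dv k)%C = (lin s * dv i)%C /\ act s' (ev (pt (1 - e + k))) = act s (ev (pt (e +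
      i))).
Proof.
  intros HT Hs Ht Hi Hj Hm He Hd Hp.
  destruct (aligned T t j m sg HT Ht Hj) as (s' & k & x & Hs' & Hk & Hx & Hd' & Hp').
  { destruct He as [[-> _]|[-> _]]; [left|right]; lra. }
  assert (Hdd : (lin s' * dv k)%C = (lin s * dv i)%C) by (rewrite Hd', Hd; ring).
  rewrite Hp in Hp'.
  assert (End : forall i e, (i < 14)%nat -> (e <= 1)%nat -> on_side i (INR e) = ev (pt (e + i))).
  { intros i' e' Hi' He'. unfold on_side. destruct e' as [|[|]]; [simpl; ring| |lia].
    change (1 + i')%nat with (Datatypes.S i'). rewrite ev_pt_S by easy. simpl. ring. }
  assert (He1 : (e <= 1)%nat) by lia.
  (* If the point were interior to side k of s', then s' would overlap s, hence equal s, and a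
     vertex of s would be interior to one of its own sides. *)
  assert (Ex : x = INR (1 - e)).
  { apply NNPP. intros Hne.
    assert (Hx' : 0 < x < 1).
    { destruct Hx as [[Hx1 Hx]|[Hx1 Hx]], He as [[-> ->]|[-> ->]]; simpl in Hne; lra. }
    assert (E : s = s').
    { apply (same_direction_eq T s s' i k (INR e) x sg); auto.
      - destruct He as [[-> ->]|[-> ->]]; [left|right]; simpl; lra.
      - destruct He as [[-> ->]|[-> ->]]; [left|right]; lra.
      - now rewrite End. }
    subst s'. apply (f_equal (loc s)) in Hp'. rewrite !loc_act in Hp'
      by (now apply (tiling_unitary T)).
    now apply (vertex_not_inside (e + i) k x) in Hp'; [|lia| |lra]. }
  rewrite Ex, End in Hp' by (easy || lia). split; [|now exists s', k].
  assert (A : s' = compose s (pl (align 0 i k (pt (e + i)) (pt (1 - e + k))))).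
  { apply align_spec; [|easy]. rewrite Hdd. cbn [zeta]. rewrite ev_one. ring. }
  (* At this point t takes up a straight angle. No angle of the Spectre is below 90 degrees, so an
     angle of s other than 90 or 180 degrees leaves too little room for s'. *)
  assert (H : forallb (fun e => forallb (fun i => forallb (fun k => existsb (Nat.eqb (e + i))
    even_vertices ||
      (let r := align 0 i k (pt (e + i)) (pt (1 - e + k)) in overlapb r && properb r))
      (seq 0 14)) (seq 0 14)) (seq 0 2) = true) by (vm_compute; reflexivity).
  rewrite forallb_forall in H. specialize (H e ltac:(apply in_seq; lia)).
  rewrite forallb_forall in H. specialize (H i ltac:(apply in_seq; lia)).
  rewrite forallb_forall in H. specialize (H k ltac:(apply in_seq; lia)). cbv zeta in H.
  rewrite orb_true_iff, andb_true_iff, existsb_exists in H.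
  destruct H as [(i' & Hin & E)|[H1 H2]].
  - apply Nat.eqb_eq in E. now rewrite E.
  - exfalso. rewrite A in Hs'. now apply (overlap_false T s _ HT Hs Hs').
Qed.

(* A fractional offset between two sides would put both ends of side [i] in
   [even_vertices], but their indices differ by one. *)
Lemma edge_to_edge T s i : tiling T -> T s -> (i < 14)%nat ->
  exists j, (j < 14)%nat /\ T (compose s (pl (nbr0 i j))).
Proof.
  intros HT Hs Hi.
  destruct (aligned T s i 0 1 HT Hs Hi) as (t & j & m & Ht & Hj & Hm & Hd & Hp); [left; lra|].
  assert (Hi0 : on_side i 0 = ev (pt i)) by (unfold on_side; ring).
  rewrite Hi0 in Hp.
  destruct Hm as [[? _]|[_ Hm]]; [lra|]. destruct (Req_dec m 1) as [->|Hne].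
  - exists j. split; [easy|]. replace (compose s (pl (nbr0 i j))) with t; [easy|].
    apply align_spec.
    + rewrite Hd, ev_zeta_6. ring.
    + rewrite ev_pt_S by easy. unfold on_side in Hp. unfold act in *.
      replace (lin t * ev (pt j) + off t)%C with
        (lin t * (ev (pt j) + RtoC 1 * dv j) + off t - lin t * dv j)%C by ring.
      rewrite Hp, Hd. ring.
  - exfalso. assert (Hm' : 0 < m < 1) by lra.
    destruct (straddle T s t i j m 1 0) as [Hev _]; auto.
    assert (Hd2 : (lin s * dv i)%C = (- (lin t * dv j))%C) by (rewrite Hd; ring).
    assert (Hp2 : act s (on_side i m) = act t (ev (pt j))).
    { unfold on_side, act in *.
      replace (lin s * (ev (pt i) + RtoC m * dv i) + off s)%C with
        (lin s * ev (pt i) + off s + RtoC m * (lin s * dv i))%C by ring.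
      rewrite <- Hp, Hd2. ring. }
    (* In turn, the start of side j of t is interior to side i of s. The tile t' prolongs side j of
       t there, and the end of side i of s is interior to side k of t'. *)
    destruct (straddle T t s j i m 1 0) as [_ (t' & k & Ht' & Hk & Hd3 & Hp3)]; auto.
    change (1 - 0 + k)%nat with (S k) in Hp3. change (0 + j)%nat with j in Hp3.
    assert (Hev2 : In (S i) even_vertices).
    { apply (straddle T s t' i k m (-1) 1); auto.
      - now rewrite Hd3.
      - change (1 + i)%nat with (S i). rewrite ev_pt_S by easy. rewrite ev_pt_S in Hp3 by easy.
        unfold on_side, act in *.
        replace (lin t' * (ev (pt k) + RtoC m * dv k) + off t')%C with
          (lin t' * (ev (pt k) + dv k) + off t' + RtoC (m - 1) * (lin t' * dv k))%C
          by (rewrite RtoC_minus; ring).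
        rewrite Hp3, <- Hp2, Hd3, Hd, RtoC_minus. ring. }
    revert Hev Hev2. unfold even_vertices. simpl. intros. lia.
Qed.

(** * Neighbours connect the tiling *)

Lemma nbr_spec t i j : (i < 14)%nat -> (j < 14)%nat ->
  let t' := compose t (pl (nbr0 i j)) in
  (lin t' * dv j)%C = (- (lin t * dv i))%C /\
  act t' (ev (pt j)) = act t (ev (pt (S i))) /\
  act t' (ev (pt (S j))) = act t (ev (pt i)).
Proof.
  intros Hi Hj t'. set (r := ((dir i + 12 + 6 - dir j) mod 12)%nat).
  assert (Hr : (ev (zeta r) * dv j)%C = (- dv i)%C).
  { unfold r, dv. rewrite zeta_mod, <- ev_mul, <- zeta_add.
    pose proof (dir_le j). replace (dir i + 12 + 6 - dir j + dir j)%nat with (12 + (6 + dir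
      i))%nat by lia.
    rewrite zeta_12, zeta_add, ev_mul, ev_zeta_6. ring. }
  assert (Hl : lin t' = (lin t * ev (zeta r))%C) by easy.
  assert (H1 : (lin t' * dv j)%C = (- (lin t * dv i))%C).
  { rewrite Hl, <- Cmult_assoc, Hr. ring. }
  assert (H2 : act t' (ev (pt j)) = act t (ev (pt (S i)))).
  { unfold t'. rewrite compose_act. f_equal. unfold act, pl, nbr0, align. fold r.
    cbn [lin off fst snd].
    rewrite ev_sub, ev_mul, zt_spec by (now apply Nat.mod_upper_bound). ring. }
  split; [easy|]. split; [easy|].
  rewrite ev_pt_S in * by easy. unfold act in *.
  replace (lin t' * (ev (pt j) + dv j) + off t')%C with (lin t' * ev (pt j) + off t' + lin t' *
    dv j)%C by ring.
  rewrite H2, H1. ring.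
Qed.

(* Interior angles at the vertices, in units of 30 degrees. *)
Definition side_angle (i : nat) : nat := nth i [3; 8; 3; 4; 9; 4; 3; 4; 9; 4; 6; 4; 3;
  8]%nat 0%nat.

(** Sector b at vertex i lies between the directions [dir i - b] and [dir i - (b + 1)], clockwise
    from side i, where the interior is. Adding 24 prevents truncated subtraction. *)
Definition sector_check : bool :=
  forallb (fun i => forallb (fun b => forallb (fun cl => existsb (fun f =>
     vlt f i || (vle f i &&
       let d := zconj (zsub (pt (snd f)) (pt (fst f))) in
       le0 (im2 (zmul d (zeta (dir i + 24 - b)))) && le0 (im2 (zmul d (zeta (dir i + 24 - S
         b)))))) cl)
     clauses) (seq 0 (side_angle i))) (seq 0 14).
Lemma sector_check_true : sector_check = true.
Proof. vm_compute. reflexivity. Qed.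

Lemma lform_ev f w : eval3 (im2 (zmul (zconj (zsub (pt (snd f)) (pt (fst f)))) w)) = 2 * lform f
  (ev w).
Proof. rewrite im2_spec, ev_mul, ev_conj, ev_sub. easy. Qed.

Lemma lform_0 f : lform f (RtoC 0) = 0.
Proof. unfold lform, Im. simpl. ring. Qed.

Lemma sector_in i b x y : (i < 14)%nat -> (b < side_angle i)%nat -> 0 <= x -> 0 <= y ->
  germ_in (ev (pt i))
    (RtoC x * ev (zeta (dir i + 24 - S b)) + RtoC y * ev (zeta (dir i + 24 - b)))%C (RtoC 0).
Proof.
  intros Hi Hb Hx Hy cl Hc. pose proof sector_check_true as H. unfold sector_check in H.
  rewrite forallb_forall in H. specialize (H i). rewrite in_seq, forallb_forall in H.
  specialize (H ltac:(lia) b). rewrite in_seq, forallb_forall in H.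
  specialize (H ltac:(lia) cl Hc). apply existsb_exists in H. destruct H as (f & Hf & H).
  exists f. split; [easy|]. rewrite lform_add, !lform_scal, lform_0.
  rewrite orb_true_iff in H. cbv zeta in H. rewrite !andb_true_iff in H.
  destruct H as [H|[H1 [H2 H3]]].
  - apply vlt_spec in H. unfold lex_pos, lex_neg. lra.
  - apply vle_spec in H1. apply le0_spec in H2, H3. rewrite lform_ev in H2, H3.
    unfold lex_pos, lex_neg. nra.
Qed.

Lemma side_form_dir i : (i < 14)%nat -> exists k, 0 < k /\ fdir (side_form i) = (RtoC k * dv i)%C.
Proof.
  intros Hi.
  assert (E : side_form i = (i, S i) \/ (side_form i = (9, 11)%nat /\ (i = 9 \/ i = 10)%nat)).
  { do 14 (destruct i as [|i]; [unfold side_form; simpl; tauto|]). lia. }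
  destruct E as [E|[E E']]; rewrite E.
  - exists 1. split; [lra|]. unfold fdir. cbn [fst snd]. rewrite ev_pt_S by easy. ring.
  - exists 2. split; [lra|]. rewrite (proj1 dv_9_10). destruct E' as [-> | ->]; [easy|].
    now rewrite (proj2 dv_9_10).
Qed.

Lemma side_interior_in i l e : (i < 14)%nat -> 0 < l < 1 -> Im (Cconj (dv i) * e)%C <= 0 ->
  germ_in (on_side i l) e (RtoC 0).
Proof.
  intros Hi Hl He cl Hc. pose proof side_check_true as H. unfold side_check in H.
  rewrite forallb_forall in H. specialize (H i). rewrite in_seq, !andb_true_iff in H.
  destruct H as [[[[H1 H2] _] H4] H5]; [lia|]. apply veq_spec in H1, H2.
  rewrite forallb_forall in H5. specialize (H5 cl Hc).
  destruct (existsb (feqb (side_form i)) cl) eqn:E.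
  - apply existsb_exists in E. destruct E as (f & Hf & E). apply feqb_eq in E. subst f.
    exists (side_form i). split; [easy|]. rewrite on_side_form, H1, H2, lform_0 by easy.
    destruct (side_form_dir i Hi) as (k & Hk & Ek).
    assert (L : lform (side_form i) e <= 0).
    { unfold lform. rewrite Ek. destruct (dv i), e. unfold Im in *. simpl in *. nra. }
    unfold lex_pos, lex_neg. lra.
  - apply existsb_exists in H5. destruct H5 as (f & Hf & H5).
    rewrite !andb_true_iff, orb_true_iff in H5. destruct H5 as [[H6 H7] H8].
    apply vle_spec in H6, H7. exists f. split; [easy|]. rewrite on_side_form by easy.
    assert (H9 : form f (ev (pt i)) < 0 \/ form f (ev (pt (S i))) < 0)
      by (destruct H8 as [H8|H8]; apply vlt_spec in H8; tauto).
    assert ((1 - l) * form f (ev (pt i)) + l * form f (ev (pt (S i))) < 0) by nra.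
    unfold lex_pos, lex_neg. lra.
Qed.

(** The first quadrant is cut at 30 and 60 degrees, and the other quadrants are rotated onto it. *)
Lemma sector_decomposition (w : C) : exists a x y, 0 <= x /\ 0 <= y /\
  w = (RtoC x * ev (zeta a) + RtoC y * ev (zeta (S a)))%C.
Proof.
  assert (Q : forall X Y, 0 <= X -> 0 <= Y -> exists a x y, 0 <= x /\ 0 <= y /\
     (X, Y) = (RtoC x * ev (zeta a) + RtoC y * ev (zeta (S a)))%C).
  { intros X Y HX HY. pose proof q3_sq as Hq. pose proof q3_pos as Hp.
    destruct (Rle_dec (q3 * Y) X).
    - exists 0%nat, (X - q3 * Y), (2 * Y). repeat split; [lra|lra|].
      apply injective_projections; simpl; field.
    - destruct (Rle_dec (q3 * X) Y).
      + exists 2%nat, (2 * X), (Y - q3 * X). repeat split; [lra|lra|].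
        apply injective_projections; simpl; field.
      + exists 1%nat, (q3 * X - Y), (q3 * Y - X). repeat split; [lra|lra|].
        apply injective_projections; simpl; field [Hq]. }
  assert (E3 : ev (zeta 3) = Ci).
  { apply injective_projections; simpl; field. }
  assert (Rt : forall k X Y, 0 <= X -> 0 <= Y -> w = (ev (zeta k) * (X, Y))%C ->
     exists a x y, 0 <= x /\ 0 <= y /\ w = (RtoC x * ev (zeta a) + RtoC y * ev (zeta (S a)))%C).
  { intros k X Y HX HY ->. destruct (Q X Y HX HY) as (a & x & y & Hx & Hy & ->).
    exists (k + a)%nat, x, y. repeat split; [easy..|].
    rewrite plus_n_Sm, !zeta_add, !ev_mul. ring. }
  destruct w as [X Y]. destruct (Rle_dec 0 X), (Rle_dec 0 Y).
  - apply (Rt 0%nat X Y); try lra. cbn [zeta]. rewrite ev_one.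
    apply injective_projections; simpl; ring.
  - apply (Rt 9%nat (- Y) X); try lra.
    replace (zeta 9) with (zmul (zeta 3) (zmul (zeta 3) (zeta 3))) by reflexivity.
    rewrite !ev_mul, E3.
    apply injective_projections; simpl; ring.
  - apply (Rt 3%nat Y (- X)); try lra. rewrite E3. apply injective_projections; simpl; ring.
  - apply (Rt 6%nat (- X) (- Y)); try lra. rewrite ev_zeta_6.
    apply injective_projections; simpl; ring.
Qed.

Definition closed_under_neighbours (K : placement -> Prop) : Prop :=
  forall t i, K t -> (i < 14)%nat -> exists j, (j < 14)%nat /\ K (compose t (pl (nbr0 i j))).

Lemma germ_in_tile t v e : germ_in (loc t v) (Cconj (lin t) * e) (RtoC 0) ->
  at_right 0 (fun u => inT t (v + RtoC u * e)%C).
Proof.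
  intros H. apply germ_in_at0 in H. revert H. apply filter_imp. intros u Hu.
  unfold inT. rewrite loc_add. unfold curve in Hu.
  replace (loc t v + Cconj (lin t) * (RtoC u * e))%C with
    (loc t v + (RtoC u * (Cconj (lin t) * e) + RtoC (u * u) * RtoC 0))%C by ring. easy.
Qed.

Definition next_vertex (j : nat) : nat := (S j mod 14)%nat.
Lemma turn j : (j < 14)%nat ->
  dv (next_vertex j) = (- dv j * ev (zeta (side_angle (next_vertex j))))%C /\
  (1 <= side_angle (next_vertex j))%nat.
Proof.
  intros Hj.
  assert (H : forallb (fun j => zz_eqb (zeta (dir (next_vertex j)))
     (zmul (zscale (-1) (zeta (dir j))) (zeta (side_angle (next_vertex j))))
     && (1 <=? side_angle (next_vertex j))%nat) (seq 0 14) = true) by (vm_compute; reflexivity).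
  rewrite forallb_forall in H. specialize (H j).
  rewrite in_seq, andb_true_iff, zz_eqb_eq, Nat.leb_le in H.
  destruct H as [H1 H2]; [lia|]. split; [|easy]. unfold dv. rewrite H1, ev_mul, ev_scale.
  replace (RtoC (IZR (-1))) with (- RtoC 1)%C by (apply injective_projections; simpl; ring). ring.
Qed.

(* Turning counterclockwise round a vertex, from tile to tile. *)
Lemma vertex_cover K : (forall t, K t -> unitary t) -> closed_under_neighbours K ->
  forall a t i x y, K t -> (i < 14)%nat -> 0 <= x -> 0 <= y ->
  exists t', K t' /\ at_right 0 (fun u => inT t' (act t (ev (pt i)) +
    RtoC u * (lin t * dv i * (RtoC x * ev (zeta a) + RtoC y * ev (zeta (S a)))))%C).
Proof.
  intros HU HK a. induction a as [a IH] using lt_wf_ind. intros t i x y Ht Hi Hx Hy.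
  destruct (HK t i Ht Hi) as (j & Hj & Ht').
  destruct (nbr_spec t i j Hi Hj) as (Hd & _ & Hp).
  set (t' := compose t (pl (nbr0 i j))) in *. set (i' := next_vertex j).
  assert (Hi' : (i' < 14)%nat) by (unfold i', next_vertex; now apply Nat.mod_upper_bound).
  destruct (turn j Hj) as [Ht1 Ht2]. fold i' in Ht1, Ht2.
  assert (Hp' : act t' (ev (pt i')) = act t (ev (pt i))).
  { unfold i', next_vertex. rewrite pt_mod; easy. }
  assert (Hu : (lin t' * dv i')%C = (lin t * dv i * ev (zeta (side_angle i')))%C).
  { rewrite Ht1. replace (lin t' * (- dv j * ev (zeta (side_angle i'))))%C with
      (- (lin t' * dv j) * ev (zeta (side_angle i')))%C by ring. rewrite Hd. ring. }
  (* Sector a is within the angle of t' at the vertex or past it. In the second case the count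
     resumes from the far side of that angle, which is at least 30 degrees, so the index
     decreases. *)
  destruct (Nat.lt_ge_cases a (side_angle i')) as [Hlt|Hge].
  - exists t'. split; [easy|]. rewrite <- Hp'. apply germ_in_tile.
    assert (Hut := HU t' Ht'). rewrite loc_act by easy.
    set (m := side_angle i') in *. set (n := (dir i' + 24 - m)%nat).
    assert (Hm : (m <= 9)%nat).
    { unfold m. clear - Hi'. do 14 (destruct i' as [|i']; [unfold side_angle; simpl; lia|]). lia.
      }
    pose proof (sector_in i' (m - a - 1) x y Hi' ltac:(lia) Hx Hy) as S.
    replace (dir i' + 24 - Datatypes.S (m - a - 1))%nat with (n + a)%nat in S by lia.
    replace (dir i' + 24 - (m - a - 1))%nat with (n + Datatypes.S a)%nat in S by lia.
    rewrite !zeta_add, !ev_mul in S.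
    assert (N : (ev (zeta m) * Cconj (ev (zeta m)))%C = RtoC 1) by (rewrite Cmult_comm;
      apply zeta_norm).
    assert (E1 : (ev (zeta n) * ev (zeta m))%C = dv i').
    { rewrite <- ev_mul, <- zeta_add. unfold dv. f_equal.
      replace (n + m)%nat with (12 + (12 + dir i'))%nat by lia. now rewrite !zeta_12. }
    assert (E : (Cconj (lin t') * (lin t * dv i))%C = ev (zeta n)).
    { transitivity (Cconj (lin t') * (lin t * dv i) * (ev (zeta m) * Cconj (ev (zeta m))))%C;
        [rewrite N; ring|].
      transitivity (Cconj (lin t') * (lin t * dv i * ev (zeta m)) * Cconj (ev (zeta m)))%C;
        [ring|].
      rewrite <- Hu, Cmult_assoc, Hut, <- E1.
      transitivity (ev (zeta n) * (ev (zeta m) * Cconj (ev (zeta m))))%C; [ring|]. rewrite N.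
      ring. }
    assert (Ed : (Cconj (lin t') * (lin t * dv i *
        (RtoC x * ev (zeta a) + RtoC y * ev (zeta (Datatypes.S a)))))%C =
      (RtoC x * (ev (zeta n) * ev (zeta a)) + RtoC y * (ev (zeta n) * ev (zeta (Datatypes.S
        a))))%C)
      by (rewrite <- E; ring).
    rewrite Ed. exact S.
  - destruct (IH (a - side_angle i')%nat ltac:(lia) t' i' x y Ht' Hi' Hx Hy) as (t2 & Ht2' & H).
    exists t2. split; [easy|]. revert H. apply filter_imp. intros u. rewrite Hp', Hu.
    replace (zeta a) with (zmul (zeta (side_angle i')) (zeta (a - side_angle i')))
      by (rewrite <- zeta_add; f_equal; lia).
    replace (zeta (Datatypes.S a)) with (zmul (zeta (side_angle i')) (zeta (Datatypes.S (a -
      side_angle i'))))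
      by (rewrite <- zeta_add; f_equal; lia).
    rewrite !ev_mul. intros H. eapply eq_ind; [exact H|]. f_equal. ring.
Qed.

(** Inside a tile, or leaving one of its sides inwards, the same tile serves; across a side the
    glued neighbour does; at a vertex the tiles are visited in turn around it. *)
Lemma local_cover K : (forall t, K t -> unitary t) -> closed_under_neighbours K ->
  forall t v e, K t -> inT t v -> exists t',
    K t' /\ at_right 0 (fun u => inT t' (v + RtoC u * e)%C).
Proof.
  intros HU HK t v e Ht Hv. assert (Hut := HU t Ht).
  assert (Hut' : (lin t * Cconj (lin t))%C = RtoC 1) by (rewrite Cmult_comm; exact Hut).
  assert (Vtx : forall i, (i < 14)%nat -> v = act t (ev (pt i)) ->
    exists t', K t' /\ at_right 0 (fun u => inT t' (v + RtoC u * e)%C)).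
  { intros i Hi Ei.
    destruct (sector_decomposition (Cconj (dv i) * (Cconj (lin t) * e))%C) as (a & x & y & Hx &
      Hy & E).
    destruct (vertex_cover K HU HK a t i x y Ht Hi Hx Hy) as (t' & Ht' & H).
    exists t'. split; [easy|]. rewrite <- E, <- Ei in H.
    replace (lin t * dv i * (Cconj (dv i) * (Cconj (lin t) * e)))%C with
      ((lin t * Cconj (lin t)) * (Cconj (dv i) * dv i) * e)%C in H by ring.
    rewrite Hut', dv_unit in H. now replace (RtoC 1 * RtoC 1 * e)%C with e in H by ring. }
  destruct (inS_cases _ Hv) as [Hs|(i & l & Hi & Hl & E)].
  - exists t. split; [easy|]. apply germ_in_tile. intros cl Hc.
    destruct (Hs cl Hc) as (f & Hf & L).
    exists f. split; [easy|]. unfold lex_pos, lex_neg. lra.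
  - apply (f_equal (act t)) in E. rewrite act_loc in E by easy.
    destruct (Req_dec l 0) as [->|Hl0].
    { apply (Vtx i Hi). rewrite E. f_equal. unfold on_side. ring. }
    destruct (Req_dec l 1) as [->|Hl1].
    { apply (Vtx (next_vertex i)); [unfold next_vertex; now apply Nat.mod_upper_bound|].
      rewrite E. f_equal. unfold on_side, next_vertex. rewrite pt_mod, ev_pt_S by easy. ring. }
    destruct (Rle_dec (Im (Cconj (dv i) * (Cconj (lin t) * e))%C) 0) as [He|He].
    + exists t. split; [easy|]. apply germ_in_tile. rewrite E, loc_act by easy.
      apply side_interior_in; auto. lra.
    + destruct (HK t i Ht Hi) as (j & Hj & Ht').
      destruct (nbr_spec t i j Hi Hj) as (Hd & Hp & _).
      set (t' := compose t (pl (nbr0 i j))) in *. exists t'. split; [easy|].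
      assert (Hu' := HU t' Ht').
      apply germ_in_tile.
      assert (Ev : v = act t' (on_side j (1 - l))).
      { rewrite E. rewrite ev_pt_S in Hp by easy. unfold on_side, act in *.
        replace (lin t' * (ev (pt j) + RtoC (1 - l) * dv j) + off t')%C with
          (lin t' * ev (pt j) + off t' + RtoC (1 - l) * (lin t' * dv j))%C by ring.
        rewrite Hp, Hd, RtoC_minus. ring. }
      rewrite Ev, loc_act by easy. apply side_interior_in; [easy|lra|].
      assert (Ec : (Cconj (dv j) * (Cconj (lin t') * e))%C = (- (Cconj (dv i) * (Cconj (lin t) *
        e)))%C).
      { replace (Cconj (dv j) * (Cconj (lin t') * e))%C with (Cconj (lin t' * dv j) * e)%C
          by (rewrite Cmult_conj; ring).
        rewrite Hd. replace (Cconj (- (lin t * dv i)))%C with (- (Cconj (lin t) * Cconj (dv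
          i)))%C; [ring|].
        apply injective_projections; simpl; ring. }
      rewrite Ec. destruct (Cconj (dv i) * (Cconj (lin t) * e))%C. unfold Im in *. simpl in *.
      lra.
Qed.

(** On the segment from the centre of t0 to that of t, being covered by K passes to limits from the
    left by local finiteness, and extends to the right by [local_cover]. The tile of K that covers
    the centre of t can only be t. *)
Lemma neighbours_connect T K t0 : tiling T -> (forall t, K t -> T t) -> K t0 ->
  closed_under_neighbours K -> forall t, T t -> K t.
Proof.
  intros HT HKT H0 HK t Ht.
  assert (HU : forall t, K t -> unitary t) by (intros; apply (tiling_unitary T); auto).
  assert (Hut := tiling_unitary T HT t Ht).
  set (z0 := act t0 kappa). set (E := (act t kappa - z0)%C).
  assert (Q : exists t', K t' /\ inT t' (z0 + RtoC 1 * E)%C).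
  { apply (real_induction (fun u => exists t', K t' /\ inT t' (z0 + RtoC u * E)%C) 0 1);
      [lra| | |].
    - exists t0. split; [easy|]. unfold inT. replace (z0 + RtoC 0 * E)%C with z0 by ring.
      unfold z0. rewrite loc_act by auto. apply sS_inS, kappa_sS.
    - intros u Hu Hl. pose proof (Cmod_ge_0 E) as HE.
      (* This keeps the parameters u - h / (k + 2) nonnegative and their points within distance 1 of
         the limit. *)
      set (h := Rmin u (/ (Cmod E + 1))).
      assert (Hh : 0 < h /\ h <= u /\ h * Cmod E <= 1).
      { assert (0 < / (Cmod E + 1)) by (apply Rinv_0_lt_compat; lra).
        split; [apply Rmin_glb_lt; lra|]. split; [apply Rmin_l|].
        apply Rle_trans with (/ (Cmod E + 1) * (Cmod E + 1)); [|right; field; lra].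
        assert (h <= / (Cmod E + 1)) by apply Rmin_r. nra. }
      assert (Hk : forall k, 0 < / (INR k + 2) <= 1 / 2).
      { intros k. pose proof (pos_INR k). split; [apply Rinv_0_lt_compat; lra|].
        replace (1 / 2) with (/ 2) by lra. apply Rinv_le_contravar; lra. }
      destruct (tile_covers_infinitely_often T K (z0 + RtoC u * E)%C
        (fun k => z0 + RtoC (u - h * / (INR k + 2)) * E)%C HT HKT) as (t' & Ht' & Hacc).
      + intros k. specialize (Hk k). revert Hk. generalize (/ (INR k + 2)). intros r Hr.
        replace (z0 + RtoC (u - h * r) * E - (z0 + RtoC u * E))%C with (- (RtoC (h * r) * E))%C
          by (rewrite RtoC_minus; ring).
        rewrite Cmod_opp, Cmod_mult, Cmod_R, Rabs_pos_eq by nra. nra.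
      + intros k. apply Hl. specialize (Hk k). nra.
      + exists t'. split; [easy|].
        assert (G : germ_in (loc t' (z0 + RtoC u * E)) (Cconj (lin t') * (- (RtoC h * E))) (RtoC
          0)).
        { apply germ_in_of_seq. intros m. destruct (Hacc m) as (k & Hkm & HS). exists k.
          split; [easy|].
          revert HS. generalize (/ (INR k + 2)). intros r HS. unfold inT in HS.
          eapply eq_ind; [exact HS|]. unfold curve. rewrite RtoC_minus, !RtoC_mult. unfold loc.
          ring. }
        intros cl Hc. destruct (G cl Hc) as (f & Hf & L). exists f. split; [easy|].
        unfold lex_pos, lex_neg in L. lra.
    - intros u Hu (t' & Ht' & HS).
      destruct (local_cover K HU HK t' _ E Ht' HS) as (t2 & Ht2 & G).
      apply at0_inv in G. destruct G as (d & Hd & G). exists d. split; [easy|].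
      intros u' Hu'. exists t2. split; [easy|]. specialize (G (u' - u) ltac:(lra)).
      eapply eq_ind; [exact G|]. rewrite RtoC_minus. ring. }
  destruct Q as (t' & Ht' & HS). replace (z0 + RtoC 1 * E)%C with (act t kappa) in HS
    by (unfold E; ring).
  replace t with t'; [easy|]. symmetry. apply (tiling_disjoint T HT t t' (act t kappa)); auto.
  unfold sT. rewrite loc_act by easy. apply kappa_sS.
Qed.

(** * Forced patches *)

Definition mem (x : zpl) (l : list zpl) : bool := anyb (zpl_eqb x) l.
Lemma mem_In x l : mem x l = true <-> In x l.
Proof.
  unfold mem. rewrite anyb_exists. split.
  - intros (y & Hy & E). apply zpl_eqb_eq in E. now subst.
  - intros H. exists x. split; [easy|]. now apply zpl_eqb_eq.
Qed.

Definition nbrs : list (list zpl) :=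
  Eval vm_compute in map (fun i => map (nbr0 i) (seq 0 14)) (seq 0 14).
Lemma nbrs_eq : nbrs = map (fun i => map (nbr0 i) (seq 0 14)) (seq 0 14).
Proof. vm_compute. reflexivity. Qed.
Lemma nth_nbrs i : (i < 14)%nat -> nth i nbrs [] = map (nbr0 i) (seq 0 14).
Proof.
  intros Hi. rewrite nbrs_eq.
  rewrite (nth_indep _ [] (map (nbr0 0) (seq 0 14))) by (rewrite length_map, length_seq; lia).
  rewrite (map_nth (fun i => map (nbr0 i) (seq 0 14))), seq_nth by lia. easy.
Qed.
(** All the gluings, sorted by rotation to shorten the lookups. *)
Definition share_table : list (list zpl) :=
  Eval vm_compute in map (fun k => filter (fun r => (fst r =? k)%nat) (concat nbrs)) (seq 0 12).
Definition sharesb (r : zpl) : bool := mem r (nth (fst r) share_table []).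
Lemma share_table_sound : allb (allb (fun r => anyb (mem r) nbrs)) share_table = true.
Proof. vm_compute. reflexivity. Qed.
Lemma share_table_complete : allb (allb sharesb) nbrs = true.
Proof. vm_compute. reflexivity. Qed.
Lemma sharesb_spec r : sharesb r = true <-> exists i j,
  (i < 14)%nat /\ (j < 14)%nat /\ r = nbr0 i j.
Proof.
  split.
  - intros H. apply mem_In in H.
    assert (H' : anyb (mem r) nbrs = true).
    { pose proof share_table_sound as C. rewrite allb_forall in C.
      destruct (Nat.lt_ge_cases (fst r) (length share_table)) as [Hl|Hl].
      - specialize (C _ (nth_In _ [] Hl)). rewrite allb_forall in C. now apply C.
      - now rewrite nth_overflow in H. }
    apply anyb_exists in H'. rewrite nbrs_eq in H'. destruct H' as (l & Hl & H').
    apply in_map_iff in Hl. destruct Hl as (i & <- & Hi).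
    apply mem_In, in_map_iff in H'. destruct H' as (j & <- & Hj). apply in_seq in Hi, Hj.
    exists i, j. repeat split; lia.
  - intros (i & j & Hi & Hj & ->). pose proof share_table_complete as C.
    rewrite allb_forall, nbrs_eq in C. specialize (C (map (nbr0 i) (seq 0 14))).
    rewrite allb_forall in C. apply C.
    + apply (in_map (fun i => map (nbr0 i) (seq 0 14))), in_seq. lia.
    + apply in_map, in_seq. lia.
Qed.
Lemma nbr0_lt i j : (fst (nbr0 i j) < 12)%nat.
Proof. unfold nbr0, align. cbn [fst]. now apply Nat.mod_upper_bound. Qed.

(* The tiles of a tiling, in coordinates relative to an odd tile; the odd tiles are
   those with an even first coordinate. *)
Record good (X : zpl -> Prop) : Prop := {
  good_lt : forall x, X x -> (fst x < 12)%nat;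
  good_nbr : forall x i, X x -> (i < 14)%nat -> exists j, (j < 14)%nat /\ X (zcomp x (nbr0 i j));
  good_disjoint : forall x y, X x -> X y -> overlapb (zrel x y) = true -> x = y;
  good_odd : forall x y, X x -> X y -> Nat.even (fst x) = true -> Nat.even (fst y) = true ->
    sharesb (zrel x y) = true -> x = y }.

Definition translated (g : zpl) (X : zpl -> Prop) (x : zpl) : Prop :=
  (fst x < 12)%nat /\ X (zcomp g x).

Lemma zrel_zcomp_zcomp g x y : (fst g < 12)%nat -> (fst x < 12)%nat -> (fst y < 12)%nat ->
  zrel (zcomp g x) (zcomp g y) = zrel x y.
Proof.
  intros Hg Hx Hy. rewrite <- (zcomp_zrel x y) at 1 by easy.
  rewrite zcomp_assoc by easy. apply zrel_zcomp; [apply zcomp_lt|]. unfold zrel. apply zcomp_lt.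
Qed.

Lemma even_mod12 n : Nat.even (n mod 12) = Nat.even n.
Proof.
  rewrite (Nat.div_mod_eq n 12) at 2. rewrite Nat.even_add, Nat.even_mul.
  change (Nat.even 12) with true. cbn [orb]. now destruct (Nat.even (n mod 12)).
Qed.
Lemma even_zcomp x y : Nat.even (fst (zcomp x y)) = Bool.eqb (Nat.even (fst x)) (Nat.even (fst
  y)).
Proof. unfold zcomp. cbn [fst]. now rewrite even_mod12, Nat.even_add. Qed.
Lemma even_zinv x : (fst x < 12)%nat -> Nat.even (fst (zinv x)) = Nat.even (fst x).
Proof. intros H. unfold zinv. cbn [fst]. rewrite even_mod12, Nat.even_sub by lia.
now destruct (Nat.even (fst x)). Qed.

Lemma zcomp_inj g x y : (fst g < 12)%nat -> (fst x < 12)%nat -> (fst y < 12)%nat ->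
  zcomp g x = zcomp g y -> x = y.
Proof.
  intros Hg Hx Hy E. rewrite <- (zrel_zcomp g x), <- (zrel_zcomp g y) by easy. now rewrite E.
Qed.

Lemma good_translated g X : (fst g < 12)%nat -> Nat.even (fst g) = true -> good X -> good
  (translated g X).
Proof.
  intros Hg He HX. unfold translated. split.
  - now intros x [H _].
  - intros x i [Hx Hx'] Hi. destruct (good_nbr X HX _ i Hx' Hi) as (j & Hj & H).
    exists j. split; [easy|]. split; [apply zcomp_lt|]. now rewrite zcomp_assoc.
  - intros x y [Hx Hx'] [Hy Hy'] H. apply (zcomp_inj g); auto.
    apply (good_disjoint X HX); auto. now rewrite zrel_zcomp_zcomp.
  - intros x y [Hx Hx'] [Hy Hy'] Ex Ey H. apply (zcomp_inj g); auto.
    apply (good_odd X HX); auto; [now rewrite even_zcomp, He, Ex|now rewrite even_zcomp, He, Ey|].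
    now rewrite zrel_zcomp_zcomp.
Qed.

(** * Search trees and their checker *)

Inductive tree := Lf | Nd (t i : nat) (l : list tree).

(* [Nd t i l]: side [i] of the [t]-th tile has a neighbour, and [l] treats in order
   the ones not excluded by a conflict. *)
Fixpoint check (cands : zpl -> nat -> list zpl) (conflict : zpl -> zpl -> bool)
    (goal : list zpl -> bool) (tr : tree) (patch : list zpl) : bool :=
  match tr with
  | Lf => goal patch
  | Nd t i l =>
    let x := nth t patch zid in
    let opts := filter (fun n => negb (anyb (fun s => conflict s n) patch))
                  (map (zcomp x) (cands x i)) in
    ((t <? length patch) && (i <? 14))%nat &&
    (fix all (l : list tree) (opts : list zpl) : bool :=
       match l, opts with
       | [], [] => true
       | s :: l', n :: opts' =>
         if check cands conflict goal s (patch ++ [n]) then all l' opts' else false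
       | _, _ => false
       end) l opts
  end.

(** The actual neighbour along the chosen side is never filtered out, so it selects a branch; a node
    whose options are all excluded is a contradiction. The explicit [fix] is due to the nesting of
    trees in lists. *)
Lemma check_sound X cands conflict goal :
  (forall x i, X x -> (i < 14)%nat -> exists r, In r (cands x i) /\ X (zcomp x r)) ->
  (forall s n, X s -> X n -> conflict s n = true -> False) ->
  forall tr patch, check cands conflict goal tr patch = true -> (forall x, In x patch -> X x) ->
  exists patch', (forall x, In x patch' -> X x) /\ goal patch' = true.
Proof.
  intros Hcands conflict_sound. fix check_sound 1.
  intros tr patch H HP. destruct tr as [|t i l].
  - now exists patch.
  - cbn [check] in H. apply andb_true_iff in H. destruct H as [H H2].
    apply andb_true_iff in H. rewrite !Nat.ltb_lt in H. destruct H as [Ht Hi].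
    assert (Hx : X (nth t patch zid)) by (apply HP, nth_In; easy).
    destruct (Hcands _ i Hx Hi) as (r & Hr & Hn).
    set (x := nth t patch zid) in *. set (n := zcomp x r) in *.
    assert (Hin : In n (filter (fun n => negb (anyb (fun s => conflict s n) patch))
                  (map (zcomp x) (cands x i)))).
    { apply filter_In. split.
      - unfold n. now apply in_map.
      - destruct (anyb _ _) eqn:E; [|easy]. apply anyb_exists in E.
        destruct E as (s & Hs & E). exfalso. now apply (conflict_sound s n); auto. }
    revert H2 Hin.
    generalize (filter (fun n => negb (anyb (fun s => conflict s n) patch))
                  (map (zcomp x) (cands x i))).
    induction l as [|s l IH]; intros [|n' opts] H2 Hin; try easy.
    destruct (check cands conflict goal s (patch ++ [n'])) eqn:E; [|easy].
    destruct Hin as [->|Hin].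
    + apply (check_sound s _ E). intros x' Hx'. apply in_app_or in Hx'.
      destruct Hx' as [Hx'|[<-|[]]]; auto.
    + now apply (IH opts).
Qed.

Definition zp (k : nat) (a b c d : Z) : zpl := (k, (a, b, c, d)).

(* The tiles forced around an odd tile, relative to it. *)
Definition cluster : list zpl :=
  [ zp 0 0 0 0 0; zp 3 3 2 0 (-1); zp 11 2 0 (-1) (-3); zp 11 3 (-1) 0 (-1); zp 9 2 (-1) (-1)
   (-1); zp 1 (-1) (-3) 2 0; zp 3 1 1 1 (-2); zp 5 1 0 1 0; zp 1 3 1 0 (-2) ].

(* The relative placements of two tiles sharing a side that are not refuted below,
   the first tile being odd, respectively even. *)
Definition edges_odd : list zpl :=
  [ zp 1 (-1) (-3) 2 0; zp 3 1 1 1 (-2); zp 9 2 (-1) (-1) (-1); zp 11 3 (-1) 0 (-1) ].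

Definition edges_even : list zpl :=
  [ zp 0 (-2) 1 1 1; zp 0 2 (-1) (-1) (-1); zp 1 (-1) (-3) 2 0; zp 2 0 (-2) (-3) 1; zp 2 0 (-1) 0
   2; zp 2 1 0 1 0; zp 2 2 (-3) (-4) 0; zp 3 (-2) (-1) 1 (-1); zp 4 1 (-3) (-2) 0; zp 4 3 1 0
   (-2); zp 4 5 0 (-1) (-3); zp 4 6 (-2) (-3) (-2); zp 6 4 (-2) (-2) (-2); zp 8 0 2 3 (-1); zp 8
   1 3 4 (-3); zp 8 2 0 (-1) (-3); zp 8 3 2 3 (-4); zp 9 1 (-1) 1 2; zp 10 (-2) 0 1 0; zp 10 0
   (-1) 0 (-1); zp 10 2 3 2 (-3); zp 10 3 1 0 (-2); zp 11 3 (-1) 0 (-1) ].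

(* The trees below were found by backtracking; the last list joins odd tiles with
   neighbouring clusters, in an order such that each entry only uses earlier ones. *)
Definition refutations : list (nat * zpl * tree) :=
  [ (1%nat, zp 0 (-3) (-1) 0 1, Nd 0 13 []); (1%nat, zp 0 (-2) (-2) (-1) 1, Nd 0 12 [Nd 1 3 []]);
   (0%nat, zp 1 0 0 3 0, Nd 0 3 []); (1%nat, zp 1 0 0 3 0, Nd 0 3 []); (0%nat, zp 1 1 (-2) (-1)
   (-2), Nd 0 8 []); (1%nat, zp 1 1 (-2) (-1) (-2), Nd 0 8 []); (0%nat, zp 1 2 (-2) (-1) (-2),
   Nd 0 7 []); (1%nat, zp 1 2 (-2) (-1) (-2), Nd 0 7 []); (0%nat, zp 1 2 1 1 (-2), Nd 0 3 []);
   (1%nat, zp 1 2 1 1 (-2), Nd 0 6 []); (0%nat, zp 1 3 0 0 (-2), Nd 0 4 []); (1%nat, zp 1 3 0 0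
   (-2), Nd 0 5 []); (1%nat, zp 2 3 (-3) (-4) 0, Nd 0 10 []); (1%nat, zp 2 3 1 (-1) (-2), Nd 0 6
   []); (1%nat, zp 2 4 0 (-2) (-2), Nd 0 7 []); (0%nat, zp 3 (-2) (-1) 1 (-1), Nd 0 0 []);
   (0%nat, zp 3 (-1) (-1) (-1) (-4), Nd 1 7 []); (1%nat, zp 3 (-1) (-1) (-1) (-4), Nd 1 7 []);
   (1%nat, zp 3 1 1 1 (-2), Nd 1 3 [Nd 1 8 [Nd 1 10 [Nd 2 3 [Nd 5 7 [Nd 0 7 [Nd 7 3 []; Nd 0 6
   []; Nd 0 6 []; Nd 0 9 [Nd 0 10 []; Nd 0 11 []; Nd 0 10 []]]]]]]]); (0%nat, zp 3 2 1 (-1)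
   (-5), Nd 0 7 []); (1%nat, zp 3 2 1 (-1) (-5), Nd 0 7 []); (1%nat, zp 4 1 (-2) 0 1, Nd 0 0
   []); (1%nat, zp 4 1 (-1) 1 0, Nd 0 0 []); (1%nat, zp 4 2 (-3) (-3) 0, Nd 0 10 []); (0%nat, zp
   5 (-1) 0 (-1) (-1), Nd 0 0 []); (1%nat, zp 5 (-1) 0 (-1) (-1), Nd 0 12 []); (0%nat, zp 5 0 0
   (-1) 0, Nd 0 1 []); (1%nat, zp 5 0 0 (-1) 0, Nd 0 1 []); (0%nat, zp 5 1 0 0 0, Nd 0 0 []);
   (1%nat, zp 5 1 0 0 0, Nd 0 0 []); (0%nat, zp 5 1 1 1 (-1), Nd 0 0 []); (1%nat, zp 5 1 1 1
   (-1), Nd 0 0 []); (0%nat, zp 5 2 2 (-3) (-4), Nd 0 7 []); (1%nat, zp 5 2 2 (-3) (-4), Nd 0 7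
   []); (0%nat, zp 5 3 2 (-3) (-4), Nd 0 7 []); (1%nat, zp 5 3 2 (-3) (-4), Nd 0 7 []); (0%nat,
   zp 5 3 3 0 (-3), Nd 0 3 []); (1%nat, zp 5 3 3 0 (-3), Nd 0 3 []); (1%nat, zp 6 0 (-1) 0 (-2),
   Nd 0 11 []); (1%nat, zp 6 0 0 0 (-1), Nd 0 0 []); (1%nat, zp 6 1 (-2) (-1) (-2), Nd 0 12 [Nd
   1 10 []; Nd 1 10 []]); (1%nat, zp 6 1 0 0 0, Nd 0 1 []); (1%nat, zp 6 2 0 1 0, Nd 0 0 []);
   (1%nat, zp 6 2 1 2 (-1), Nd 0 3 []); (1%nat, zp 6 3 (-2) (-2) (-2), Nd 0 9 []); (1%nat, zp 6
   5 (-2) (-2) (-2), Nd 0 8 []); (1%nat, zp 6 5 2 1 (-4), Nd 0 4 [Nd 1 6 []; Nd 1 6 []]);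
   (1%nat, zp 6 6 1 0 (-4), Nd 1 5 [Nd 0 7 []; Nd 0 7 []]) ].

Definition cluster_tree : tree :=
  Nd 0 8 [Nd 0 3 [Nd 0 0 [Nd 0 10 [Nd 3 5 [Nd 1 2 [Nd 1 9 [Nd 2 9 [Lf]]]]]]]].

Definition near_tree : tree :=
  Nd 0 3 [Nd 0 2 [Nd 0 13 [Nd 2 6 [Lf]; Nd 0 10 [Nd 0 9 [Lf]]]; Nd 0 13 [Nd 0 6 [Lf; Nd 0 9 [Nd 5
   12 [Nd 4 0 [Nd 5 0 [Nd 2 4 [Nd 3 7 [Nd 1 7 [Nd 2 12 [Lf; Lf; Nd 3 13 []]; Nd 2 12 [Lf; Lf; Nd
   3 13 []]]; Nd 1 7 [Nd 2 12 [Lf; Lf; Nd 3 13 []]; Nd 2 12 [Lf; Lf; Nd 3 13 []]]]; Nd 3 7 [Nd 2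
   12 [Lf; Lf; Nd 3 13 []]; Nd 2 12 [Lf; Lf; Nd 3 13 []]]]]]]]]; Nd 0 10 [Nd 0 9 [Lf]]]]; Nd 0 2
   [Nd 0 13 [Nd 2 6 [Lf]; Nd 0 10 [Nd 0 9 [Lf]]]; Nd 2 4 [Nd 0 13 [Nd 0 5 [Nd 0 8 [Nd 0 10 [Nd 6
   10 [Nd 6 9 [Nd 5 7 [Nd 4 7 [Nd 2 12 [Lf; Lf; Nd 4 13 []]; Nd 2 12 [Lf; Lf; Nd 4 13 []]]; Nd 4
   7 [Nd 2 12 [Lf; Lf; Nd 4 13 []]; Nd 2 12 [Lf; Lf; Nd 4 13 []]]]]]]; Nd 0 9 [Nd 5 7 [Nd 4 7
   [Nd 2 12 [Lf; Lf; Nd 4 13 []]; Nd 2 12 [Lf; Lf; Nd 4 13 []]]; Nd 4 7 [Nd 2 12 [Lf; Lf; Nd 4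
   13 []]; Nd 2 12 [Lf; Lf; Nd 4 13 []]]]]]; Nd 0 6 [Nd 0 9 [Nd 7 12 [Nd 7 0 [Nd 4 7 [Nd 2 12
   [Lf; Lf; Nd 4 13 []]; Nd 2 12 [Lf; Lf; Nd 4 13 []]]]]]]]; Nd 0 10 [Nd 0 9 [Lf]]]]]; Nd 0 9
   [Nd 0 10 [Nd 0 6 [Nd 4 6 [Nd 0 0 [Lf; Lf; Nd 0 13 [Lf]]]; Nd 4 4 [Nd 2 8 [Nd 2 10 [Nd 1 8 [Nd
   0 0 [Lf; Lf; Nd 0 13 [Lf]]; Nd 0 0 [Lf; Lf; Nd 0 13 [Lf]]]]; Nd 2 9 [Nd 1 8 [Nd 0 0 [Lf; Lf;
   Nd 0 13 [Lf]]; Nd 0 0 [Lf; Lf; Nd 0 13 [Lf]]]]]; Nd 1 8 [Nd 2 9 [Nd 2 10 [Nd 0 0 [Lf; Lf; Nd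
   0 13 [Lf]]]; Nd 2 8 [Nd 0 0 [Lf; Lf; Nd 0 13 [Lf]]; Nd 0 0 [Lf; Lf; Nd 0 13 [Lf]]]]; Nd 2 9
   [Nd 2 10 [Nd 0 0 [Lf; Lf; Nd 0 13 [Lf]]]; Nd 2 8 [Nd 0 0 [Lf; Lf; Nd 0 13 [Lf]]; Nd 0 0 [Lf;
   Lf; Nd 0 13 [Lf]]]]]]]; Nd 2 10 [Nd 2 9 [Nd 2 5 [Nd 6 6 [Nd 0 11 [Nd 0 0 [Nd 9 12 [Lf]]; Nd 0
   0 [Nd 0 13 [Lf]]]]]]]]; Nd 0 8 [Nd 0 6 [Nd 4 6 [Nd 0 11 [Nd 0 0 [Nd 7 12 [Lf]]; Nd 0 0 [Nd 0
   13 [Lf]]]]; Nd 4 4 [Nd 0 11 [Nd 0 0 [Nd 7 12 [Lf]]; Nd 0 0 [Nd 0 13 [Lf]]]]]; Nd 0 5 [Nd 2 12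
   [Nd 4 12 [Nd 2 0 [Nd 0 11 [Nd 0 0 [Nd 9 12 [Lf]]; Nd 0 0 [Nd 0 13 [Lf]]]]]]]]; Lf]].

Definition links : list (zpl * tree) :=
  [ (zp 0 (-5) (-6) 4 3, Nd 17 10 [Nd 7 6 [Nd 18 13 [Nd 11 7 [Nd 7 9 [Nd 22 12 [Nd 11 10 [Nd 21 8
   [Nd 13 6 [Nd 13 9 [Nd 22 0 [Nd 19 5 [Nd 10 3 [Nd 20 11 [Nd 20 9 [Nd 32 6 [Nd 29 13 [Nd 27 12
   [Nd 22 2 [Nd 24 2 [Nd 32 9 [Nd 1 6 [Nd 27 0 [Nd 1 9 [Nd 38 12 [Nd 27 2 [Nd 27 5 [Nd 44 12 [Nd
   44 2 [Nd 16 6 [Nd 30 12 [Nd 29 7 []]]]]]]]]]]]]]]]]]]]]]]]]]]]]]]]); (zp 0 (-3) 1 (-3) (-8),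
   Nd 2 9 []); (zp 2 (-3) (-7) 0 (-1), Nd 4 9 []); (zp 2 (-2) (-9) 4 6, Nd 5 0 []); (zp 2 (-2)
   (-6) 1 3, Nd 12 6 [Nd 12 9 [Nd 7 6 [Nd 7 9 [Nd 18 12 [Nd 20 12 [Lf]]]]]]); (zp 2 0 1 (-6)
   (-8), Nd 4 7 [Nd 10 3 [Nd 18 13 [Nd 18 9 [Nd 18 10 []]]]; Nd 10 3 []]); (zp 2 4 (-2) 1 7, Nd
   6 5 []); (zp 2 5 6 (-7) (-6), Nd 2 3 []); (zp 2 8 5 (-4) 2, Nd 1 9 []); (zp 4 1 0 (-5) (-9),
   Nd 2 9 []); (zp 4 2 (-3) 2 3, Nd 1 3 []); (zp 4 7 7 (-8) (-8), Nd 2 3 []); (zp 4 10 6 (-5) 0,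
   Nd 1 9 []); (zp 6 2 2 (-4) (-10), Nd 13 7 [Nd 2 4 [Nd 18 13 [Nd 18 9 [Nd 18 10 []]]]; Nd 2 3
   []]); (zp 6 6 (-1) 3 5, Nd 1 3 []); (zp 6 7 7 (-5) (-8), Nd 2 3 []); (zp 6 10 6 (-2) 0, Nd 8
   7 [Nd 10 3 [Nd 18 13 [Nd 18 9 [Nd 18 10 []]]]; Nd 10 3 []]); (zp 2 (-3) (-8) 3 4, Nd 11 10
   [Nd 11 3 [Nd 13 7 [Nd 13 10 [Nd 18 13 [Nd 20 7 [Nd 20 10 [Nd 23 8 [Nd 22 11 [Nd 22 9 [Nd 27 6
   [Nd 24 2 [Nd 27 9 [Nd 30 12 [Nd 28 5 [Nd 2 3 [Nd 30 0 [Nd 7 7 [Nd 7 10 [Nd 19 13 [Nd 35 6 [Nd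
   35 10 [Nd 38 8 [Nd 37 11 [Nd 37 9 [Nd 42 6 [Nd 36 13 [Nd 1 7 [Nd 1 10 [Nd 42 9 [Nd 39 2 [Nd 8
   6 [Nd 43 9 [Nd 33 12 [Nd 32 7 []]]]]]]]]]]]]]]]]; Nd 7 9 [Nd 19 13 [Nd 37 7 [Nd 38 6 [Nd 38 9
   [Nd 37 10 [Nd 37 13 [Lf]]]]; Nd 38 4 [Nd 37 13 [Nd 35 12 [Lf]; Lf]]]]]]]]]]]]]]]]]]]]; Nd 13
   9 [Nd 18 13 [Nd 7 7 [Nd 7 10 [Nd 19 13 [Nd 23 6 [Nd 23 10 [Nd 26 8 [Nd 25 11 [Nd 25 9 [Nd 30
   6 [Nd 24 13 [Nd 1 7 [Nd 1 10 [Nd 30 9 [Nd 27 2 [Nd 8 6 [Nd 8 9 [Nd 31 9 [Nd 38 12 [Nd 38 0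
   [Nd 38 2 [Nd 2 6 [Nd 2 9 [Nd 22 9 [Nd 44 1 [Nd 44 12 [Nd 33 9 [Nd 31 5 [Nd 10 3 [Nd 22 13 [Nd
   20 13 [Lf]; Lf]]]]]]]]]]]]]]]]]]]]]]]]]]]]; Nd 7 9 [Nd 19 13 [Nd 22 7 [Nd 26 6 [Nd 26 9 [Nd
   22 10 [Nd 22 13 [Lf]]]]; Nd 22 9 [Nd 22 13 [Nd 20 13 [Lf]; Lf]]]]]]]]]]]); (zp 2 5 2 (-1) 2,
   Nd 15 6 [Nd 8 6 [Nd 8 9 [Nd 15 9 [Nd 19 12 [Nd 20 12 [Nd 19 0 [Nd 20 0 [Nd 17 5 [Nd 7 3 [Nd
   18 5 [Nd 19 2 [Nd 27 6 [Nd 25 13 [Nd 20 2 [Nd 21 2 [Nd 2 6 [Nd 2 9 [Nd 10 6 [Nd 10 9 [Nd 27 9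
   [Nd 34 12 [Nd 23 2 [Nd 29 9 [Lf]]]]]]]]]]]]]]]]]]]]]]]]); (zp 2 7 3 (-2) 3, Nd 1 3 [Nd 1 10
   [Nd 8 7 [Nd 8 10 [Nd 19 13 [Nd 20 7 [Lf]]]; Nd 8 9 [Nd 19 13 [Nd 16 7 [Nd 18 13 [Nd 16 10 [Nd
   23 6 [Nd 23 10 [Nd 26 8 [Nd 24 11 [Nd 24 9 [Nd 7 3 [Nd 25 13 [Nd 10 7 [Lf]]]]]]]]]]; Nd 23 4
   [Nd 18 13 [Nd 7 3 [Nd 7 6 []; Nd 25 7 [Nd 22 7 [Nd 28 6 [Nd 28 9 [Nd 22 10 [Nd 22 13 [Lf]]]];
   Nd 22 9 [Nd 21 4 [Nd 22 13 [Nd 20 13 [Lf]; Lf]; Nd 21 0 [Nd 20 1 [Lf]]]]]]]]]]]]]]]); (zp 4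
   (-1) (-7) 2 2, Nd 5 13 [Nd 7 6 [Nd 7 9 [Nd 20 12 [Lf]]]]); (zp 4 3 (-4) 3 5, Nd 14 13 [Nd 7 4
   [Nd 18 13 [Nd 1 6 [Lf]]]]) ].

Definition edges (odd : bool) : list zpl := if odd then edges_odd else edges_even.

(* Approximate coordinates of the distance between the centres; far tiles are not
   worth testing. *)
Definition far (r : zpl) : bool :=
  let '(a0, a1, a2, a3) := zsub (zadd (zmul (zt (fst r)) (3, 6, -1,
    -6)%Z) (zscale 4 (snd r))) (3, 6, -1, -6)%Z in
  let x := Z.abs (2000 * a0 + 1732 * a1 + 1000 * a2) in
  let y := Z.abs (1000 * a1 + 1732 * a2 + 2000 * a3) in
  if (x <? 48000)%Z then negb (y <? 48000)%Z else true.

Definition conflict1 (s n : zpl) : bool :=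
  let r := zrel s n in
  if zpl_eqb s n then false else
  if far r then false else
  if overlapb r then true else
  if Nat.even (fst s) then if Nat.even (fst n) then sharesb r else false else false.

Lemma conflict1_sound X : good X -> forall s n, X s -> X n -> conflict1 s n = true -> False.
Proof.
  intros HX s n Hs Hn H. unfold conflict1 in H.
  destruct (zpl_eqb s n) eqn:E; [easy|].
  assert (Hne : s <> n) by (intros Hsn; apply zpl_eqb_eq in Hsn; congruence).
  destruct (far (zrel s n)); [easy|].
  destruct (overlapb (zrel s n)) eqn:Eo; [now apply Hne, (good_disjoint X HX)|].
  destruct (Nat.even (fst s)) eqn:E1; [|easy]. destruct (Nat.even (fst n)) eqn:E2; [|easy].
  now apply Hne, (good_odd X HX).
Qed.

Definition refuted (k : nat) (r : zpl) : bool :=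
  anyb (fun x => let '(k', r', _) := x in if (k =? k')%nat then zpl_eqb r r' else false)
    refutations.
Definition root (k : nat) : zpl := (k, zzero).

Definition all_cands (x : zpl) (i : nat) : list zpl := nth i nbrs [].
Lemma all_cands_sound X : good X -> forall x i, X x -> (i < 14)%nat ->
  exists r, In r (all_cands x i) /\ X (zcomp x r).
Proof.
  intros HX x i Hx Hi. destruct (good_nbr X HX x i Hx Hi) as (j & Hj & H).
  exists (nbr0 i j). split; [|easy]. unfold all_cands. rewrite nth_nbrs by easy.
  apply in_map, in_seq. lia.
Qed.

Lemma refutations_check :
  allb (fun x => let '(k, r, tr) := x in
    ((k <? 2) && (fst r <? 12))%nat &&
    check all_cands conflict1 (fun _ => false) tr [root k; zcomp (root k) r]) refutations = true.
Proof. vm_compute. reflexivity. Qed.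

Definition parity (x : zpl) : nat := if Nat.even (fst x) then 0%nat else 1%nat.

(** Only changes of origin with an even rotation preserve the parity that marks odd tiles. Hence an
    odd tile is brought to [root 0] and an even tile to [root 1]. *)
Lemma rebase X x : good X -> X x -> exists g, good (translated g X) /\ (fst g < 12)%nat /\
  Nat.even (fst g) = true /\ x = zcomp g (root (parity x)).
Proof.
  intros HX Hx. assert (Hl := good_lt X HX x Hx).
  set (k := parity x). assert (Hk : (k < 12)%nat) by (unfold k, parity;
    destruct (Nat.even (fst x)); lia).
  exists (zcomp x (zinv (root k))).
  assert (E : Nat.even (fst (zcomp x (zinv (root k)))) = true).
  { rewrite even_zcomp, even_zinv by easy. unfold root, k, parity. cbn [fst].
    now destruct (Nat.even (fst x)). }
  split; [now apply good_translated; [apply zcomp_lt| |]|]. split; [apply zcomp_lt|].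
  split; [easy|].
  rewrite <- zcomp_assoc, zcomp_inv_l, zcomp_id_r; auto using zinv_lt.
Qed.

Lemma refuted_false X x r : good X -> X x -> X (zcomp x r) -> refuted (parity x) r = true ->
  False.
Proof.
  intros HX Hx Hr H. unfold refuted in H. apply anyb_exists in H.
  destruct H as ([[k r'] tr] & Hin & H). destruct (parity x =? k)%nat eqn:Ek; [|easy].
  apply Nat.eqb_eq in Ek. apply zpl_eqb_eq in H. subst k r'.
  pose proof refutations_check as C. rewrite allb_forall in C. specialize (C _ Hin).
  cbv beta iota in C.
  rewrite !andb_true_iff, !Nat.ltb_lt in C. destruct C as [[Hk Hrl] C].
  destruct (rebase X x HX Hx) as (g & Hg & Hgl & Hge & E).
  assert (Hkl : (fst (root (parity x)) < 12)%nat) by (unfold root; cbn [fst]; lia).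
  destruct (check_sound _ _ _ _ (all_cands_sound _ Hg) (conflict1_sound _ Hg) _ _ C) as (p' & _ &
    F); [|easy].
  intros z [<-|[<-|[]]]; split; auto using zcomp_lt.
  - now rewrite <- E.
  - rewrite zcomp_assoc by easy. now rewrite <- E.
Qed.

(** A gluing outside the lists is excluded by an overlap, by two odd tiles sharing a side, or by a
    refutation read from either of the two tiles; read from the second one, it involves the inverse
    placement and the parity of that tile. *)
Lemma edges_check :
  allb (fun i => allb (fun j => allb (fun k =>
    let r := nbr0 i j in
    if mem r (edges (k =? 0)%nat) then true else
    if overlapb r then negb (zpl_eqb r zid) else
    if ((k =? 0) && Nat.even (fst r))%nat then negb (zpl_eqb r zid) else
    if refuted k r then true else
    refuted (if Nat.even (fst r) then k else 1 - k) (zinv r)) [0;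
      1]%nat) (seq 0 14)) (seq 0 14) = true.
Proof. vm_compute. reflexivity. Qed.

Lemma proper_ne x r : (fst x < 12)%nat -> (fst r < 12)%nat -> zpl_eqb r zid = false -> x <> zcomp
  x r.
Proof.
  intros Hx Hr Hp E.
  assert (E2 : zcomp x zid = zcomp x r) by now rewrite zcomp_id_r.
  apply zcomp_inj in E2; try easy; [|simpl; lia]. subst r. discriminate.
Qed.

Lemma good_edges X x i j : good X -> X x -> (i < 14)%nat -> (j < 14)%nat ->
  X (zcomp x (nbr0 i j)) -> In (nbr0 i j) (edges (Nat.even (fst x))).
Proof.
  intros HX Hx Hi Hj Hn. assert (Hl := good_lt X HX x Hx).
  pose proof edges_check as C.
  rewrite allb_forall in C. specialize (C i ltac:(apply in_seq; lia)).
  rewrite allb_forall in C. specialize (C j ltac:(apply in_seq; lia)).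
  rewrite allb_forall in C. specialize (C (parity x)). cbv zeta in C.
  set (r := nbr0 i j) in *. assert (Hrl : (fst r < 12)%nat) by apply nbr0_lt.
  assert (Hp : (parity x =? 0)%nat = Nat.even (fst x)) by (unfold parity;
    now destruct (Nat.even (fst x))).
  rewrite Hp in C.
  specialize (C ltac:(unfold parity; destruct (Nat.even (fst x)); simpl; tauto)).
  destruct (mem r (edges (Nat.even (fst x)))) eqn:E1; [now apply mem_In|]. exfalso.
  destruct (overlapb r) eqn:E2.
  { apply negb_true_iff in C. apply (proper_ne x r Hl Hrl C). apply (good_disjoint X HX); auto.
    now rewrite zrel_zcomp. }
  destruct (Nat.even (fst x) && Nat.even (fst r)) eqn:E3.
  { apply negb_true_iff in C. apply (proper_ne x r Hl Hrl C).
    apply andb_true_iff in E3. destruct E3 as [E3 E4].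
    apply (good_odd X HX); auto; [now rewrite even_zcomp, E3, E4|].
    rewrite zrel_zcomp by easy. apply sharesb_spec.
    exists i, j. split; [exact Hi|]. split; [exact Hj|reflexivity]. }
  destruct (refuted (parity x) r) eqn:E4; [now apply (refuted_false X x r)|].
  apply (refuted_false X (zcomp x r) (zinv r)); auto.
  - rewrite <- zcomp_assoc, zcomp_inv_r, zcomp_id_r; easy.
  - replace (parity (zcomp x r)) with (if Nat.even (fst r) then parity x else (1 - parity
      x)%nat); [easy|].
    unfold parity. rewrite even_zcomp. now destruct (Nat.even (fst x)), (Nat.even (fst r)).
Qed.

Definition edge_table : list (list (list zpl)) :=
  Eval vm_compute in map (fun odd => map (filter (fun r => mem r (edges odd))) nbrs) [true;
    false].
Definition edge_cands (x : zpl) (i : nat) : list zpl :=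
  nth i (nth (parity x) edge_table []) [].
Lemma edge_table_eq :
  edge_table = map (fun odd => map (filter (fun r => mem r (edges odd))) nbrs) [true; false].
Proof. vm_compute. reflexivity. Qed.
Lemma edge_cands_sound X : good X -> forall x i, X x -> (i < 14)%nat ->
  exists r, In r (edge_cands x i) /\ X (zcomp x r).
Proof.
  intros HX x i Hx Hi. destruct (good_nbr X HX x i Hx Hi) as (j & Hj & H).
  exists (nbr0 i j). split; [|easy]. unfold edge_cands.
  assert (E : nth (parity x) edge_table [] = map (filter (fun r => mem r (edges (Nat.even (fst
    x))))) nbrs).
  { rewrite edge_table_eq. unfold parity. now destruct (Nat.even (fst x)). }
  rewrite E, (nth_indep _ [] (filter (fun r => mem r (edges (Nat.even (fst x)))) []))
    by (rewrite length_map; change (length nbrs) with 14%nat; easy).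
  rewrite map_nth, nth_nbrs by easy. apply filter_In. split.
  - apply in_map, in_seq. lia.
  - apply mem_In. now apply (good_edges X).
Qed.

(** For tiles that share a side, the established lists [edges] replace the tests of [conflict1], so
    the refuted gluings are excluded too. *)
Definition conflict2 (s n : zpl) : bool :=
  let r := zrel s n in
  if zpl_eqb s n then false else
  if far r then false else
  if sharesb r then negb (mem r (edges (Nat.even (fst s)))) else overlapb r.

Lemma conflict2_sound X : good X -> forall s n, X s -> X n -> conflict2 s n = true -> False.
Proof.
  intros HX s n Hs Hn H. unfold conflict2 in H.
  destruct (zpl_eqb s n) eqn:E; [easy|].
  assert (Hne : s <> n) by (intros Hsn; apply zpl_eqb_eq in Hsn; congruence).
  destruct (far (zrel s n)); [easy|].
  destruct (sharesb (zrel s n)) eqn:Es; [|now apply Hne, (good_disjoint X HX)].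
  apply sharesb_spec in Es.
  destruct Es as (i & j & Hi & Hj & Er).
  apply negb_true_iff in H. rewrite <- not_true_iff_false, mem_In in H. apply H. rewrite Er.
  apply (good_edges X); auto. rewrite <- Er, zcomp_zrel; auto; now apply (good_lt X HX).
Qed.

Lemma cluster_check :
  check edge_cands conflict2 (fun p => allb (fun c => mem c p) cluster) cluster_tree [zid] = true.
Proof. vm_compute. reflexivity. Qed.

(** If [root 1] is member c of the cluster of an odd tile, that tile is [root 1] composed with the
    inverse of c. *)
Definition near_goal (p : list zpl) : bool :=
  anyb (fun c => if Nat.even (fst (zcomp (root 1) (zinv c))) then mem (zcomp (root 1) (zinv c)) p
    else false) cluster.
Lemma near_check : check edge_cands conflict2 near_goal near_tree [root 1] = true.
Proof. vm_compute. reflexivity. Qed.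

Lemma cluster_lt c : In c cluster -> (fst c < 12)%nat.
Proof.
  intros H. assert (C : forallb (fun c => fst c <? 12)%nat cluster = true) by reflexivity.
  rewrite forallb_forall in C. now apply Nat.ltb_lt, C.
Qed.

Lemma good_cluster X y c : good X -> X y -> Nat.even (fst y) = true -> In c cluster -> X (zcomp y
  c).
Proof.
  intros HX Hy Ey Hc. assert (Hl := good_lt X HX y Hy).
  pose proof (good_translated y X Hl Ey HX) as Hg.
  destruct (check_sound _ _ _ _ (edge_cands_sound _ Hg) (conflict2_sound _ Hg) _ _ cluster_check)
    as (p & Hp & G).
  - intros x [<-|[]]. split; [simpl; lia|]. now rewrite zcomp_id_r.
  - rewrite allb_forall in G. specialize (G c Hc). apply mem_In in G. now apply Hp.
Qed.

Lemma good_near X x : good X -> X x -> exists y c, X y /\ Nat.even (fst y) = true /\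
  In c cluster /\ x = zcomp y c.
Proof.
  intros HX Hx. assert (Hl := good_lt X HX x Hx). destruct (Nat.even (fst x)) eqn:E.
  { exists x, zid. repeat split; auto; [now left|now rewrite zcomp_id_r]. }
  destruct (rebase X x HX Hx) as (g & Hg & Hgl & Hge & Ex).
  assert (Ep : parity x = 1%nat) by (unfold parity; now rewrite E).
  rewrite Ep in Ex.
  destruct (check_sound _ _ _ _ (edge_cands_sound _ Hg) (conflict2_sound _ Hg) _ _ near_check) as
    (p & Hp & G).
  - intros z [<-|[]]. split; [simpl; lia|]. now rewrite <- Ex.
  - unfold near_goal in G. apply anyb_exists in G. destruct G as (c & Hc & G).
    set (y := zcomp (root 1) (zinv c)) in *. destruct (Nat.even (fst y)) eqn:Ey; [|easy].
    apply mem_In in G. destruct (Hp y G) as [Hy1 Hy2].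
    exists (zcomp g y), c. repeat split; auto.
    + now rewrite even_zcomp, Hge, Ey.
    + pose proof (cluster_lt c Hc). rewrite <- zcomp_assoc by easy. unfold y.
      rewrite <- (zcomp_assoc (root 1)), zcomp_inv_l, zcomp_id_r; auto using zinv_lt; simpl; lia.
Qed.

(* Twice the components of [a] on the lattices of yellow and blue decoration edges,
   spanned by the [zeta (2 k) * alpha] and the [zeta (2 k + 1) * alpha]. *)
Definition alpha : zz := zadd (zeta 2) (zeta 11).
(** This is 2 a / alpha: the multiplier zeta^10 + zeta is the conjugate of alpha, and alpha times
    its conjugate is 2. The even and odd powers of zeta in the quotient give the two components. *)
Definition twice_quot (a : zz) : zz := zadd (zmul (zeta 10) a) (zmul (zeta 1) a).
Definition ypart (a : zz) : zz :=
  let '(e0, _, e2, _) := twice_quot a in zmul alpha (e0, 0, e2, 0)%Z.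
Definition bpart (a : zz) : zz :=
  let '(_, e1, _, e3) := twice_quot a in zmul alpha (0, e1, 0, e3)%Z.

(** For consecutive vertices A, B, C of a regular hexagon the centre is A + C - B. *)
Definition hex_center (x : zpl) : zz :=
  zadd (zmul (zt (fst x)) (zsub (zadd (pt 1) (pt 5)) (pt 3))) (snd x).
Definition znorm (a : zz) : zz := zmul a (zconj a).
Definition sqrt3 (a : zz) : zz := zmul (zadd (zeta 1) (zeta 11)) a.

(* The displacement of hex centres is that of a V-type, respectively I-type, interface. *)
Definition V_stepb (d : zz) : bool :=
  zz_eqb (bpart d) (zscale 3 (zmul (zeta 11) (ypart d))) &&
  zz_eqb (znorm (ypart d)) (24, 0, 0, 0)%Z.
(** With u = zeta^11 [ypart d], the target is 3 u + zeta^5 u / sqrt 3; multiplying by sqrt 3 clears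
    the denominator, and zeta^5 zeta^11 = zeta^4. By [setup_scale], the norms 24 and 152 are the
    squared lengths 1 and 19/3 multiplied by 24. *)
Definition I_stepb (d : zz) : bool :=
  zz_eqb (sqrt3 (bpart d))
    (zadd (sqrt3 (zscale 3 (zmul (zeta 11) (ypart d)))) (zmul (zeta 4) (ypart d))) &&
  zz_eqb (znorm (ypart d)) (24, 0, 0, 0)%Z && zz_eqb (znorm (bpart d)) (152, 0, 0, 0)%Z.
Definition stepb (r : zpl) : bool :=
  let d := zsub (hex_center r) (hex_center zid) in V_stepb d || I_stepb d.

(** * Chains of interface steps *)

Definition step (X : zpl -> Prop) (x y : zpl) : Prop :=
  X x /\ X y /\ Nat.even (fst x) = true /\ Nat.even (fst y) = true /\ stepb (zrel x y) = true.
Definition linked (X : zpl -> Prop) : zpl -> zpl -> Prop := clos_refl_sym_trans zpl (step X).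

(** [done] holds relative placements already known to be linked, which may be used in both
    directions. *)
Definition link (done : list zpl) (x y : zpl) : bool :=
  if stepb (zrel x y) then true else if mem (zrel x y) done then true else mem (zrel y x) done.
Fixpoint reach (n : nat) (done odds seen : list zpl) : list zpl :=
  match n with
  | O => seen
  | S m => reach m done odds
      (filter (fun t => if mem t seen then false else anyb (fun s => link done s t) seen) odds ++
        seen)
  end.
Definition link_goal (done : list zpl) (r : zpl) (p : list zpl) : bool :=
  mem r (reach 5 done (filter (fun t => Nat.even (fst t)) p) [zid]).
(** Both clusters are present by [good_cluster]. Their common tiles are listed once, which fixes the
    indices used in the trees. *)
Definition link_root (r : zpl) : list zpl :=
  cluster ++ filter (fun x => negb (mem x cluster)) (map (zcomp r) cluster).
Fixpoint links_check (done : list zpl) (l : list (zpl * tree)) : bool :=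
  match l with
  | [] => true
  | (r, tr) :: l =>
    if ((fst r <? 12)%nat && Nat.even (fst r) && check edge_cands conflict2 (link_goal done r) tr
      (link_root r))%bool
    then links_check (r :: done) l else false
  end.
Lemma links_check_true : links_check [] links = true.
Proof. vm_compute. reflexivity. Qed.

(* Keeps conversion from computing with these on symbolic arguments. *)
Strategy 100 [stepb mem sharesb overlapb zrel zcomp zinv zpl_eqb conflict2].

Definition linkable (r : zpl) : Prop := (fst r < 12)%nat /\ Nat.even (fst r) = true /\
  forall X, good X -> X zid -> X r -> linked X zid r.

Lemma linked_translated g X x y : (fst g < 12)%nat -> Nat.even (fst g) = true ->
  linked (translated g X) x y -> linked X (zcomp g x) (zcomp g y).
Proof.
  intros Hg Eg. induction 1 as [x y H|x|x y _ IH|x y z _ IH1 _ IH2].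
  - destruct H as ((Hx & Hx') & (Hy & Hy') & Ex & Ey & H). apply rst_step.
    repeat split; auto; [now rewrite even_zcomp, Eg, Ex|now rewrite even_zcomp, Eg, Ey|].
    now rewrite zrel_zcomp_zcomp.
  - apply rst_refl.
  - now apply rst_sym.
  - now apply rst_trans with (zcomp g y).
Qed.

Lemma linkable_linked X x y : good X -> X x -> X y -> Nat.even (fst x) = true ->
  linkable (zrel x y) -> linked X x y.
Proof.
  intros HX Hx Hy Ex (Hr & Er & H). assert (Hxl := good_lt X HX x Hx).
  assert (Hyl := good_lt X HX y Hy).
  rewrite <- (zcomp_id_r x) by easy. rewrite <- (zcomp_zrel x y) by easy.
  replace (zrel (zcomp x zid) y) with (zrel x y) by now rewrite zcomp_id_r.
  apply linked_translated; auto. apply H.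
  - now apply good_translated.
  - split; [simpl; lia|]. now rewrite zcomp_id_r.
  - split; [easy|]. now rewrite zcomp_zrel.
Qed.

Lemma link_linked X done x y : good X -> (forall r, In r done -> linkable r) ->
  X x -> X y -> Nat.even (fst x) = true -> Nat.even (fst y) = true ->
  link done x y = true -> linked X x y.
Proof.
  intros HX Hd Hx Hy Ex Ey H. unfold link in H. destruct (stepb (zrel x y)) eqn:E1.
  { apply rst_step. repeat split; auto. }
  destruct (mem (zrel x y) done) eqn:E2.
  { apply linkable_linked; [exact HX|exact Hx|exact Hy|exact Ex|]. now apply Hd, mem_In. }
  apply rst_sym. apply linkable_linked; [exact HX|exact Hy|exact Hx|exact Ey|].
  apply Hd, mem_In. exact H.
Qed.

Lemma reach_linked X done odds : good X -> (forall r, In r done -> linkable r) ->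
  (forall t, In t odds -> X t /\ Nat.even (fst t) = true) ->
  forall n seen, (forall t, In t seen -> X t /\ Nat.even (fst t) = true /\ linked X zid t) ->
  forall t, In t (reach n done odds seen) -> linked X zid t.
Proof.
  intros HX Hd Ho. induction n; intros seen Hs t Ht.
  - now apply Hs.
  - apply (IHn _) in Ht; [easy|]. intros u Hu. apply in_app_or in Hu.
    destruct Hu as [Hu|Hu]; [|now apply Hs].
    apply filter_In in Hu. destruct Hu as [Hu H]. destruct (Ho u Hu) as [Xu Eu].
    split; [easy|]. split; [easy|]. destruct (mem u seen); [easy|].
    apply anyb_exists in H. destruct H as (s & Hs' & H). destruct (Hs s Hs') as (Xs & Es & L).
    apply rst_trans with s; [easy|]. now apply (link_linked X done).
Qed.

Lemma links_sound l : forall done, links_check done l = true ->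
  (forall r, In r done -> linkable r) -> forall r tr, In (r, tr) l -> linkable r.
Proof.
  induction l as [|[r0 tr0] l IH]; intros done H Hd r tr Hin; [easy|].
  cbn [links_check] in H. destruct (_ && _) eqn:E in H; [|easy].
  rewrite !andb_true_iff, Nat.ltb_lt in E. destruct E as [[Hr Er] E].
  assert (H0 : linkable r0).
  { split; [easy|]. split; [easy|]. intros X HX Xid Xr.
    destruct (check_sound X _ _ _ (edge_cands_sound _ HX) (conflict2_sound _ HX) _ _ E) as (p &
      Hp & G).
    - intros x Hx. apply in_app_or in Hx. destruct Hx as [Hx|Hx].
      + rewrite <- (zcomp_id_l x) by (now apply cluster_lt). now apply good_cluster.
      + apply filter_In in Hx. destruct Hx as [Hx _]. apply in_map_iff in Hx.
        destruct Hx as (c & <- & Hc). now apply good_cluster.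
    - apply mem_In in G. revert G. apply (reach_linked X done).
      + easy.
      + easy.
      + intros t Ht. apply filter_In in Ht. destruct Ht as [Ht Et]. split; [now apply Hp|easy].
      + intros t [<-|[]]. split; [easy|]. split; [easy|]. apply rst_refl. }
  destruct Hin as [Hin|Hin].
  - injection Hin as <- <-. easy.
  - apply (IH (r0 :: done) H) with tr; [|easy]. intros r' [<-|Hr']; auto.
Qed.

(** The relative placement r of two odd tiles is recovered from members c1, c2 of their clusters
    glued by e. Either the odd tiles coincide, or a step or an entry of [links] joins them, or the
    two clusters conflict and r does not occur. *)
Lemma pair_check :
  allb (fun c1 => allb (fun c2 => allb (fun e =>
    let r := zcomp (zcomp c1 e) (zinv c2) in
    if Nat.even (fst r) then
      if zpl_eqb r zid then true else
      if stepb r then true else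
      if mem r (map fst links) then true else
      if mem (zinv r) (map fst links) then true else
      anyb (fun s => anyb (fun c => conflict2 s (zcomp r c)) cluster) cluster
    else true) (edges (Nat.even (fst c1)))) cluster) cluster = true.
Proof. vm_compute. reflexivity. Qed.

Lemma links_linkable r : In r (map fst links) -> linkable r.
Proof.
  intros H. apply in_map_iff in H. destruct H as ([r' tr] & <- & H).
  apply (links_sound links [] links_check_true) with tr; easy.
Qed.

Lemma edges_lt odd e : In e (edges odd) -> (fst e < 12)%nat.
Proof.
  intros H. assert (C : forallb (fun odd => forallb (fun e => fst e <? 12)%nat (edges odd))
    [true; false] = true)
    by reflexivity.
  rewrite forallb_forall in C. specialize (C odd). rewrite forallb_forall in C.
  apply Nat.ltb_lt, C; [|easy]. destruct odd; simpl; tauto.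
Qed.

Lemma good_pair X y y' c c' e : good X -> X y -> X y' -> Nat.even (fst y) = true ->
  Nat.even (fst y') = true -> In c cluster -> In c' cluster -> In e (edges (Nat.even (fst c))) ->
  zcomp y' c' = zcomp (zcomp y c) e -> linked X y y'.
Proof.
  intros HX Hy Hy' Ey Ey' Hc Hc' He E.
  assert (Hyl := good_lt X HX y Hy). assert (Hyl' := good_lt X HX y' Hy').
  assert (Hcl := cluster_lt c Hc). assert (Hcl' := cluster_lt c' Hc').
  assert (Hel := edges_lt _ e He).
  set (r := zcomp (zcomp c e) (zinv c')).
  assert (Er : zcomp y r = y').
  { unfold r. rewrite zcomp_assoc, (zcomp_assoc y), <- E by (auto using zcomp_lt).
    rewrite <- zcomp_assoc, zcomp_inv_r, zcomp_id_r; easy. }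
  assert (Hrl : (fst r < 12)%nat) by apply zcomp_lt.
  assert (Rr : zrel y y' = r) by (rewrite <- Er; now apply zrel_zcomp).
  assert (Evr : Nat.even (fst r) = true).
  { assert (B := even_zcomp y r). rewrite Er, Ey, Ey' in B. now destruct (Nat.even (fst r)). }
  pose proof pair_check as C. rewrite allb_forall in C. specialize (C c Hc).
  rewrite allb_forall in C. specialize (C c' Hc'). rewrite allb_forall in C. specialize (C e He).
  cbv zeta in C. fold r in C. rewrite Evr in C.
  destruct (zpl_eqb r zid) eqn:E1.
  { apply zpl_eqb_eq in E1. rewrite <- Er, E1, zcomp_id_r by easy. apply rst_refl. }
  destruct (stepb r) eqn:E2.
  { apply rst_step. repeat split; auto. now rewrite Rr. }
  destruct (mem r (map fst links)) eqn:E3.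
  { apply linkable_linked; [exact HX|exact Hy|exact Hy'|exact Ey|].
    rewrite Rr. now apply links_linkable, mem_In. }
  destruct (mem (zinv r) (map fst links)) eqn:E4.
  { apply rst_sym, linkable_linked; [exact HX|exact Hy'|exact Hy|exact Ey'|].
    replace (zrel y' y) with (zinv r).
    - now apply links_linkable, mem_In.
    - apply (zcomp_inj y'); auto using zinv_lt; [unfold zrel; apply zcomp_lt|].
      rewrite zcomp_zrel by easy. rewrite <- Er, <- zcomp_assoc, zcomp_inv_r, zcomp_id_r; easy. }
  exfalso. apply anyb_exists in C. destruct C as (s & Hs & C). apply anyb_exists in C.
  destruct C as (s' & Hs' & C).
  apply (conflict2_sound (translated y X) (good_translated y X Hyl Ey HX) s (zcomp r s'));
    [| |easy].
  - split; [now apply cluster_lt|]. now apply good_cluster.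
  - split; [apply zcomp_lt|]. rewrite zcomp_assoc, Er by easy. now apply good_cluster.
Qed.

(** The invariant that is carried from neighbour to neighbour over the whole tiling. *)
Definition near (X : zpl -> Prop) (x : zpl) : Prop :=
  exists y c, X y /\ Nat.even (fst y) = true /\ linked X zid y /\ In c cluster /\ x = zcomp y c.

Lemma near_zid X : good X -> X zid -> near X zid.
Proof.
  intros HX H. exists zid, zid. repeat split; auto; [apply rst_refl|now left].
Qed.

Lemma even_cluster c : In c cluster -> Nat.even (fst c) = true -> c = zid.
Proof.
  intros Hc E. assert (C : forallb (fun c => negb (Nat.even (fst c)) || zpl_eqb c zid) cluster =
    true) by reflexivity.
  rewrite forallb_forall in C. specialize (C c Hc). rewrite E in C. now apply zpl_eqb_eq in C.
Qed.

Lemma near_nbr X x i j : good X -> X x -> near X x -> (i < 14)%nat -> (j < 14)%nat ->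
  X (zcomp x (nbr0 i j)) -> near X (zcomp x (nbr0 i j)).
Proof.
  intros HX Hx (y & c & Hy & Ey & L & Hc & E) Hi Hj Hn.
  destruct (good_near X _ HX Hn) as (y' & c' & Hy' & Ey' & Hc' & E').
  exists y', c'. repeat split; auto. apply rst_trans with y; [easy|].
  apply (good_pair X y y' c c' (nbr0 i j)); auto.
  - replace (Nat.even (fst c)) with (Nat.even (fst x)); [now apply (good_edges X)|].
    rewrite E, even_zcomp, Ey. now destruct (Nat.even (fst c)).
  - now rewrite <- E', <- E.
Qed.

Lemma near_odd X x : good X -> near X x -> Nat.even (fst x) = true -> linked X zid x.
Proof.
  intros HX (y & c & Hy & Ey & L & Hc & E) Ex.
  assert (Ec : Nat.even (fst c) = true).
  { rewrite E, even_zcomp, Ey in Ex. now destruct (Nat.even (fst c)). }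
  apply even_cluster in Ec; [|easy]. rewrite E, Ec, zcomp_id_r by (now apply (good_lt X)). easy.
Qed.

(* Not both classes can avoid sharing sides: two even tiles of a cluster do. *)
Lemma even_tiles_share X : good X -> X zid -> exists x x' i j, X x /\ X x' /\
  Nat.even (fst x) = false /\ Nat.even (fst x') = false /\ (i < 14)%nat /\ (j < 14)%nat /\
  x' = zcomp x (nbr0 i j) /\ x <> x'.
Proof.
  intros HX H. set (x := zp 3 3 2 0 (-1)). set (x' := zp 3 1 1 1 (-2)).
  assert (S : sharesb (zrel x x') = true) by reflexivity.
  apply sharesb_spec in S. destruct S as (i & j & Hi & Hj & E).
  exists x, x', i, j. repeat split; auto; try discriminate.
  - rewrite <- (zcomp_id_l x) by (simpl; lia). apply good_cluster; auto. simpl; tauto.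
  - rewrite <- (zcomp_id_l x') by (simpl; lia). apply good_cluster; auto. simpl; tauto.
  - rewrite <- E, zcomp_zrel; simpl; lia || easy.
Qed.

(** * The decoration *)

(** Infinite descent: 3 divides a, then b. *)
Lemma square_eq_3_square (a b : Z) : (a * a = 3 * (b * b))%Z -> b = 0%Z.
Proof.
  assert (H : forall n a b, (Z.abs_nat b < n)%nat -> (a * a = 3 * (b * b))%Z -> b = 0%Z).
  { clear a b. induction n as [|n IH]; intros a b Hn E; [lia|].
    assert (D : forall x y : Z, (x * x = 3 * y)%Z -> exists z, (x = 3 * z)%Z).
    { intros x y Ex. pose proof (Z.div_mod x 3 ltac:(lia)) as M.
      pose proof (Z.mod_pos_bound x 3 ltac:(lia)) as B.
      set (q := (x / 3)%Z) in *. exists q.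
      assert (x mod 3 = 0 \/ x mod 3 = 1 \/ x mod 3 = 2)%Z as [R|[R|R]] by lia; rewrite R in M;
        nia. }
    destruct (D a (b * b)%Z E) as [a' ->].
    destruct (D b (a' * a')%Z) as [b' ->]; [nia|].
    assert (b' = 0)%Z; [|lia]. destruct (Z.eq_dec b' 0) as [|Hne]; [easy|].
    apply (IH a'); nia. }
  intros E. apply (H (S (Z.abs_nat b)) a b); [lia|easy].
Qed.

Lemma q3_irrational (a b : Z) : IZR a + IZR b * q3 = 0 -> a = 0%Z /\ b = 0%Z.
Proof.
  intros E.
  assert (H : (a * a = 3 * (b * b))%Z).
  { apply eq_IZR. rewrite !mult_IZR. pose proof q3_sq.
    replace (IZR a) with (- (IZR b * q3)) by lra. nra. }
  apply square_eq_3_square in H. subst b. split; [|easy]. apply eq_IZR. lra.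
Qed.

(** By irrationality of sqrt 3. It lets equalities of placements be read on their codes. *)
Lemma ev_inj a b : ev a = ev b -> a = b.
Proof.
  intros E. pose proof (f_equal Re E) as E1. pose proof (f_equal Im E) as E2.
  pose proof (re2_spec a) as A1. pose proof (im2_spec a) as A2.
  pose proof (re2_spec b) as B1. pose proof (im2_spec b) as B2.
  rewrite E1 in A1. rewrite E2 in A2.
  assert (D : forall p q, eval3 p = eval3 q -> p = q).
  { intros [p1 p2] [r1 r2]. unfold eval3. cbn [fst snd]. intros H.
    destruct (q3_irrational (p1 - r1) (p2 - r2)); [rewrite !minus_IZR; lra|]. f_equal; lia. }
  assert (F1 : re2 a = re2 b) by (apply D; lra). assert (F2 : im2 a = im2 b) by (apply D; lra).
  destr_zz a; destr_zz b. unfold re2, im2 in F1, F2.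
  apply pair_equal_spec in F1, F2. repeat apply (f_equal2 pair); lia.
Qed.

Lemma zeta_inj j k : (j < 12)%nat -> (k < 12)%nat -> zeta j = zeta k -> j = k.
Proof.
  intros Hj Hk E.
  assert (C : forallb (fun j => forallb (fun k => (j =? k)%nat || negb (zz_eqb (zeta j) (zeta
    k))) (seq 0 12)) (seq 0 12) = true)
    by (vm_compute; reflexivity).
  rewrite forallb_forall in C. specialize (C j). rewrite in_seq, forallb_forall in C.
  specialize (C ltac:(lia) k). rewrite in_seq, orb_true_iff, Nat.eqb_eq, negb_true_iff in C.
  destruct C as [C|C]; [lia|easy|]. apply zz_eqb_eq in E. congruence.
Qed.

Lemma pl_inj x y : (fst x < 12)%nat -> (fst y < 12)%nat -> pl x = pl y -> x = y.
Proof.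
  intros Hx Hy E. pose proof (f_equal lin E) as E1. pose proof (f_equal off E) as E2.
  unfold pl in E1, E2. cbn [lin off] in E1, E2. apply ev_inj in E1, E2.
  apply zeta_inj in E1; try easy. destruct x, y. simpl in *. now subst.
Qed.

Lemma compose_inj t u v : lin t <> RtoC 0 -> compose t u = compose t v -> u = v.
Proof.
  intros Ht E. pose proof (f_equal lin E) as E1. pose proof (f_equal off E) as E2.
  unfold compose, act in E1, E2. cbn [lin off] in E1, E2.
  assert (C : forall a b, (lin t * a)%C = (lin t * b)%C -> a = b).
  { intros a b H. transitivity (/ lin t * (lin t * a))%C; [field; easy|]. rewrite H. field; easy.
    }
  apply placement_eq; apply C; [easy|].
  replace (lin t * off u)%C with (lin t * off u + off t - off t)%C by ring. rewrite E2. ring.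
Qed.

Lemma unitary_lin t : unitary t -> lin t <> RtoC 0.
Proof.
  intros H E. unfold unitary in H. rewrite E in H. apply (f_equal fst) in H. simpl in H. lra.
Qed.

Lemma side_map (f : C -> C) l v w : side (map f l) v w <->
  exists k, (k < length l)%nat /\
    ((v = f (nth k l (RtoC 0)) /\ w = f (nth (S k mod length l) l (RtoC 0))) \/
     (v = f (nth (S k mod length l) l (RtoC 0)) /\ w = f (nth k l (RtoC 0)))).
Proof.
  unfold side. rewrite length_map.
  assert (N : forall k, (k < length l)%nat -> nth k (map f l) (RtoC 0) = f (nth k l (RtoC 0))).
  { intros k Hk. rewrite (nth_indep _ _ (f (RtoC 0))) by now rewrite length_map. apply map_nth. }
  split; intros (k & Hk & H); exists k; (split; [easy|]); cbv zeta in *;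
    rewrite !N in * by (try apply Nat.mod_upper_bound; lia); easy.
Qed.

Lemma side_sym l v w : side l v w -> side l w v.
Proof. intros (k & Hk & H). exists k. split; [easy|]. cbv zeta in *. tauto. Qed.

Lemma side_tile t i : (i < 14)%nat -> side (tile t) (act t (ev (pt i))) (act t (ev (pt (S i)))).
Proof.
  intros Hi. apply side_map. exists i. change (length spectre) with 14%nat. split; [easy|].
  left. rewrite !spectre_nth, pt_mod by (try apply Nat.mod_upper_bound; lia). easy.
Qed.

Lemma share_edge_nbr t i j s : (i < 14)%nat -> (j < 14)%nat ->
  share_edge (compose s t) (compose s (compose t (pl (nbr0 i j)))).
Proof.
  intros Hi Hj. destruct (nbr_spec t i j Hi Hj) as (_ & H1 & H2).
  exists (act (compose s t) (ev (pt i))), (act (compose s t) (ev (pt (S i)))).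
  split; [now apply side_tile|]. rewrite !(compose_act s t), <- H1, <- H2, <- !compose_act.
  apply side_sym. now apply side_tile.
Qed.

Lemma rho_zeta : rho = ev (zeta 2).
Proof. unfold rho. rewrite <- cis_zeta. f_equal. simpl. field. Qed.
Lemma rho_pow k : (rho ^ k)%C = ev (zeta (2 * k)).
Proof.
  induction k.
  - rewrite Nat.mul_0_r. symmetry. apply ev_one.
  - replace (2 * S k)%nat with (2 + 2 * k)%nat by lia.
    rewrite zeta_add, ev_mul, <- rho_zeta, <- IHk.
    easy.
Qed.

Lemma Cmod_cis x : Cmod (cis x) = 1.
Proof.
  unfold Cmod, cis. cbn [fst snd]. rewrite <- sqrt_1. f_equal. pose proof (sin2_cos2 x) as H.
  unfold Rsqr in H. lra.
Qed.
Lemma Cmod_zeta k : Cmod (ev (zeta k)) = 1.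
Proof. rewrite <- cis_zeta. apply Cmod_cis. Qed.

Lemma Cmod_sq z : (Cmod z ^ 2 = fst z ^ 2 + snd z ^ 2)%R.
Proof. unfold Cmod. rewrite pow2_sqrt; [easy|nra]. Qed.

Lemma znorm_Cmod a n : znorm a = (n, 0, 0, 0)%Z -> Cmod (ev a) ^ 2 = IZR n.
Proof.
  intros H. apply (f_equal ev) in H. unfold znorm in H. rewrite ev_mul, ev_conj in H.
  apply (f_equal fst) in H. rewrite Cmod_sq. destruct (ev a) as [x y]. simpl in H.
  cbn [fst snd]. simpl. lra.
Qed.

Lemma q3_norm_c : Cmod c = / q3.
Proof.
  assert (H : Cmod (1 + rho)%C = q3).
  { replace (RtoC 1 + rho)%C with (ev (zadd zone (zeta 2)))
      by (now rewrite ev_add, ev_one, rho_zeta).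
    assert (N : Cmod (ev (zadd zone (zeta 2))) ^ 2 = 3) by (apply znorm_Cmod; reflexivity).
    pose proof (Cmod_ge_0 (ev (zadd zone (zeta 2)))). pose proof q3_sq. pose proof q3_pos. nra. }
  unfold c. rewrite Cmod_inv; [now rewrite H|].
  intros E. rewrite E, Cmod_0 in H. pose proof q3_pos. lra.
Qed.

(** Consecutive vertices differ by [rho ^ k * (rho - 1) * c], and rho - 1 has modulus 1. *)
Lemma honeycomb_edge_length z z' : honeycomb_edge z z' -> Cmod (z' - z) = / q3.
Proof.
  intros (l & _ & H). unfold honeycomb_hexagon in H.
  destruct H as (k & Hk & H). rewrite length_map, length_seq in *. cbv zeta in H.
  assert (Nt : forall k, (k < 6)%nat ->
    nth k (map (fun k => (l + rho ^ k * c)%C) (seq 0 6)) (RtoC 0) = (l + rho ^ k * c)%C).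
  { intros k' Hk'. rewrite (nth_indep _ _ ((fun k => (l + rho ^ k * c)%C) 0%nat))
      by (rewrite length_map, length_seq; lia).
    rewrite (map_nth (fun k => (l + rho ^ k * c)%C)), seq_nth by easy. easy. }
  rewrite !Nt in H by (try apply Nat.mod_upper_bound; lia).
  assert (R : (rho ^ (S k mod 6))%C = (ev (zeta (2 * k)) * rho)%C).
  { rewrite rho_pow, rho_zeta, <- ev_mul, <- zeta_add. f_equal.
    replace (2 * k + 2)%nat with (2 * S k)%nat by lia.
    rewrite <- (zeta_mod (2 * S k)), <- (zeta_mod (2 * (S k mod 6))). f_equal.
    rewrite <- (Nat.mul_mod_distr_l (S k) 6 2) by lia. now rewrite Nat.Div0.mod_mod. }
  rewrite R, rho_pow in H.
  assert (U : Cmod (rho - 1)%C = 1).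
  { replace (rho - RtoC 1)%C with (ev (zsub (zeta 2) zone))
      by (now rewrite ev_sub, ev_one, rho_zeta).
    assert (N : Cmod (ev (zsub (zeta 2) zone)) ^ 2 = 1) by (apply znorm_Cmod; reflexivity).
    pose proof (Cmod_ge_0 (ev (zsub (zeta 2) zone))). nra. }
  assert (V : Cmod (ev (zeta (2 * k)) * (rho - 1) * c)%C = / q3).
  { rewrite !Cmod_mult, Cmod_zeta, U, q3_norm_c. ring. }
  destruct H as [[-> ->]|[-> ->]].
  - rewrite <- V. f_equal. ring.
  - rewrite <- V, <- (Cmod_opp (_ * _ * _)). f_equal. ring.
Qed.

Definition sumC (l : list C) : C := fold_right Cplus (RtoC 0) l.
Lemma sumC_perm l l' : Permutation l l' -> sumC l = sumC l'.
Proof.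
  induction 1; simpl; [easy|now f_equal|ring|congruence].
Qed.

Lemma c_nonzero : c <> RtoC 0.
Proof.
  intros E. pose proof q3_norm_c as H. rewrite E, Cmod_0 in H.
  pose proof (Rinv_0_lt_compat _ q3_pos). lra.
Qed.

Lemma honeycomb_NoDup l : NoDup (honeycomb_hexagon l).
Proof.
  unfold honeycomb_hexagon. apply FinFun.Injective_map_NoDup_in; [|apply seq_NoDup].
  intros j k Hj Hk E. apply in_seq in Hj, Hk.
  assert (E1 : (rho ^ j)%C = (rho ^ k)%C).
  { transitivity ((l + rho ^ j * c - l) * / c)%C; [field; apply c_nonzero|].
    rewrite E. field. apply c_nonzero. }
  rewrite !rho_pow in E1. apply ev_inj, zeta_inj in E1; lia.
Qed.

Lemma honeycomb_sum l : sumC (honeycomb_hexagon l) = (RtoC 6 * l)%C.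
Proof.
  unfold honeycomb_hexagon, sumC. cbn [map seq fold_right]. rewrite !rho_pow.
  assert (E : (ev (zeta (2 * 0)) + ev (zeta (2 * 1)) + ev (zeta (2 * 2)) + ev (zeta (2 * 3))
     + ev (zeta (2 * 4)) + ev (zeta (2 * 5)))%C = RtoC 0).
  { rewrite <- !ev_add, <- ev_zero. reflexivity. }
  transitivity (RtoC 6 * l + (ev (zeta (2 * 0)) + ev (zeta (2 * 1)) + ev (zeta (2 * 2)) + ev
    (zeta (2 * 3))
     + ev (zeta (2 * 4)) + ev (zeta (2 * 5))) * c)%C; [|rewrite E; ring].
  generalize (ev (zeta (2 * 0))) (ev (zeta (2 * 1))) (ev (zeta (2 * 2))) (ev (zeta (2 * 3)))
    (ev (zeta (2 * 4))) (ev (zeta (2 * 5))) c. intros.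
  apply injective_projections; simpl; ring.
Qed.

(** [maps_hex_to] only equates sets of vertices. The honeycomb hexagon has six distinct vertices, so
    the six image points are a permutation of them, and their sum determines the centre. *)
Lemma maps_hex_sum f h l : maps_hex_to f h l -> sumC (map f (hex h)) = (RtoC 6 * l)%C.
Proof.
  intros [_ H]. rewrite <- honeycomb_sum. symmetry. apply sumC_perm.
  apply NoDup_Permutation_bis; [apply honeycomb_NoDup| |].
  - unfold hex, honeycomb_hexagon. rewrite !length_map. simpl. lia.
  - intros z Hz. now apply H.
Qed.

Strategy 200 [Cmult Cplus Cminus Copp ev zeta zmul zadd zsub zscale zt].

(** * Coordinates relative to a reference odd tile *)

Record setup (T D : placement -> Prop) (s t0 : placement) : Prop := {
  setup_tiling : tiling T;
  setup_t0 : T t0;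
  setup_lin : lin s <> RtoC 0;
  setup_D : D = image_tiling s T;
  setup_odd : odd D (compose s t0) }.

Definition coords (T : placement -> Prop) (t0 : placement) (x : zpl) : Prop :=
  (fst x < 12)%nat /\ T (compose t0 (pl x)).
Definition plac (s t0 : placement) (x : zpl) : placement := compose s (compose t0 (pl x)).
(** The position in Z[zeta] of the point w of the tile with code x; [plac_act] carries it to the
    plane. *)
Definition vz (x : zpl) (w : zz) : zz := zadd (zmul (zt (fst x)) w) (snd x).

Lemma plac_lin s t0 x : lin (plac s t0 x) = (lin s * lin t0 * ev (zeta (fst x)))%C.
Proof. unfold plac, compose, pl. cbn [lin]. ring. Qed.
Lemma plac_act s t0 x w : (fst x < 12)%nat ->
  act (plac s t0 x) (ev w) = (lin s * lin t0 * ev (vz x w) + act s (off t0))%C.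
Proof.
  intros H. unfold plac, compose, act, pl, vz. cbn [lin off].
  rewrite ev_add, ev_mul, zt_spec by easy. ring.
Qed.
Lemma plac_D T D s t0 x : setup T D s t0 -> coords T t0 x -> D (plac s t0 x).
Proof. intros S [_ H]. rewrite (setup_D _ _ _ _ S). now exists (compose t0 (pl x)). Qed.

Lemma plac_zid s t0 : plac s t0 zid = compose s t0.
Proof. unfold plac. now rewrite compose_zid. Qed.

Lemma plac_inj T D s t0 x y : setup T D s t0 -> coords T t0 x -> coords T t0 y ->
  plac s t0 x = plac s t0 y -> x = y.
Proof.
  intros S [Hx _] [Hy _] E. apply pl_inj; auto.
  apply (compose_inj t0); [apply unitary_lin, (tiling_unitary T); apply S|].
  apply (compose_inj s); [apply S|exact E].
Qed.

Lemma same_parity_plac s t0 x y : (fst x < 12)%nat -> (fst y < 12)%nat ->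
  Nat.even (fst x) = Nat.even (fst y) -> same_parity (plac s t0 x) (plac s t0 y).
Proof.
  intros Hx Hy E.
  assert (exists n, (2 * n + fst x = 12 + fst y)%nat) as [n Hn].
  { destruct (Nat.even (fst x)) eqn:Ex; symmetry in E.
    - apply Nat.even_spec in Ex, E. destruct Ex as [a Ha], E as [b Hb]. exists (6 + b - a)%nat.
      lia.
    - rewrite <- Nat.negb_odd, negb_false_iff, Nat.odd_spec in Ex, E.
      destruct Ex as [a Ha], E as [b Hb]. exists (6 + b - a)%nat. lia. }
  exists n. rewrite !plac_lin, rho_pow.
  rewrite <- (zeta_12 (fst y)), <- Hn, zeta_add, ev_mul. ring.
Qed.

(** Geometry enters the search here: contact along whole sides, disjointness of tiles, and the
    property of the parity class of the reference tile. *)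
Lemma setup_good T D s t0 : setup T D s t0 -> good (coords T t0).
Proof.
  intros S. assert (HT := setup_tiling _ _ _ _ S). split.
  - now intros x [H _].
  - intros x i [Hx H] Hi. destruct (edge_to_edge T _ i HT H Hi) as (j & Hj & H').
    exists j. split; [easy|]. split; [apply zcomp_lt|]. now rewrite pl_zcomp, compose_assoc.
  - intros x y Hx Hy H. apply (plac_inj T D s t0); auto. unfold plac. f_equal.
    destruct Hx as [Hxl Hx], Hy as [Hyl Hy]. rewrite <- (zcomp_zrel x y) in Hy |- * by easy.
    rewrite pl_zcomp, compose_assoc in Hy |- * by easy.
    now apply (overlap_eq T).
  - intros x y Hx Hy Ex Ey H. apply NNPP. intros Hne.
    apply sharesb_spec in H. destruct H as (i & j & Hi & Hj & H).
    destruct (setup_odd _ _ _ _ S) as [_ Ho]. rewrite <- (plac_zid s t0) in Ho.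
    apply (Ho (plac s t0 x) (plac s t0 y)).
    + now apply (plac_D T).
    + now apply (plac_D T).
    + apply same_parity_plac; [simpl; lia|apply Hx|now rewrite Ex].
    + apply same_parity_plac; [simpl; lia|apply Hy|now rewrite Ey].
    + intros E. now apply Hne, (plac_inj T D s t0).
    + destruct Hx as [Hxl Hx], Hy as [Hyl Hy].
      rewrite <- (zcomp_zrel x y), H by easy. unfold plac at 2.
      rewrite pl_zcomp, (compose_assoc t0) by easy.
      now apply share_edge_nbr.
Qed.

Lemma coords_zid T D s t0 : setup T D s t0 -> coords T t0 zid.
Proof. intros S. split; [simpl; lia|]. rewrite compose_zid. apply S. Qed.

(** Induction over all tiles: [neighbours_connect] is applied to the family of tiles that have a
    code satisfying Q and [near], so it suffices that Q passes through gluings. *)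
Lemma D_plac T D s t0 : setup T D s t0 -> forall (Q : zpl -> Prop), Q zid ->
  (forall x i j, coords T t0 x -> near (coords T t0) x -> Q x -> (i < 14)%nat -> (j < 14)%nat ->
     coords T t0 (zcomp x (nbr0 i j)) -> Q (zcomp x (nbr0 i j))) ->
  forall h, D h -> exists x, coords T t0 x /\ near (coords T t0) x /\ Q x /\ h = plac s t0 x.
Proof.
  intros S Q Q0 Qn h Hh. rewrite (setup_D _ _ _ _ S) in Hh. destruct Hh as (t & Ht & ->).
  assert (HG := setup_good _ _ _ _ S). assert (HT := setup_tiling _ _ _ _ S).
  assert (K : exists x, coords T t0 x /\ near (coords T t0) x /\ Q x /\ t = compose t0 (pl x)).
  { apply (neighbours_connect T (fun t => exists x,
      coords T t0 x /\ near (coords T t0) x /\ Q x /\ t = compose t0 (pl x)) t0 HT).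
    - intros t' (x & [_ Hx] & _ & _ & ->). easy.
    - exists zid. repeat split; [simpl; lia|rewrite compose_zid;
        apply S| |easy|now rewrite compose_zid].
      apply near_zid; [easy|]. now apply (coords_zid T D s).
    - intros t' i (x & Hx & Nx & Qx & ->) Hi.
      destruct (edge_to_edge T _ i HT (proj2 Hx) Hi) as (j & Hj & H'). exists j. split; [easy|].
      assert (Hc : coords T t0 (zcomp x (nbr0 i j))).
      { split; [apply zcomp_lt|]. rewrite pl_zcomp, compose_assoc; [easy|apply Hx]. }
      exists (zcomp x (nbr0 i j)). split; [easy|]. split; [now apply near_nbr|].
      split; [now apply Qn|].
      rewrite pl_zcomp, compose_assoc; [easy|apply Hx].
    - easy. }
  destruct K as (x & Hx & Nx & Qx & ->). now exists x.
Qed.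

Lemma D_coords T D s t0 h : setup T D s t0 -> D h ->
  exists x, coords T t0 x /\ near (coords T t0) x /\ h = plac s t0 x.
Proof.
  intros S Hh. destruct (D_plac T D s t0 S (fun _ => True)) with (h := h) as (x & H1 & H2 & _ &
    H3); auto.
  now exists x.
Qed.

(** All tiles with an odd rotation have the same parity, and two of them, in the cluster of the
    reference tile, share a side. *)
Lemma plac_not_odd T D s t0 x : setup T D s t0 -> coords T t0 x -> Nat.even (fst x) = false ->
  ~ odd D (plac s t0 x).
Proof.
  intros S Hx Ex [_ Ho].
  destruct (even_tiles_share _ (setup_good _ _ _ _ S) (coords_zid _ _ _ _ S))
    as (x1 & x2 & i & j & H1 & H2 & E1 & E2 & Hi & Hj & E & Hne).
  apply (Ho (plac s t0 x1) (plac s t0 x2)).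
  - now apply (plac_D T).
  - now apply (plac_D T).
  - apply same_parity_plac; [apply Hx|apply H1|congruence].
  - apply same_parity_plac; [apply Hx|apply H2|congruence].
  - intros E'. now apply Hne, (plac_inj T D s t0).
  - rewrite E. unfold plac at 2. rewrite pl_zcomp, (compose_assoc t0) by apply H1.
    now apply share_edge_nbr.
Qed.

Lemma plac_odd T D s t0 x : setup T D s t0 -> coords T t0 x -> Nat.even (fst x) = true ->
  odd D (plac s t0 x).
Proof.
  intros S Hx Ex. split; [now apply (plac_D T)|].
  intros h1 h2 D1 D2 P1 P2. destruct (setup_odd _ _ _ _ S) as [_ Ho].
  assert (P : forall h, D h -> same_parity (plac s t0 x) h -> same_parity (compose s t0) h).
  { intros h _ [k Hk]. rewrite <- plac_zid. apply Nat.even_spec in Ex. destruct Ex as [m Hm].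
    exists (m + k)%nat. rewrite Hk, !plac_lin, !rho_pow, Hm.
    replace (2 * (m + k))%nat with (2 * m + 2 * k)%nat by lia. rewrite zeta_add, ev_mul.
    cbn [zid fst zeta]. rewrite ev_one. ring. }
  apply Ho; auto.
Qed.

Lemma odd_plac_even T D s t0 x : setup T D s t0 -> coords T t0 x -> odd D (plac s t0 x) ->
  Nat.even (fst x) = true.
Proof.
  intros S Hx Ho. destruct (Nat.even (fst x)) eqn:E; [easy|].
  now apply (plac_not_odd T D s t0 x) in E.
Qed.

(* [ring] would compare the atoms [ev _] by computing them. *)
Ltac ev_ring := repeat match goal with |- context [ev ?a] => generalize (ev a); intro end; ring.

(** The point p completes the parallelogram with vertices P 1, p, P 11, P 13, which places it in
    Z[zeta]. *)
Definition pz : zz := Eval vm_compute in zsub (zadd (pt 1) (pt 11)) (pt 13).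
Definition hex_points : list zz := [pt 1; pt 3; pt 5; pt 7; pt 9; pz].
Definition rhomb_points : list zz := [pt 1; pz; pt 11; pt 13].

Lemma p_pz : p = ev pz.
Proof. unfold p. fold q3. apply injective_projections; simpl; field. Qed.

Lemma spectre_hex_eq : spectre_hex = map ev hex_points.
Proof. unfold spectre_hex, hex_points. rewrite !P_pt, p_pz by lia. easy. Qed.
Lemma spectre_rhomb_eq : spectre_rhomb = map ev rhomb_points.
Proof. unfold spectre_rhomb, rhomb_points. rewrite !P_pt, p_pz by lia. easy. Qed.

(* The sides of the hex are [zeta n * alpha] for these [n]. *)
Definition hex_exps : list nat := [0; 10; 8; 6; 4; 2]%nat.
Lemma hex_exps_spec k : (k < 6)%nat ->
  zsub (nth (S k mod 6) hex_points zzero) (nth k hex_points zzero) = zmul (zeta (nth k hex_exps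
    0%nat)) alpha /\
  Nat.even (nth k hex_exps 0%nat) = true.
Proof. intros H. do 6 (destruct k as [|k]; [split; reflexivity|]). lia. Qed.
Definition edge_vec (s t0 : placement) (n : nat) : C := (lin s * lin t0 * ev (zeta n) * ev
  alpha)%C.

Lemma plac_side_vec s t0 x w w' n : (fst x < 12)%nat -> zsub w' w = zmul (zeta n) alpha ->
  (act (plac s t0 x) (ev w') - act (plac s t0 x) (ev w))%C = edge_vec s t0 (fst x + n).
Proof.
  intros Hx H. unfold act, edge_vec. rewrite plac_lin, zeta_add, ev_mul.
  transitivity (lin s * lin t0 * ev (zeta (fst x)) * (ev w' - ev w))%C; [ring|].
  rewrite <- ev_sub, H, ev_mul. ev_ring.
Qed.

Lemma edge_vec_6 s t0 n : edge_vec s t0 (6 + n) = (- edge_vec s t0 n)%C.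
Proof. unfold edge_vec. rewrite zeta_add, ev_mul, ev_zeta_6. ev_ring. Qed.

Lemma poly_side (f : C -> C) (ws : list zz) v w : side (map f (map ev ws)) v w <->
  exists k, (k < length ws)%nat /\
    ((v = f (ev (nth k ws zzero)) /\ w = f (ev (nth (S k mod length ws) ws zzero))) \/
     (v = f (ev (nth (S k mod length ws) ws zzero)) /\ w = f (ev (nth k ws zzero)))).
Proof.
  rewrite side_map, length_map.
  assert (N : forall k, (k < length ws)%nat -> nth k (map ev ws) (RtoC 0) = ev (nth k ws zzero)).
  { intros k Hk. rewrite <- ev_zero. apply map_nth. }
  split; intros (k & Hk & H); exists k; (split; [easy|]);
    rewrite !N in * by (try apply Nat.mod_upper_bound; lia); easy.
Qed.

Lemma hex_side_vec s t0 x v w : (fst x < 12)%nat -> side (hex (plac s t0 x)) v w ->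
  exists n, Nat.even n = Nat.even (fst x) /\ (w - v)%C = edge_vec s t0 n.
Proof.
  intros Hx H. unfold hex in H. rewrite spectre_hex_eq in H. apply poly_side in H.
  destruct H as (k & Hk & H). change (length hex_points) with 6%nat in *.
  destruct (hex_exps_spec k Hk) as [E Ev].
  assert (V := plac_side_vec s t0 x _ _ _ Hx E).
  destruct H as [[-> ->]|[-> ->]].
  - exists (fst x + nth k hex_exps 0)%nat. split; [|easy]. rewrite Nat.even_add, Ev.
    now destruct (Nat.even (fst x)).
  - exists (6 + (fst x + nth k hex_exps 0))%nat. split.
    + rewrite !Nat.even_add, Ev. now destruct (Nat.even (fst x)).
    + rewrite edge_vec_6, <- V. ring.
Qed.

Lemma hex_side_ex s t0 x n : (fst x < 12)%nat -> Nat.even n = Nat.even (fst x) ->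
  exists v w, side (hex (plac s t0 x)) v w /\ (w - v)%C = edge_vec s t0 n.
Proof.
  intros Hx En. set (m := ((n + 12 - fst x) mod 12)%nat).
  assert (Em : Nat.even m = true).
  { unfold m. rewrite even_mod12, Nat.even_sub, Nat.even_add, En by lia.
    now destruct (Nat.even (fst x)). }
  assert (Hm : (m < 12)%nat) by (now apply Nat.mod_upper_bound).
  assert (exists k, (k < 6)%nat /\ nth k hex_exps 0%nat = m) as (k & Hk & Ek).
  { clearbody m. do 12 (destruct m as [|m]; [try discriminate Em; clear; first
      [exists 0%nat; split; [lia|reflexivity]|exists 1%nat; split;
        [lia|reflexivity]|exists 2%nat; split; [lia|reflexivity]
      |exists 3%nat; split; [lia|reflexivity]|exists 4%nat; split;
        [lia|reflexivity]|exists 5%nat; split; [lia|reflexivity]]|]). lia. }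
  destruct (hex_exps_spec k Hk) as [E _]. rewrite Ek in E.
  assert (V := plac_side_vec s t0 x _ _ _ Hx E).
  eexists _, _. split.
  - unfold hex. rewrite spectre_hex_eq. apply poly_side. exists k. split; [exact Hk|]. left.
    split; reflexivity.
  - change (length hex_points) with 6%nat. rewrite V. unfold edge_vec. f_equal. f_equal. f_equal.
    rewrite <- (zeta_mod (fst x + m)). unfold m. rewrite Nat.Div0.add_mod_idemp_r.
    replace (fst x + (n + 12 - fst x))%nat with (12 + n)%nat by lia.
    now rewrite zeta_mod, zeta_12.
Qed.

(** The ratio zeta^(m - n) is real only when 6 divides m - n. *)
Lemma edge_vec_parity s t0 m n r : (lin s * lin t0)%C <> RtoC 0 ->
  edge_vec s t0 m = (RtoC r * edge_vec s t0 n)%C -> Nat.even m = Nat.even n.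
Proof.
  intros HL E. destruct (Bool.bool_dec (Nat.even m) (Nat.even n)) as [|Hne]; [easy|exfalso].
  assert (Ha : ev alpha <> RtoC 0) by (apply nonzero_spec; reflexivity).
  assert (E1 : ev (zeta m) = (RtoC r * ev (zeta n))%C).
  { unfold edge_vec in E. transitivity (/ (lin s * lin t0 * ev alpha) * (lin s * lin t0 * ev
      (zeta m) * ev alpha))%C.
    - revert Ha HL. generalize (ev alpha) (ev (zeta m)) (lin s) (lin t0). intros a u p q Ha HL.
      field. split; [easy|]. split; intros E0; apply HL; rewrite E0; ring.
    - rewrite E. revert Ha HL. generalize (ev alpha) (ev (zeta n)) (lin s) (lin t0).
      intros a u p q Ha HL.
      field. split; [easy|]. split; intros E0; apply HL; rewrite E0; ring. }
  (* Modulo 12, [11 * n] stands for - n. *)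
  set (d := ((m + 11 * n) mod 12)%nat).
  assert (E2 : ev (zeta d) = RtoC r).
  { unfold d. rewrite zeta_mod, zeta_add, ev_mul, E1.
    transitivity (RtoC r * ev (zeta (n + 11 * n)))%C; [rewrite zeta_add, ev_mul; ev_ring|].
    rewrite <- zeta_mod. replace ((n + 11 * n) mod 12)%nat with 0%nat.
    - cbn [zeta]. rewrite ev_one. ring.
    - replace (n + 11 * n)%nat with (n * 12)%nat by lia. now rewrite Nat.Div0.mod_mul. }
  assert (Ed : Nat.even d = false).
  { unfold d. rewrite even_mod12, Nat.even_add, Nat.even_mul. change (Nat.even 11) with false.
    cbn [orb].
    now destruct (Nat.even m), (Nat.even n). }
  assert (Hd : (d < 12)%nat) by (now apply Nat.mod_upper_bound).
  assert (C : forallb (fun d => Nat.even d || lt0 (im2 (zeta d)) || lt0 (opp3 (im2 (zeta d))))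
    (seq 0 12) = true)
    by (vm_compute; reflexivity).
  rewrite forallb_forall in C. specialize (C d). rewrite in_seq, Ed in C. cbn [orb] in C.
  pose proof (im2_spec (zeta d)) as I. rewrite E2 in I. unfold Im in I. simpl snd in I.
  apply orb_true_iff in C; [|lia]. destruct C as [C|C]; apply lt0_spec in C;
    rewrite ?opp3_spec in C; lra.
Qed.

Lemma setup_L T D s t0 : setup T D s t0 -> (lin s * lin t0)%C <> RtoC 0.
Proof.
  intros S. apply Cmult_neq_0; [apply S|]. apply unitary_lin, (tiling_unitary T); apply S.
Qed.

(** The hexes of even tiles have sides [edge_vec s t0 n] with n odd, those of odd tiles with n even,
    and by [edge_vec_parity] the two families have no common direction. *)
Lemma edge_kind T D s t0 v w n : setup T D s t0 -> decoration_edge D v w ->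
  (w - v)%C = edge_vec s t0 n ->
  (Nat.even n = true -> yellow_edge D v w) /\ (Nat.even n = false -> blue_edge D v w).
Proof.
  intros S Hd Hv. split; intros En.
  - split; [easy|]. intros (_ & t & x & x' & [Dt No] & Hs & r & Hr & Hp).
    destruct (D_coords T D s t0 t S Dt) as (z & Hz & _ & ->).
    destruct (hex_side_vec s t0 z x x' (proj1 Hz) Hs) as (m & Em & Hm).
    rewrite Hv, Hm in Hp. apply edge_vec_parity in Hp; [|now apply (setup_L T D)].
    apply No. apply (plac_odd T D s t0 z S Hz). congruence.
  - split; [easy|].
    destruct (even_tiles_share _ (setup_good _ _ _ _ S) (coords_zid _ _ _ _ S))
      as (z & _ & _ & _ & Hz & _ & Ez & _).
    destruct (hex_side_ex s t0 z n (proj1 Hz)) as (x & x' & Hs & Hm); [congruence|].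
    exists (plac s t0 z), x, x'. split; [split;
      [now apply (plac_D T)|now apply (plac_not_odd T)]|].
    split; [easy|]. exists 1. split; [lra|]. rewrite Hv, Hm. ring.
Qed.

(** * Components of displacements and increments of b and y *)

Ltac zz_const t := let t' := eval vm_compute in t in change t with t'.
Ltac zz_cbv := unfold bpart, ypart, twice_quot;
  try zz_const (zeta 10); try zz_const (zeta 1); try zz_const (zeta 2); try zz_const alpha;
  unfold zsub, zadd, zscale, zmul, zzero; cbv beta iota zeta.

Lemma bpart_sub a b : bpart (zsub a b) = zsub (bpart a) (bpart b).
Proof. destr_zz a; destr_zz b. zz_cbv. repeat apply (f_equal2 pair); ring. Qed.
Lemma ypart_sub a b : ypart (zsub a b) = zsub (ypart a) (ypart b).
Proof. destr_zz a; destr_zz b. zz_cbv. repeat apply (f_equal2 pair); ring. Qed.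
Lemma ypart_add a b : ypart (zadd a b) = zadd (ypart a) (ypart b).
Proof. destr_zz a; destr_zz b. zz_cbv. repeat apply (f_equal2 pair); ring. Qed.
Lemma ypart_scale n a : ypart (zscale n a) = zscale n (ypart a).
Proof. destr_zz a. zz_cbv. repeat apply (f_equal2 pair); ring. Qed.
Lemma parts_rot2 a : bpart (zmul (zeta 2) a) = zmul (zeta 2) (bpart a) /\
  ypart (zmul (zeta 2) a) = zmul (zeta 2) (ypart a).
Proof. destr_zz a. split; zz_cbv; repeat apply (f_equal2 pair); ring. Qed.
Lemma parts_rot k a : Nat.even k = true -> bpart (zmul (zeta k) a) = zmul (zeta k) (bpart a) /\
  ypart (zmul (zeta k) a) = zmul (zeta k) (ypart a).
Proof.
  intros H. apply Nat.even_spec in H. destruct H as [m ->]. induction m.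
  - change (zeta (2 * 0)) with zone. now rewrite !zmul_1.
  - replace (2 * S m)%nat with (2 + 2 * m)%nat by lia.
    rewrite zeta_add. destruct IHm as [IH1 IH2].
    assert (A : forall u, zmul (zmul (zeta 2) (zeta (2 * m))) u = zmul (zeta 2) (zmul (zeta (2 *
      m)) u))
      by (intros u; symmetry; apply zmul_assoc).
    rewrite !A. destruct (parts_rot2 (zmul (zeta (2 * m)) a)) as [-> ->]. rewrite IH1, IH2.
    split; reflexivity.
Qed.

Lemma parts_edge n : if Nat.even n
  then bpart (zmul (zeta n) alpha) = zzero /\ ypart (zmul (zeta n) alpha) = zscale 2 (zmul (zeta
    n) alpha)
  else ypart (zmul (zeta n) alpha) = zzero /\ bpart (zmul (zeta n) alpha) = zscale 2 (zmul (zeta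
    n) alpha).
Proof.
  rewrite <- (zeta_mod n), <- (even_mod12 n).
  assert (H : (n mod 12 < 12)%nat) by (now apply Nat.mod_upper_bound).
  generalize dependent (n mod 12)%nat. intros m H.
  do 12 (destruct m as [|m]; [split; vm_compute; reflexivity|]). lia.
Qed.

(** The increments of b and y are the components of the displacement a' - a in Z[zeta]. The factor
    1/2 compensates the doubling in [bpart] and [ypart], and zeta^11 is the rotation exp (- i pi /
    6) of [is_y]. *)
Definition pot (b y : C -> C) (L v : C) (a : zz) (v' : C) (a' : zz) : Prop :=
  (b v' - b v = RtoC (1 / 2) * L * (ev (bpart a') - ev (bpart a)))%C /\
  (y v' - y v = ev (zeta 11) * (RtoC (1 / 2) * L) * (ev (ypart a') - ev (ypart a)))%C.

Lemma pot_refl b y L v a : pot b y L v a v a.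
Proof. split; ring. Qed.
Lemma pot_sym b y L v a v' a' : pot b y L v a v' a' -> pot b y L v' a' v a.
Proof.
  intros [H1 H2]. split.
  - replace (b v - b v')%C with (- (b v' - b v))%C by ring. rewrite H1. ev_ring.
  - replace (y v - y v')%C with (- (y v' - y v))%C by ring. rewrite H2. ev_ring.
Qed.
Lemma pot_trans b y L v a v' a' v'' a'' : pot b y L v a v' a' -> pot b y L v' a' v'' a'' ->
  pot b y L v a v'' a''.
Proof.
  intros [H1 H2] [H3 H4]. split.
  - replace (b v'' - b v)%C with ((b v'' - b v') + (b v' - b v))%C by ring. rewrite H1, H3.
    ev_ring.
  - replace (y v'' - y v)%C with ((y v'' - y v') + (y v' - y v))%C by ring. rewrite H2, H4.
    ev_ring.
Qed.

Lemma cis_opp_PI6 : cis (- (PI / 6)) = ev (zeta 11).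
Proof.
  rewrite <- cis_zeta. unfold cis. replace (INR 11 * (PI / 6)) with (- (PI / 6) + 2 * PI)
    by (simpl; field).
  now rewrite cos_plus, sin_plus, cos_2PI, sin_2PI, !Rmult_1_r, !Rmult_0_r, Rminus_0_r, Rplus_0_r.
Qed.

Lemma edge_pot T D s t0 b y v w n a a' : setup T D s t0 -> is_b D b -> is_y D y ->
  decoration_edge D v w -> (w - v)%C = edge_vec s t0 n -> zsub a' a = zmul (zeta n) alpha ->
  pot b y (lin s * lin t0) v a w a'.
Proof.
  intros S (B1 & B2 & _) (Y1 & Y2 & _) Hd Hv Ha.
  destruct (edge_kind T D s t0 v w n S Hd Hv) as [Hy Hb].
  assert (Eb : (ev (bpart a') - ev (bpart a))%C = ev (bpart (zmul (zeta n) alpha)))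
    by (rewrite <- ev_sub, <- bpart_sub, Ha; easy).
  assert (Ey : (ev (ypart a') - ev (ypart a))%C = ev (ypart (zmul (zeta n) alpha)))
    by (rewrite <- ev_sub, <- ypart_sub, Ha; easy).
  assert (Half : forall u, (RtoC (1 / 2) * (RtoC 2 * u))%C = u).
  { intros u. apply injective_projections; simpl; field. }
  pose proof (parts_edge n) as Q. unfold pot. rewrite Eb, Ey.
  assert (E2 : ev (zscale 2 (zmul (zeta n) alpha)) = (RtoC 2 * (ev (zeta n) * ev alpha))%C)
    by (rewrite ev_scale, ev_mul; easy).
  destruct (Nat.even n).
  - destruct Q as [-> ->]. specialize (Hy eq_refl).
    rewrite (B2 _ _ Hy), (Y1 _ _ Hy), Hv, ev_zero, E2, cis_opp_PI6. split; [ring|].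
    unfold edge_vec.
    transitivity (ev (zeta 11) * (lin s * lin t0) * (RtoC (1 / 2) * (RtoC 2 * (ev (zeta n) * ev
      alpha))))%C; [|ev_ring].
    rewrite Half. ev_ring.
  - destruct Q as [-> ->]. specialize (Hb eq_refl).
    rewrite (B1 _ _ Hb), (Y2 _ _ Hb), Hv, ev_zero, E2. split; [|ev_ring].
    unfold edge_vec.
    transitivity ((lin s * lin t0) * (RtoC (1 / 2) * (RtoC 2 * (ev (zeta n) * ev alpha))))%C;
      [|ev_ring].
    rewrite Half. ev_ring.
Qed.

(* Consecutive points are joined by sides of the hex, then of the rhomb. *)
Definition deco_points : list zz := [pt 1; pt 3; pt 5; pt 7; pt 9; pz; pt 11; pt 13].
Definition deco_exps : list nat :=
  [0; 10; 8; 6; 4; 7; 2]%nat.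

Lemma vz_sub x w w' : zsub (vz x w') (vz x w) = zmul (zt (fst x)) (zsub w' w).
Proof.
  unfold vz. destruct (zt (fst x)) as [[[? ?] ?] ?], (snd x) as [[[? ?] ?] ?]; destr_zz w;
    destr_zz w'.
  unfold zsub, zadd, zmul, zscale. cbv zeta. repeat apply (f_equal2 pair); ring.
Qed.

Lemma tile_pot T D s t0 b y x w : setup T D s t0 -> is_b D b -> is_y D y -> coords T t0 x ->
  In w deco_points ->
  pot b y (lin s * lin t0) (act (plac s t0 x) (ev (pt 1))) (vz x (pt 1))
    (act (plac s t0 x) (ev w)) (vz x w).
Proof.
  intros S Hb Hy Hx Hw.
  assert (A : forall k, (k < 8)%nat -> pot b y (lin s * lin t0) (act (plac s t0 x) (ev (pt 1)))
    (vz x (pt 1))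
    (act (plac s t0 x) (ev (nth k deco_points zzero))) (vz x (nth k deco_points zzero))).
  { induction k; intros Hk; [apply pot_refl|].
    eapply pot_trans; [apply IHk; lia|].
    assert (E : zsub (nth (Datatypes.S k) deco_points zzero) (nth k deco_points zzero) =
      zmul (zeta (nth k deco_exps 0%nat)) alpha).
    { clear - Hk. do 7 (destruct k as [|k]; [reflexivity|]). lia. }
    apply (edge_pot T D s t0 b y _ _ (fst x + nth k deco_exps 0%nat)); auto.
    - exists (plac s t0 x). split; [now apply (plac_D T)|].
      assert (K : (k < 5)%nat \/ k = 5%nat \/ k = 6%nat) by lia.
      destruct K as [K|K].
      + left. unfold hex. rewrite spectre_hex_eq. apply poly_side. exists k. split; [simpl; lia|].
        left. clear - K. do 5 (destruct k as [|k]; [split; reflexivity|]). lia.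
      + right. unfold rhomb. rewrite spectre_rhomb_eq. apply poly_side.
        destruct K as [-> | ->]; [exists 1%nat|exists 2%nat]; (split; [simpl; lia|]); left;
          split; reflexivity.
    - apply plac_side_vec; [apply Hx|easy].
    - rewrite vz_sub, E, zt_spec, zeta_add, zmul_assoc; [easy|apply Hx]. }
  destruct (In_nth _ _ zzero Hw) as (k & Hk & <-). now apply A.
Qed.

(** Two tiles that share a side have a common decoration vertex, through which the increments of b
    and y pass from one tile to the other. *)
Lemma edges_share_deco odd r : In r (edges odd) ->
  exists w w', In w deco_points /\ In w' deco_points /\ w = vz r w'.
Proof.
  intros Hr.
  assert (H : forallb (fun r => existsb (fun w => existsb (fun w' => zz_eqb w (vz r w'))
    deco_points) deco_points)
     (edges_odd ++ edges_even) = true) by (vm_compute; reflexivity).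
  rewrite forallb_forall in H. specialize (H r).
  rewrite existsb_exists in H. destruct H as (w & Hw & H).
  { apply in_or_app. destruct odd; [now left|now right]. }
  apply existsb_exists in H. destruct H as (w' & Hw' & H). apply zz_eqb_eq in H. now exists w, w'.
Qed.

Lemma vz_zcomp x r w : (fst x < 12)%nat -> (fst r < 12)%nat -> vz (zcomp x r) w = vz x (vz r w).
Proof.
  intros Hx Hr. unfold vz, zcomp. cbn [fst snd].
  rewrite !zt_spec, zeta_mod, zeta_add by (try apply Nat.mod_upper_bound; lia).
  rewrite zmul_add, zmul_assoc.
  destruct (zmul (zmul (zeta (fst x)) (zeta (fst r))) w) as [[[? ?] ?] ?],
    (zmul (zeta (fst x)) (snd r)) as [[[? ?] ?] ?], (snd x) as [[[? ?] ?] ?].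
  unfold zadd. repeat apply (f_equal2 pair); ring.
Qed.

Definition base_pot b y s t0 (x : zpl) : Prop :=
  pot b y (lin s * lin t0)%C (act (plac s t0 zid) (ev (pt 1))) (vz zid (pt 1))
    (act (plac s t0 x) (ev (pt 1))) (vz x (pt 1)).

Lemma base_pot_nbr T D s t0 b y x i j : setup T D s t0 -> is_b D b -> is_y D y ->
  coords T t0 x -> (i < 14)%nat -> (j < 14)%nat -> coords T t0 (zcomp x (nbr0 i j)) ->
  base_pot b y s t0 x -> base_pot b y s t0 (zcomp x (nbr0 i j)).
Proof.
  intros S Hb Hy Hx Hi Hj Hx' P.
  destruct (edges_share_deco _ _ (good_edges _ x i j (setup_good _ _ _ _ S) Hx Hi Hj Hx')) as (w
    & w' & Hw & Hw' & E).
  pose proof (tile_pot T D s t0 b y x w S Hb Hy Hx Hw) as P1.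
  pose proof (tile_pot T D s t0 b y _ w' S Hb Hy Hx' Hw') as P2.
  unfold base_pot. eapply pot_trans; [exact P|]. eapply pot_trans; [exact P1|].
  apply pot_sym. rewrite !plac_act in * by (apply Hx || apply Hx').
  rewrite (vz_zcomp x (nbr0 i j) w'), <- E in P2 by (apply Hx || apply nbr0_lt). exact P2.
Qed.

Lemma D_base_pot T D s t0 b y h : setup T D s t0 -> is_b D b -> is_y D y -> D h ->
  exists x, coords T t0 x /\ near (coords T t0) x /\ base_pot b y s t0 x /\ h = plac s t0 x.
Proof.
  intros S Hb Hy Hh. apply (D_plac T D s t0 S (base_pot b y s t0)); [apply pot_refl| |easy].
  intros x i j Hx _ P Hi Hj Hx'. now apply (base_pot_nbr T D).
Qed.

Definition hc0 : zz := zsub (zadd (pt 1) (pt 5)) (pt 3).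
Lemma hex_center_vz x : hex_center x = vz x hc0.
Proof. reflexivity. Qed.

(** [ypart] is additive, and the vertices of a regular hexagon sum to six times its centre. *)
Lemma ev_ypart_sum x : sumC (map (fun w => ev (ypart (vz x w))) hex_points) = (RtoC 6 * ev (ypart
  (hex_center x)))%C.
Proof.
  replace (RtoC 6) with (RtoC (IZR 6)) by easy. rewrite <- ev_scale, <- ypart_scale.
  unfold hex_points, sumC. cbn [map fold_right]. rewrite <- ev_zero, <- !ev_add.
  replace zzero with (ypart zzero) by reflexivity. rewrite <- !ypart_add. do 2 f_equal.
  rewrite hex_center_vz. unfold vz. destruct (zt (fst x)) as [[[? ?] ?] ?], (snd x) as [[[? ?] ?]
    ?].
  zz_const (pt 1). zz_const (pt 3). zz_const (pt 5). zz_const (pt 7). zz_const (pt 9).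
  zz_const pz. zz_const hc0.
  zz_cbv. repeat apply (f_equal2 pair); ring.
Qed.

(** A vertex of a yellow hex differs from its centre by a vector of the yellow lattice, which has no
    blue component. *)
Lemma bpart_center x : (fst x < 12)%nat -> Nat.even (fst x) = true ->
  bpart (vz x (pt 1)) = bpart (hex_center x).
Proof.
  intros Hx Ex.
  assert (E : zsub (bpart (vz x (pt 1))) (bpart (hex_center x)) = zzero).
  { rewrite <- bpart_sub, hex_center_vz, vz_sub, zt_spec by easy.
    rewrite (proj1 (parts_rot _ _ Ex)). replace (bpart (zsub (pt 1) hc0)) with zzero
      by reflexivity.
    destruct (zeta (fst x)) as [[[? ?] ?] ?]. zz_cbv. repeat apply (f_equal2 pair); ring. }
  destruct (bpart (vz x (pt 1))) as [[[a0 a1] a2] a3], (bpart (hex_center x)) as [[[b0 b1] b2]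
    b3].
  unfold zsub, zadd, zscale, zzero in E. apply pair_equal_spec in E. destruct E as [E E3].
  apply pair_equal_spec in E. destruct E as [E E2]. apply pair_equal_spec in E.
  repeat apply (f_equal2 pair); lia.
Qed.

Lemma hex_center_rel x x' : (fst x < 12)%nat -> (fst x' < 12)%nat ->
  zsub (hex_center x') (hex_center x) =
  zmul (zeta (fst x)) (zsub (hex_center (zrel x x')) (hex_center zid)).
Proof.
  intros Hx Hx'. rewrite <- (zcomp_zrel x x') at 1 by easy.
  rewrite !hex_center_vz, vz_zcomp, vz_sub, zt_spec by (easy || (unfold zrel; apply zcomp_lt)).
  replace (vz zid hc0) with hc0 by reflexivity. reflexivity.
Qed.

Lemma sumC_affine (f g : zz -> C) (u k : C) (ws : list zz) :
  (forall w, In w ws -> f w = (u + k * g w)%C) ->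
  sumC (map f ws) = (RtoC (INR (length ws)) * u + k * sumC (map g ws))%C.
Proof.
  induction ws as [|w ws IH]; intros H.
  - simpl. ring.
  - cbn [map sumC fold_right length]. fold (sumC (map f ws)). fold (sumC (map g ws)).
    rewrite IH by (intros; apply H; now right). rewrite (H w) by now left.
    rewrite S_INR, RtoC_plus. ring.
Qed.

Lemma dot_value T D s t0 b y bh x : setup T D s t0 ->
  (forall h, yellow_hex D h -> is_dot b h (bh h)) ->
  coords T t0 x -> base_pot b y s t0 x -> Nat.even (fst x) = true ->
  bh (plac s t0 x) = (b (act (plac s t0 zid) (ev (pt 1))) +
    RtoC (1 / 2) * (lin s * lin t0) * (ev (bpart (hex_center x)) - ev (bpart (vz zid (pt 1)))))%C.
Proof.
  intros S Hbh Hx [P _] Ex.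
  assert (Hin : In (act (plac s t0 x) (ev (pt 1))) (hex (plac s t0 x))).
  { unfold hex. rewrite spectre_hex_eq. apply in_map, in_map. now left. }
  pose proof (Hbh (plac s t0 x) (plac_odd T D s t0 x S Hx Ex) _ Hin) as E. rewrite <- E.
  rewrite (bpart_center x (proj1 Hx) Ex) in P. rewrite <- P. ring.
Qed.

(** [yh] is known only as the centre of the image hexagon, so it is computed as the mean of the
    values of y at the six vertices. *)
Lemma center_value T D s t0 b y yh x : setup T D s t0 -> is_b D b -> is_y D y ->
  (forall h, yellow_hex D h -> maps_hex_to y h (yh h)) ->
  coords T t0 x -> base_pot b y s t0 x -> Nat.even (fst x) = true ->
  yh (plac s t0 x) = (y (act (plac s t0 zid) (ev (pt 1))) +
    ev (zeta 11) * (RtoC (1 / 2) * (lin s * lin t0)) * (ev (ypart (hex_center x)) - ev (ypart (vz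
      zid (pt 1)))))%C.
Proof.
  intros S Hb Hy Hyh Hx P Ex.
  pose proof (maps_hex_sum _ _ _ (Hyh (plac s t0 x) (plac_odd T D s t0 x S Hx Ex))) as M.
  unfold hex in M. rewrite spectre_hex_eq, !map_map in M.
  set (y0 := y (act (plac s t0 zid) (ev (pt 1)))) in *.
  set (k := (ev (zeta 11) * (RtoC (1 / 2) * (lin s * lin t0)))%C) in *.
  rewrite (sumC_affine _ (fun w => ev (ypart (vz x w))) (y0 - k * ev (ypart (vz zid (pt 1)))) k)
    in M.
  - rewrite ev_ypart_sum in M. change (length hex_points) with 6%nat in M.
    replace (INR 6) with 6 in M by (simpl; ring).
    assert (Hc : forall u v : C, (RtoC 6 * u = RtoC 6 * v)%C -> u = v).
    { intros u v E. transitivity (RtoC (/ 6) * (RtoC 6 * u))%C; [|rewrite E];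
        apply injective_projections; simpl; field. }
    apply Hc. rewrite <- M. ev_ring.
  - intros w Hw.
    assert (Hw' : In w deco_points) by (revert Hw; unfold hex_points, deco_points; simpl; tauto).
    destruct (pot_trans _ _ _ _ _ _ _ _ _ P (tile_pot T D s t0 b y x w S Hb Hy Hx Hw')) as [_ E].
    fold y0 k in E.
    replace (y (act (plac s t0 x) (ev w))) with (y0 + (y (act (plac s t0 x) (ev w)) - y0))%C
      by ring.
    rewrite E. ev_ring.
Qed.

Lemma sq_eq_1 (a : R) : 0 <= a -> a ^ 2 = 1 -> a = 1.
Proof. nra. Qed.

(** With L = [lin s * lin t0], a decoration edge has length |L| sqrt 2, since alpha has squared
    modulus 2. Normalisation makes it 1 / sqrt 3, so |L|^2 = 1/6. *)
Lemma setup_scale T D s t0 : setup T D s t0 -> normalised D ->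
  Cmod (RtoC (1 / 2) * (lin s * lin t0)) ^ 2 = / 24.
Proof.
  intros S [Hn _].
  destruct (hex_side_ex s t0 zid 0) as (v & w & Hs & Hv); [simpl; lia|easy|].
  assert (Hd : decoration_edge D v w).
  { exists (plac s t0 zid). split; [apply (plac_D T);
      [easy|now apply (coords_zid T D s)]|now left]. }
  apply Hn in Hd. rewrite Hv in Hd. unfold edge_vec in Hd.
  rewrite !Cmod_mult, Cmod_zeta, Rmult_1_r in Hd.
  assert (A : Cmod (ev alpha) ^ 2 = 2) by (apply znorm_Cmod; reflexivity).
  rewrite !Cmod_mult, Cmod_R, Rabs_pos_eq by lra.
  set (m := Cmod (lin s) * Cmod (lin t0)) in *.
  assert (E : m ^ 2 * 2 = 1 / 3).
  { rewrite <- A, <- Rpow_mult_distr, Hd. fold q3. pose proof q3_sq. pose proof q3_pos.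
    replace ((1 / q3) ^ 2) with (1 / (q3 * q3)) by (field; lra). now rewrite H. }
  replace ((1 / 2 * m) ^ 2) with (m ^ 2 * 2 / 8) by field. rewrite E. field.
Qed.

Lemma ev_sqrt3 a : ev (sqrt3 a) = (RtoC q3 * ev a)%C.
Proof.
  assert (E : ev (0, 2, 0, -1)%Z = RtoC q3) by (apply injective_projections; simpl; field).
  unfold sqrt3. replace (zadd (zeta 1) (zeta 11)) with ((0, 2, 0, -1)%Z : zz) by reflexivity.
  now rewrite ev_mul, E.
Qed.

Lemma sq_mod u a n : Cmod u ^ 2 = / 24 -> Cmod (ev a) ^ 2 = IZR n -> Cmod (u * ev a)%C ^ 2 = IZR
  n / 24.
Proof. intros H1 H2. rewrite Cmod_mult, Rpow_mult_distr, H1, H2. field. Qed.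

(** * Invariance of b - 3 y - rho^2 g *)

Definition height (bh yh gh : placement -> C) (h : placement) : C :=
  (bh h - (RtoC 3 * yh h + rho ^ 2 * gh h))%C.

Lemma own_cluster D bh yh h : yellow_hex D h ->
  yellow_cluster D bh yh (cluster_of D bh yh h) /\ cluster_of D bh yh h h.
Proof. intros H. split; [now exists h|]. split; [easy|apply rst_refl]. Qed.

Lemma V_step_height D bh yh gh (G : (placement -> Prop) -> C) h h' :
  (forall K h, yellow_cluster D bh yh K -> K h -> gh h = G K) ->
  yellow_hex D h -> yellow_hex D h' -> Cmod (yh h' - yh h)%C = 1 ->
  (bh h' - bh h)%C = (RtoC 3 * (yh h' - yh h))%C ->
  height bh yh gh h' = height bh yh gh h.
Proof.
  intros Hg Hh Hh' Hy Hb.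
  assert (V : V_interface D bh yh h h').
  { split; [now split|]. rewrite Hb, Cmod_mult, Cmod_R, Hy, Rabs_pos_eq by lra. ring. }
  destruct (own_cluster D bh yh h Hh) as [K1 K2].
  assert (E : gh h' = gh h).
  { rewrite (Hg _ h K1 K2). apply (Hg _ h' K1). split; [easy|]. now apply rst_step. }
  unfold height. rewrite E. replace (bh h') with (bh h + (bh h' - bh h))%C by ring. rewrite Hb.
  ring.
Qed.

(** The condition on I-type interfaces gives only the direction of the increment of g; its length 1
    / sqrt 3 comes from adjacency in the honeycomb. *)
Lemma I_step_height D bh yh gh (G : (placement -> Prop) -> C) h h' :
  is_G D bh yh G ->
  (forall K h, yellow_cluster D bh yh K -> K h -> gh h = G K) ->
  yellow_hex D h -> yellow_hex D h' -> Cmod (yh h' - yh h)%C = 1 ->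
  Cmod (bh h' - bh h)%C ^ 2 = 19 / 3 ->
  (bh h' - bh h)%C = (RtoC 3 * (yh h' - yh h) + rho ^ 2 * (RtoC (/ q3) * (ev (zeta 1) * (yh h' -
    yh h))))%C ->
  height bh yh gh h' = height bh yh gh h.
Proof.
  intros (_ & _ & _ & G1 & G2) Hg Hh Hh' Hy H19 Hb.
  assert (I : I_interface D bh yh h h') by (split; [now split|easy]).
  destruct (own_cluster D bh yh h Hh) as [K1 K2].
  destruct (own_cluster D bh yh h' Hh') as [K1' K2'].
  assert (L : honeycomb_edge (G (cluster_of D bh yh h)) (G (cluster_of D bh yh h'))).
  { apply G1; [easy|easy|]. now exists h, h'. }
  apply honeycomb_edge_length in L.
  destruct (G2 _ _ h h' K1 K1' K2 K2' I) as (r & Hr & E).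
  rewrite <- (Hg _ h K1 K2), <- (Hg _ h' K1' K2') in E, L.
  rewrite E, !Cmod_mult, Cmod_R, Cmod_cis, Hy, Rabs_pos_eq in L by lra.
  assert (Er : r = / q3) by lra.
  assert (E1 : cis (PI / 6) = ev (zeta 1)) by (rewrite <- cis_zeta; f_equal; simpl; ring).
  rewrite Er, E1 in E. unfold height.
  replace (bh h') with (bh h + (bh h' - bh h))%C by ring.
  replace (gh h') with (gh h + (gh h' - gh h))%C by ring. rewrite Hb, E. ring.
Qed.

Lemma step_height T D s t0 b y bh yh gh G x x' : setup T D s t0 -> normalised D ->
  is_b D b -> is_y D y ->
  (forall h, yellow_hex D h -> is_dot b h (bh h)) ->
  (forall h, yellow_hex D h -> maps_hex_to y h (yh h)) ->
  is_G D bh yh G -> (forall K h, yellow_cluster D bh yh K -> K h -> gh h = G K) ->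
  (forall z, coords T t0 z -> base_pot b y s t0 z) ->
  step (coords T t0) x x' ->
  height bh yh gh (plac s t0 x') = height bh yh gh (plac s t0 x).
Proof.
  intros S Hn Hb Hy Hbh Hyh HG Hg HP (Hx & Hx' & Ex & Ex' & Hs).
  pose proof (dot_value T D s t0 b y bh x S Hbh Hx (HP x Hx) Ex) as B.
  pose proof (dot_value T D s t0 b y bh x' S Hbh Hx' (HP x' Hx') Ex') as B'.
  pose proof (center_value T D s t0 b y yh x S Hb Hy Hyh Hx (HP x Hx) Ex) as Y.
  pose proof (center_value T D s t0 b y yh x' S Hb Hy Hyh Hx' (HP x' Hx') Ex') as Y'.
  pose proof (plac_odd T D s t0 x S Hx Ex) as O.
  pose proof (plac_odd T D s t0 x' S Hx' Ex') as O'.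
  set (d := zsub (hex_center (zrel x x')) (hex_center zid)).
  pose proof (hex_center_rel x x' (proj1 Hx) (proj1 Hx')) as HC. fold d in HC.
  destruct (parts_rot _ d Ex) as [Rb Ry].
  set (U := (RtoC (1 / 2) * (lin s * lin t0))%C) in *.
  assert (MU : Cmod (U * ev (zeta (fst x))) ^ 2 = / 24).
  { rewrite Cmod_mult, Cmod_zeta, Rmult_1_r. now apply (setup_scale T D). }
  assert (DB : (bh (plac s t0 x') - bh (plac s t0 x))%C = (U * ev (zeta (fst x)) * ev (bpart
    d))%C).
  { rewrite B, B'.
    transitivity (U * (ev (bpart (hex_center x')) - ev (bpart (hex_center x))))%C; [ev_ring|].
    rewrite <- ev_sub, <- bpart_sub, HC, Rb, ev_mul. ev_ring. }
  assert (DY : (yh (plac s t0 x') - yh (plac s t0 x))%C = (ev (zeta 11) * (U * ev (zeta (fst x))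
    * ev (ypart d)))%C).
  { rewrite Y, Y'.
    transitivity (ev (zeta 11) * U * (ev (ypart (hex_center x')) - ev (ypart (hex_center x))))%C;
      [ev_ring|].
    rewrite <- ev_sub, <- ypart_sub, HC, Ry, ev_mul. ev_ring. }
  clear B B' Y Y'. set (W := (U * ev (zeta (fst x)))%C) in *.
  assert (NY : znorm (ypart d) = (24, 0, 0, 0)%Z -> Cmod (yh (plac s t0 x') - yh (plac s t0 x))%C
    = 1).
  { intros N. apply sq_eq_1; [apply Cmod_ge_0|].
    rewrite DY, Cmod_mult, Cmod_zeta, Rmult_1_l, (sq_mod _ _ 24 MU); [field|].
    now apply znorm_Cmod. }
  unfold stepb in Hs. fold d in Hs. apply orb_true_iff in Hs. destruct Hs as [Hs|Hs].
  - unfold V_stepb in Hs. rewrite andb_true_iff, !zz_eqb_eq in Hs. destruct Hs as [H1 H2].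
    apply (V_step_height D bh yh gh G); auto.
    rewrite DB, DY, H1, ev_scale, ev_mul. ev_ring.
  - unfold I_stepb in Hs. rewrite !andb_true_iff, !zz_eqb_eq in Hs. destruct Hs as [[H1 H2] H3].
    apply (I_step_height D bh yh gh G); auto.
    + rewrite DB, (sq_mod _ _ 152 MU); [field|]. now apply znorm_Cmod.
    + apply (f_equal ev) in H1. rewrite ev_add, !ev_sqrt3, ev_scale, !ev_mul in H1.
      pose proof q3_pos as Hq.
      assert (Hq0 : RtoC q3 <> RtoC 0) by (intros E; injection E; lra).
      assert (E2 : ev (bpart d) = (RtoC 3 * (ev (zeta 11) * ev (ypart d)) + RtoC (/ q3) * (ev
        (zeta 4) * ev (ypart d)))%C).
      { rewrite RtoC_inv by lra.
        transitivity (/ RtoC q3 * (RtoC q3 * ev (bpart d)))%C; [field; easy|]. rewrite H1.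
        revert Hq0. generalize (RtoC q3) (ev (zeta 11)) (ev (ypart d)) (ev (zeta 4)). intros.
        field. easy. }
      (* The rotation exp (i pi / 6) in the direction of the increment of g cancels the rotation exp
         (- i pi / 6) in the increment of y. *)
      assert (E4 : (ev (zeta 1) * ev (zeta 11))%C = RtoC 1).
      { rewrite <- ev_mul, <- ev_one. reflexivity. }
      rewrite DB, DY, E2, rho_pow. change (zeta (2 * 2)) with (zeta 4).
      transitivity (RtoC 3 * (ev (zeta 11) * (W * ev (ypart d))) +
        ev (zeta 4) * (RtoC (/ q3) * ((ev (zeta 1) * ev (zeta 11)) * (W * ev (ypart d)))))%C;
          [|ev_ring].
      rewrite E4. ev_ring.
Qed.

Theorem proposition56
  (T : placement -> Prop) (hT : spectre_tiling T)
  (s : placement) (hs : lin s <> RtoC 0)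
  (D : placement -> Prop) (hD : D = image_tiling s T) (hn : normalised D)
  (b : C -> C) (hb : is_b D b)
  (y : C -> C) (hy : is_y D y)
  (bh : placement -> C)
  (hbh : forall h, yellow_hex D h -> is_dot b h (bh h))
  (yh : placement -> C)
  (hyh : forall h, yellow_hex D h -> maps_hex_to y h (yh h))
  (G : (placement -> Prop) -> C) (hG : is_G D bh yh G)
  (gh : placement -> C)
  (hgh : forall K h, yellow_cluster D bh yh K -> K h -> gh h = G K)
  (h0 : placement) (hh0 : yellow_hex D h0)
  (h : placement) (hh : yellow_hex D h) :
  (bh h - bh h0 = RtoC 3 * (yh h - yh h0) + rho ^ 2 * (gh h - gh h0))%C.
Proof.
  (* The tile of h0 is taken as the reference odd tile, with code [zid]. *)
  assert (S : exists t0, setup T D s t0 /\ h0 = compose s t0).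
  { assert (H0 := proj1 hh0). rewrite hD in H0. destruct H0 as (t0 & Ht0 & E0). exists t0.
    split; [|easy]. split; auto; [now apply spectre_tiling_tiling|now rewrite <- E0]. }
  destruct S as (t0 & S & E0). rewrite <- (plac_zid s t0) in E0.
  (* The induction over tiles provides some code with the property; injectivity of [plac] identifies
     it with z. *)
  assert (HP : forall z, coords T t0 z -> base_pot b y s t0 z).
  { intros z Hz. destruct (D_base_pot T D s t0 b y _ S hb hy (plac_D _ _ _ _ _ S Hz)) as (z' &
      Hz' & _ & P & E).
    apply (plac_inj T D s t0) in E; auto. now subst z'. }
  destruct (D_coords T D s t0 h S (proj1 hh)) as (x & Hx & Nx & ->).
  assert (Ex := odd_plac_even T D s t0 x S Hx hh).
  assert (L := near_odd _ x (setup_good _ _ _ _ S) Nx Ex).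
  assert (E : height bh yh gh (plac s t0 x) = height bh yh gh (plac s t0 zid)).
  { assert (A : forall u v, linked (coords T t0) u v ->
      height bh yh gh (plac s t0 v) = height bh yh gh (plac s t0 u)).
    { induction 1 as [u v H|u|u v _ IH|u v w _ IH1 _ IH2]; [|easy|easy|congruence].
      now apply (step_height T D s t0 b y bh yh gh G). }
    now apply A. }
  rewrite E0. unfold height in E.
  replace (bh (plac s t0 x)) with
    (bh (plac s t0 x) - (RtoC 3 * yh (plac s t0 x) + rho ^ 2 * gh (plac s t0 x)) +
     (RtoC 3 * yh (plac s t0 x) + rho ^ 2 * gh (plac s t0 x)))%C by ring.
  rewrite E. ring.
Qed.
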